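(* Let $\Sigma$ be a simply-connected Riemann surface. Let $g:\Sigma\to\mathbb{H}^2$ be a harmonic map that is nowhere antiholomorphic. Let $z_0\in\Sigma$, $F_0\in\mathbb{C}$ and $h_0\in\mathbb{R}$. Then there exists a unique conformal minimal immersion $X:\Sigma\to\mathrm{Nil}_3$ such that $g$ is the Gauss map of $X$ and $X(z_0)=(F_0,h_0)$. Moreover, writing $X=(F,h)$, the immersion satisfies, in any local conformal coordinate $z$, $$F_z=-4i\frac{g_z}{(1-|g|^2)^2},\qquad F_{\bar z}=-4i\frac{g^2\,\bar g_{\bar z}}{(1-|g|^2)^2},$$ $$h_z=4i\frac{\bar g\,g_z}{(1-|g|^2)^2}-\frac i4\left(\bar F F_z-F\bar F_z\right).$$
   Context: The Heisenberg group $\mathrm{Nil}_3$ is $\mathbb{R}^3$ with coordinates $(x_1,x_2,x_3)$ and the Riemannian metric $$dx_1^2+dx_2^2+\left(\tfrac12(x_2\,dx_1-x_1\,dx_2)+dx_3\right)^2 .$$ The canonical left-invariant orthonormal frame is $E_1=\frac{\partial}{\partial x_1}-\frac{x_2}{2}\frac{\partial}{\partial x_3}$, $E_2=\frac{\partial}{\partial x_2}+\frac{x_1}{2}\frac{\partial}{\partial x_3}$, $E_3=\frac{\partial}{\partial x_3}$, and $\mathrm{Nil}_3$ is oriented so that this frame is positive. Tangent vectors are identified with elements of the Lie algebra by left multiplication, i.e. with their coordinates in the frame $(E_1,E_2,E_3)$. Points of $\mathrm{Nil}_3$ are written $(F,h)$ with $F=x_1+ix_2\in\mathbb{C}$ and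 $h=x_3\in\mathbb{R}$. For a conformal immersion $X:\Sigma\to\mathrm{Nil}_3$ of an oriented Riemann surface, with conformal coordinate $z=u+iv$, the unit normal $N$ is the normalization of $X_u\times X_v$, regarded as a map $N:\Sigma\to\mathbb{S}^2$ into the unit sphere of the Lie algebra. The Gauss map of $X$ is the map $g:\Sigma\to\bar{\mathbb{C}}=\mathbb{C}\cup\{\infty\}$ obtained by stereographic projection of $N$ from the southern pole, i.e. in the frame $(E_1,E_2,E_3)$ $$N=\frac{1}{1+|g|^2}\bigl(2\,\mathrm{Re}\,g,\;2\,\mathrm{Im}\,g,\;1-|g|^2\bigr).$$ The hyperbolic plane is the Poincaré disk $\mathbb{H}^2=\{z\in\mathbb{C}:|z|<1\}$ with the metric $\frac{4|dz|^2}{(1-|z|^2)^2}$. A map $g:\Sigma\to\mathbb{H}^2$ is nowhere antiholomorphic if $g_z$ does not vanish at any point. Subscripts $z,\bar z$ denote $\partial_z=\frac12(\partial_u-i\partial_v)$ and $\partial_{\bar z}=\frac12(\partial_u+i\partial_v)$; $\bar F_z$ and $\bar g_{\bar z}$ mean $(\bar F)_z$ and $(\bar g)_{\bar z}$. *)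

(* Defs.v *)
From HB Require Import structures.
From mathcomp Require Import all_boot all_order all_algebra.
From mathcomp Require Import all_classical all_reals all_analysis.
From mathcomp Require Export complex.

Set Implicit Arguments.
Unset Strict Implicit.
Unset Printing Implicit Defensive.

Import Order.TTheory GRing.Theory Num.Theory.
Import numFieldNormedType.Exports.

Local Open Scope classical_set_scope.
Local Open Scope ring_scope.
Local Open Scope complex_scope.

(* R[i]^o is R[i] with the topology of its norm; only the values of    *)
(* chart_map on chart_dom and of chart_inv on chart_cod are meaningful. *)
Record chart (R : realType) (T : topologicalType) := Chart {
  chart_dom : set T;
  chart_cod : set R[i]^o;
  chart_map : T -> R[i]^o;
  chart_inv : R[i]^o -> T;
  chart_dom_open : open chart_dom;
  chart_cod_open : open chart_cod;
  chart_mapP : forall p, chart_dom p -> chart_cod (chart_map p);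
  chart_invP : forall z, chart_cod z -> chart_dom (chart_inv z);
  chart_mapK : forall p, chart_dom p -> chart_inv (chart_map p) = p;
  chart_invK : forall z, chart_cod z -> chart_map (chart_inv z) = z;
  chart_map_cont : forall p, chart_dom p -> {for p, continuous chart_map};
  chart_inv_cont : forall z, chart_cod z -> {for z, continuous chart_inv}
}.

(* Derivability over the field R[i], i.e. complex differentiability.   *)
Definition holomorphic_transition (R : realType) (T : topologicalType)
    (a b : chart R T) : Prop :=
  forall z : R[i]^o, chart_cod a z -> chart_dom b (chart_inv a z) ->
    derivable (chart_map b \o chart_inv a) z 1.

(* The members of the (maximal) atlas are the local conformal           *)
(* coordinates.                                                        *)
Record riemann_surface (R : realType) := RiemannSurface {
  surface_space :> topologicalType;
  surface_hausdorff : hausdorff_space surface_space;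
  atlas : set (chart R surface_space);
  atlas_cover : forall p, exists2 c, atlas c & chart_dom c p;
  atlas_compatible : forall a b, atlas a -> atlas b ->
    holomorphic_transition a b;
  atlas_maximal : forall c,
    (forall a, atlas a ->
       holomorphic_transition a c /\ holomorphic_transition c a) ->
    atlas c
}.

Definition path_connected (R : realType) (T : topologicalType) : Prop :=
  forall p q : T, exists gamma : R -> T,
    [/\ {within `[0, 1], continuous gamma}, gamma 0 = p & gamma 1 = q].

Definition null_homotopic_loop (R : realType) (T : topologicalType)
    (gamma : R -> T) : Prop :=
  exists H : R * R -> T,
    [/\ {within `[0, 1] `*` `[0, 1], continuous H},
        forall t, t \in `[0, 1] -> H (0, t) = gamma t,
        forall t, t \in `[0, 1] -> H (1, t) = gamma 0 &
        forall s, s \in `[0, 1] -> H (s, 0) = gamma 0 /\ H (s, 1) = gamma 0].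

Definition simply_connected (R : realType) (T : topologicalType) : Prop :=
  path_connected R T /\
  forall gamma : R -> T,
    {within `[0, 1], continuous gamma} -> gamma 0 = gamma 1 ->
    null_homotopic_loop gamma.

(* Derivative in the real direction e; e = 1 gives d/du, e = i gives d/dv. *)
Definition on_line (R : realType) (e : R[i]) (f : R[i] -> R) (z : R[i])
  : R -> R := fun t => f (z + t%:C * e).

Definition partial (R : realType) (e : R[i]) (f : R[i] -> R) (z : R[i]) : R :=
  derive1 (on_line e f z) 0.

Definition has_partial (R : realType) (e : R[i]) (f : R[i] -> R) (z : R[i])
  : Prop := derivable (on_line e f z) 0 1.

Fixpoint Ck_on (R : realType) (k : nat) (D : set R[i]^o) (f : R[i] -> R)
  : Prop :=
  (forall z : R[i]^o, D z -> {for z, continuous (f : R[i]^o -> R)}) /\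
  (if k is k'.+1 then
     [/\ forall z : R[i], D z -> has_partial 1 f z /\ has_partial 'i%C f z,
         Ck_on k' D (partial 1 f) & Ck_on k' D (partial 'i%C f)]
   else True).

Definition smooth_on (R : realType) (D : set R[i]^o) (f : R[i] -> R) : Prop :=
  forall k, Ck_on k D f.

Definition cpartial (R : realType) (e : R[i]) (f : R[i] -> R[i]) (z : R[i])
  : R[i] :=
  partial e (fun w => complex.Re (f w)) z
  +i* partial e (fun w => complex.Im (f w)) z.

Definition dz (R : realType) (f : R[i] -> R[i]) (z : R[i]) : R[i] :=
  2^-1 * (cpartial 1 f z - 'i%C * cpartial 'i%C f z).

Definition dzbar (R : realType) (f : R[i] -> R[i]) (z : R[i]) : R[i] :=
  2^-1 * (cpartial 1 f z + 'i%C * cpartial 'i%C f z).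

Definition vpartial (R : realType) (n : nat) (e : R[i])
    (X : R[i] -> 'rV[R]_n) (z : R[i]) : 'rV[R]_n :=
  \row_k partial e (fun w => X w 0 k) z.

Definition inner (R : realType) (n : nat) (G : 'rV[R]_n -> 'M[R]_n)
    (x v w : 'rV[R]_n) : R := (v *m G x *m w^T) 0 0.

Definition christoffel (R : realType) (n : nat) (G : 'rV[R]_n -> 'M[R]_n)
    (x : 'rV[R]_n) (k i j : 'I_n) : R :=
  let dG (m a b : 'I_n) : R :=
    'D_(delta_mx 0 m : 'rV[R]_n) (fun y : 'rV[R]_n => G y a b) x in
  2^-1 * \sum_(l < n)
    invmx (G x) k l * (dG i j l + dG j i l - dG l i j).

(* Covariant derivative along X, in the direction a, of the field      *)
(* dX(b), for the Levi-Civita connection of G.                         *)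
Definition nabla (R : realType) (n : nat) (G : 'rV[R]_n -> 'M[R]_n)
    (X : R[i] -> 'rV[R]_n) (a b : R[i]) (z : R[i]) : 'rV[R]_n :=
  vpartial a (vpartial b X) z +
  \row_k \sum_(i < n) \sum_(j < n)
    christoffel G (X z) k i j * vpartial a X z 0 i * vpartial b X z 0 j.

(* Tension field for the flat metric du^2 + dv^2 of the coordinate; for *)
(* any other conformal metric on the surface it is only multiplied by a *)
(* positive function.                                                  *)
Definition tension (R : realType) (n : nat) (G : 'rV[R]_n -> 'M[R]_n)
    (X : R[i] -> 'rV[R]_n) (z : R[i]) : 'rV[R]_n :=
  nabla G X 1 1 z + nabla G X 'i%C 'i%C z.

Definition coord_dir (R : realType) (a : 'I_2) : R[i] := [:: 1; 'i%C]`_a.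

Definition jacobian (R : realType) (n : nat) (X : R[i] -> 'rV[R]_n)
    (z : R[i]) : 'M[R]_(2, n) :=
  \matrix_(a < 2) vpartial (coord_dir R a) X z.

Definition first_form (R : realType) (n : nat) (G : 'rV[R]_n -> 'M[R]_n)
    (X : R[i] -> 'rV[R]_n) (z : R[i]) : 'M[R]_2 :=
  \matrix_(a < 2, b < 2)
    inner G (X z) (vpartial (coord_dir R a) X z) (vpartial (coord_dir R b) X z).

Definition second_form (R : realType) (n : nat) (G : 'rV[R]_n -> 'M[R]_n)
    (X : R[i] -> 'rV[R]_n) (nu : 'rV[R]_n) (z : R[i]) : 'M[R]_2 :=
  \matrix_(a < 2, b < 2)
    inner G (X z) (nabla G X (coord_dir R a) (coord_dir R b) z) nu.

Definition mean_curvature (R : realType) (n : nat) (G : 'rV[R]_n -> 'M[R]_n)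
    (X : R[i] -> 'rV[R]_n) (nu : 'rV[R]_n) (z : R[i]) : R :=
  2^-1 * \tr (invmx (first_form G X z) *m second_form G X nu z).

Definition plane_point (R : realType) (z : R[i]) : 'rV[R]_2 :=
  \row_(k < 2) [:: complex.Re z; complex.Im z]`_k.

Definition poincare_metric (R : realType) (x : 'rV[R]_2) : 'M[R]_2 :=
  (4 / (1 - (x 0 0 ^+ 2 + x 0 1 ^+ 2)) ^+ 2)%:M.

Definition harmonic_disk_map (R : realType) (S : riemann_surface R)
    (g : S -> R[i]) : Prop :=
  [/\ forall p, `|g p| < 1,
      forall c, atlas c ->
        smooth_on (chart_cod c) (fun z => complex.Re (g (chart_inv c z))) /\
        smooth_on (chart_cod c) (fun z => complex.Im (g (chart_inv c z))) &
      forall c z, atlas c -> chart_cod c z ->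
        tension (@poincare_metric R) (fun w => plane_point (g (chart_inv c w))) z
        = 0].

Definition nowhere_antiholomorphic (R : realType) (S : riemann_surface R)
    (g : S -> R[i]) : Prop :=
  forall c z, atlas c -> chart_cod c z ->
    dz (fun w => g (chart_inv c w)) z != 0.

(* The Heisenberg group; the point (x1, x2, x3) is the row vector with  *)
(* entries x 0 0, x 0 1, x 0 2.                                         *)

Definition nil_F (R : realType) (x : 'rV[R]_3) : R[i] := x 0 0 +i* x 0 1.
Definition nil_h (R : realType) (x : 'rV[R]_3) : R := x 0 2.

Definition nil3_metric (R : realType) (x : 'rV[R]_3) : 'M[R]_3 :=
  let dx (k : 'I_3) : 'rV[R]_3 := delta_mx 0 k in
  let omega := 2^-1 *: (x 0 1 *: dx 0 - x 0 0 *: dx 1) + dx 2 in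
  (dx 0)^T *m dx 0 + (dx 1)^T *m dx 1 + omega^T *m omega.

(* The rows are the coordinates of E1, E2, E3 at x.                    *)
Definition nil3_frame (R : realType) (x : 'rV[R]_3) : 'M[R]_3 :=
  let d (k : 'I_3) : 'rV[R]_3 := delta_mx 0 k in
  \matrix_(k < 3) [:: d 0 - (x 0 1 / 2) *: d 2;
                      d 1 + (x 0 0 / 2) *: d 2;
                      d 2]`_k.

Definition frame_coord (R : realType) (x v : 'rV[R]_3) : 'rV[R]_3 :=
  v *m invmx (nil3_frame x).

Definition cross (R : realType) (a b : 'rV[R]_3) : 'rV[R]_3 :=
  \row_(k < 3) [:: a 0 1 * b 0 2 - a 0 2 * b 0 1;
                   a 0 2 * b 0 0 - a 0 0 * b 0 2;
                   a 0 0 * b 0 1 - a 0 1 * b 0 0]`_k.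

Definition normalize (R : realType) (v : 'rV[R]_3) : 'rV[R]_3 :=
  (Num.sqrt (\sum_(k < 3) v 0 k ^+ 2))^-1 *: v.

(* In the Lie algebra, i.e. in the frame (E1, E2, E3).                 *)
Definition unit_normal (R : realType) (X : R[i] -> 'rV[R]_3) (z : R[i])
  : 'rV[R]_3 :=
  normalize (cross (frame_coord (X z) (vpartial 1 X z))
                   (frame_coord (X z) (vpartial 'i%C X z))).

Definition conformal_immersion (R : realType) (S : riemann_surface R)
    (X : S -> 'rV[R]_3) : Prop :=
  forall c, atlas c ->
    (forall k, smooth_on (chart_cod c) (fun z => X (chart_inv c z) 0 k)) /\
    forall z, chart_cod c z ->
      let Xc := fun w => X (chart_inv c w) in
      row_free (jacobian Xc z) /\
      exists2 lambda : R, 0 < lambda &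
        first_form (@nil3_metric R) Xc z = lambda%:M.

(* unit_normal *m nil3_frame converts the normal from the frame back to *)
(* the coordinates x1, x2, x3.                                         *)
Definition minimal (R : realType) (S : riemann_surface R)
    (X : S -> 'rV[R]_3) : Prop :=
  forall c z, atlas c -> chart_cod c z ->
    let Xc := fun w => X (chart_inv c w) in
    mean_curvature (@nil3_metric R) Xc
      (unit_normal Xc z *m nil3_frame (Xc z)) z = 0.

(* Inverse of the stereographic projection from the southern pole.     *)
Definition sphere_point (R : realType) (g : R[i]) : 'rV[R]_3 :=
  let m : R := complex.Re g ^+ 2 + complex.Im g ^+ 2 in
  (1 + m)^-1 *: \row_(k < 3) [:: 2 * complex.Re g; 2 * complex.Im g; 1 - m]`_k.

Definition is_gauss_map (R : realType) (S : riemann_surface R)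
    (X : S -> 'rV[R]_3) (g : S -> R[i]) : Prop :=
  forall c z, atlas c -> chart_cod c z ->
    unit_normal (fun w => X (chart_inv c w)) z = sphere_point (g (chart_inv c z)).

(* Main.v *)
Require Import Defs.
From mathcomp Require Import all_boot all_order all_algebra.
From mathcomp Require Import all_classical all_reals all_analysis.
From mathcomp Require Import ring lra.
Set Implicit Arguments.
Unset Strict Implicit.
Unset Printing Implicit Defensive.
Import Order.TTheory GRing.Theory Num.Theory.
Import numFieldNormedType.Exports.
Local Open Scope classical_set_scope.
Local Open Scope ring_scope.
Local Open Scope complex_scope.

(** Let mu = F_z.  In the left-invariant frame X_z = phi1 E1 + phi2 E2 + phi3 E3
    with phi1 + i phi2 = mu.  Conformality makes (phi1, phi2, phi3) isotropic,
    and having Gauss map g makes it orthogonal to N; since |g| < 1 the two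
    conditions together say exactly that
      phi1 - i phi2 = - conj(g)^2 mu,  phi3 = - conj(g) mu,  mu <> 0
    ([isotropic_of_gauss], [gauss_of_isotropic]), so that mu is the only unknown.

    Differentiate these relations in zbar.  The mixed derivatives of x1 and x2
    are real, the bracket [E1, E2] = E3 fixes the imaginary part of
    (phi3)_zbar, and the vanishing of the mean curvature is one more real
    equation.  This linear system has a single solution ([minimal_algebra]),
    and it contains g_z = (i/4) (1 - |g|^2)^2 mu, i.e. the formula for F_z
    ([representation]).  Hence g determines X_z, which gives the three formulas
    and, a surface being path connected, uniqueness ([equal_differential]).

    Conversely define mu by this formula.  The harmonic map equation becomes
    mu_zbar = - (i/2) g |mu|^2 (1 - |g|^2) ([rep_Fz_dzbar]), and this is what
    makes the real forms dx1, dx2, and then dx3, closed ([rep_dzbar],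
    [rep_x3z_dzbar]).  In every chart they are 2 Re (A g_z dz) with A a function
    on the surface, hence they do not depend on the chart, and they have
    primitives on a simply connected surface ([surface_primitive]).  The map
    (x1, x2, x3) has the isotropic X_z above, so it is a conformal immersion
    with Gauss map g ([conformal_of_isotropic]); the same value of mu_zbar
    cancels its mean curvature ([minimal_of_isotropic]).

    Primitives are found on a box by integrating along a horizontal and then a
    vertical segment ([poincare_box]) and are continued along paths. That
    the result depends only on the end points follows from the existence of
    a primitive along any continuous map of a square ([along_square]): on
    the square of a homotopy the increments along the sides add up to zero. *)

(** * Boxes and lines in the complex plane *)
Section Boxes.
Variable R : realType.
Implicit Types (z w e : R[i]) (f : R[i] -> R).

Definition box z (r : R) : set R[i] :=
  [set w | `|complex.Re w - complex.Re z| < r /\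
           `|complex.Im w - complex.Im z| < r].

(** The norm of [R[i]] takes its values in [R[i]], and so do the radii of its
    balls.  Boxes replace them by conditions on two real coordinates, which is
    the form that arguments moving along one axis at a time need. *)
Lemma nbhs_boxP (z : R[i]^o) (D : set R[i]^o) :
  nbhs z D <-> exists2 r : R, 0 < r & box z r `<=` D.
Proof.
split.
- move=> /nbhs_normP[e /= e0 eD].
  have [Ime Ree] : complex.Im e = 0 /\ 0 < complex.Re e.
    by move: e0; rewrite ltcE /= => /andP[/eqP].
  exists (complex.Re e / 2); first by rewrite divr_gt0.
  move=> w [wr wi]; apply: eD => /=.
  rewrite -normrN opprB normc_def ltcE /= Ime eqxx /=.
  rewrite -[X in _ < X]ger0_norm ?ltW// -sqrtr_sqr ltr_sqrt ?exprn_gt0//.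
  have sq (x : R) : `|x| < complex.Re e / 2 -> x ^+ 2 < (complex.Re e / 2) ^+ 2.
    move=> xe; rewrite -real_normK ?num_real// ltr_pXn2r// nnegrE//.
    by rewrite divr_ge0 ?ltW.
  case: w z wr wi => [a b] [c d] /= /sq h1 /sq h2.
  have := ltrD h1 h2 => h; apply: (lt_le_trans h).
  have : 0 <= complex.Re e ^+ 2 by apply: sqr_ge0.
  lra.
- move=> [r r0 rD]; apply/(nbhs_normP z D); exists r%:C; first by rewrite /= ltcR.
  move=> w /=; rewrite -normrN opprB normc_def ltcR => h; apply: rD.
  case: w z h => [a b] [c d] /=; split => /=;
    by apply: le_lt_trans h; rewrite -sqrtr_sqr ler_wsqrtr// ?lerDl ?lerDr ?sqr_ge0.
Qed.

Lemma continuous_boxP (f : R[i]^o -> R) (z : R[i]^o) :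
  {for z, continuous f} <->
  forall eps, 0 < eps ->
    exists2 r : R, 0 < r & forall w, box z r w -> `|f w - f z| < eps.
Proof.
split.
- move=> cf eps e0.
  have /cf/nbhs_boxP[r r0 rD] : nbhs (f z) (ball (f z) eps) by exact: nbhsx_ballx.
  by exists r => // w /rD; rewrite distrC.
- move=> h A /nbhs_ballP[eps /= /h[r r0 rD] eA].
  apply/(nbhs_boxP z); exists r => // w /rD wD.
  by apply: eA; rewrite /ball /= distrC.
Qed.

Lemma box_subset z (r s : R) : r <= s -> box z r `<=` box z s.
Proof.
move=> rs w [wr wi]; split; [exact: lt_le_trans wr rs|exact: lt_le_trans wi rs].
Qed.

Lemma Re_line e z (t : R) :
  complex.Re (z + t%:C * e) = complex.Re z + t * complex.Re e.
Proof. by case: z e => [a b] [c d] /=; rewrite mul0r subr0. Qed.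

Lemma Im_line e z (t : R) :
  complex.Im (z + t%:C * e) = complex.Im z + t * complex.Im e.
Proof. by case: z e => [a b] [c d] /=; rewrite mul0r addr0. Qed.

Lemma on_line_shift e f z (s t : R) :
  on_line e f (z + s%:C * e) t = on_line e f z (t + s).
Proof. by rewrite /on_line -addrA -mulrDl -rmorphD (addrC s). Qed.

Lemma on_line_shiftE e f z (s : R) :
  on_line e f (z + s%:C * e) = on_line e f z \o shift s.
Proof. by apply/funext => t; rewrite on_line_shift. Qed.

Lemma is_derive_on_line e f z (s : R) : has_partial e f (z + s%:C * e) ->
  is_derive s 1 (on_line e f z) (partial e f (z + s%:C * e)).
Proof.
rewrite /has_partial /partial on_line_shiftE derive1E => h.
have -> : 'D_1 (on_line e f z \o shift s) 0 = 'D_1 (on_line e f z) s.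
  by rewrite /derive /=; under eq_fun do rewrite /= addr0 add0r.
apply: DeriveDef => //; move: h; rewrite /derivable /=.
by under eq_fun do rewrite /= addr0 add0r.
Qed.

Lemma on_line0 e f z : on_line e f z 0 = f z.
Proof. by rewrite /on_line mul0r addr0. Qed.

End Boxes.

(** * Continuous induction and the mean value theorem *)
Section Calculus.
Variable R : realType.
Implicit Types (z w e : R[i]) (f : R[i] -> R).

(** The supremum of the points t for which Q holds on [a, t] can be reached, and
    can be passed if it is not b, by the local hypothesis there.  All the
    compactness arguments below are instances of this induction. *)
Lemma interval_induction (Q : R -> R -> Prop) (a b : R) : a <= b ->
  (forall t, a <= t <= b -> exists2 eps, 0 < eps &
     forall c d, a <= c -> c <= t -> t <= d -> d <= b ->
       t - eps < c -> d < t + eps -> Q c d) ->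
  (forall c m d, c <= m -> m <= d -> Q c m -> Q m d -> Q c d) ->
  Q a b.
Proof.
move=> ab loc glue.
pose E : set R := [set t | a <= t <= b /\ Q a t].
have Ea : E a.
  split; first by rewrite lexx.
  have [|eps eps0 h] := loc a; first by rewrite lexx.
  by apply: h; rewrite // ?gtrBl ?ltrDl.
have supE : has_sup E by split; [exists a | exists b => t [/andP[]]].
have as_ : a <= sup E by apply: ub_le_sup => //; case: supE.
have sb : sup E <= b by apply: ge_sup; [exists a | move=> t [/andP[]]].
have [|eps eps0 h] := loc (sup E); first by rewrite as_.
have [t [/andP[at_ tb] Qat] et] := sup_adherent eps0 supE.
have ts : t <= sup E by apply: ub_le_sup; [case: supE | split; rewrite ?at_].
case: (ltP (sup E) b) => [sltb|bs]; last first.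
  apply: (glue _ t) => //; apply: h => //.
  by apply: (le_lt_trans bs); rewrite ltrDl.
pose d := Num.min b (sup E + eps / 2).
have sd : sup E < d by rewrite /d lt_min sltb ltrDl divr_gt0.
have : d <= sup E.
  apply: ub_le_sup; first by case: supE.
  split; first by rewrite (le_trans as_ (ltW sd)) /d ge_min lexx.
  apply: (glue _ t) => //; first exact: le_trans ts (ltW sd).
  apply: h => //; first exact: ltW.
    by rewrite /d ge_min lexx.
  by rewrite /d gt_min ltrD2l ltr_pdivrMr // ltr_pMr ?ltr1n ?orbT.
by rewrite leNgt sd.
Qed.

Lemma MVT_line e f z (h : R) :
  (forall t : R, `|t| <= `|h| -> has_partial e f (z + t%:C * e)) ->
  exists2 t : R, `|t| <= `|h| &
    f (z + h%:C * e) - f z = h * partial e f (z + t%:C * e).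
Proof.
move=> df.
have df' (t : R) : `|t| <= `|h| ->
    is_derive t 1 (on_line e f z) (partial e f (z + t%:C * e)).
  by move=> /df; exact: is_derive_on_line.
have cf (a b : R) : (forall t, a <= t <= b -> `|t| <= `|h|) ->
    {within `[a, b], continuous (on_line e f z)}.
  move=> hab; apply: derivable_within_continuous => t.
  by rewrite in_itv /= => /hab/df'[].
rewrite -[f z](on_line0 e) -[f (z + _)]/(on_line e f z h).
have [h0|h0] := leP 0 h.
- have bnd t : 0 <= t <= h -> `|t| <= `|h|.
    by move=> /andP[? ?]; rewrite !ger0_norm.
  have [||t] := @MVT_segment R (on_line e f z)
    (fun t => partial e f (z + t%:C * e)) 0 h h0.
  + move=> t; rewrite in_itv /= => /andP[t0 th]; apply: df'.
    by apply: bnd; rewrite !ltW.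
  + by apply: cf => t /bnd.
  rewrite in_itv /= => /bnd tb; rewrite subr0 => ->.
  by exists t => //; rewrite mulrC.
- have bnd t : h <= t <= 0 -> `|t| <= `|h|.
    by move=> /andP[? ?]; rewrite !ler0_norm ?lerN2 // ltW.
  have [||t] := @MVT_segment R (on_line e f z)
    (fun t => partial e f (z + t%:C * e)) h 0 (ltW h0).
  + move=> t; rewrite in_itv /= => /andP[t0 th]; apply: df'.
    by apply: bnd; rewrite !ltW.
  + by apply: cf => t /bnd.
  rewrite in_itv /= => /bnd tb E.
  by exists t => //; rewrite -opprB E sub0r mulrN opprK mulrC.
Qed.

Lemma is_derive_cvgP (F : R -> R) (t l : R) :
  is_derive t 1 F l <-> h^-1 * (F (h + t) - F t) @[h --> 0^'] --> l.
Proof.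
have E : (fun h => h^-1 *: ((F \o shift t) (h *: (1 : R)) - F t)) =
         (fun h => h^-1 * (F (h + t) - F t)).
  by apply/funext => h; rewrite /= /GRing.scale /= mulr1.
split=> [[dF <-]|H]; first by rewrite /derive -E; exact: dF.
have cv : (fun h => h^-1 *: ((F \o shift t) (h *: (1 : R)) - F t)) @ 0^' --> l.
  by rewrite E.
by apply: DeriveDef; [apply/cvg_ex; exists l | exact: cvg_lim cv].
Qed.

Lemma is_derive_quotientP (F : R -> R) (t l : R) :
  is_derive t 1 F l <->
  forall eps, 0 < eps -> exists2 r, 0 < r & forall h, h != 0 -> `|h| < r ->
     `|h^-1 * (F (h + t) - F t) - l| < eps.
Proof.
rewrite is_derive_cvgP; split.
- move=> H eps e0; move: H => /cvgrPdist_lt/(_ _ e0).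
  rewrite near_withinE => /nbhs_ballP[r /= r0 rh].
  exists r => // h h0 hr; rewrite distrC; apply: rh => //.
  by rewrite /ball /= sub0r normrN.
- move=> H; apply/cvgrPdist_lt => eps /H[r r0 rh]; rewrite near_withinE.
  apply/nbhs_ballP; exists r => //= h; rewrite /ball /= sub0r normrN => hr h0.
  by rewrite distrC; exact: rh.
Qed.

End Calculus.

(** * Functions of class C1 in the plane *)
Section C1.
Variable R : realType.
Implicit Types (z w e : R[i]) (f : R[i] -> R).

Definition C1_at f z :=
  [/\ exists2 r : R, 0 < r &
        forall w, box z r w -> has_partial 1 f w /\ has_partial 'i%C f w,
      {for (z : R[i]^o), continuous (partial 1 f : R[i]^o -> R)} &
      {for (z : R[i]^o), continuous (partial 'i%C f : R[i]^o -> R)}].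

Lemma box_line1 z (r t : R) : `|t| < r -> box z r (z + t%:C * 1).
Proof.
move=> tr; rewrite /box /= Re_line Im_line /= mulr1 mulr0 addr0 subrr normr0.
by rewrite addrC addKr; split => //; exact: le_lt_trans tr.
Qed.

Lemma box_linei z (r t : R) : `|t| < r -> box z r (z + t%:C * 'i%C).
Proof.
move=> tr; rewrite /box /= Re_line Im_line /= mulr1 mulr0 addr0 subrr normr0.
by rewrite addrC addKr; split => //; exact: le_lt_trans tr.
Qed.

Lemma box_line1i z (r s t : R) : `|s| < r -> `|t| < r ->
  box z r (z + s%:C * 1 + t%:C * 'i%C).
Proof.
move=> sr tr; rewrite /box /= !Re_line !Im_line /= !mulr1 !mulr0 !addr0.
by rewrite [_ + s]addrC addrK [_ + t]addrC addrK.
Qed.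

Lemma line1i z w :
  z + (complex.Re w - complex.Re z)%:C * 1 +
      (complex.Im w - complex.Im z)%:C * 'i%C = w.
Proof.
apply/eqP; rewrite eq_complex !Re_line !Im_line /= !mulr1 !mulr0 !addr0.
by rewrite !(addrC _ (_ - _)) !subrK !eqxx.
Qed.

(** The increment of f from z to w is split at the corner of the box, and the
    mean value theorem is applied on each of the two sides.  The coefficients are
    partial derivatives at intermediate points, which tend to z with w.
    In this form differentiability composes with a curve. *)
Lemma caratheodory f z : C1_at f z ->
  exists a b : R[i]^o -> R,
  [/\ a w @[w --> (z : R[i]^o)] --> partial 1 f z,
      b w @[w --> (z : R[i]^o)] --> partial 'i%C f z &
      exists2 r : R, 0 < r & forall w, box z r w ->
        f w - f z = a w * (complex.Re w - complex.Re z) +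
                    b w * (complex.Im w - complex.Im z)].
Proof.
move=> [[r r0 df] c1 ci].
pose good e w (v : R) := exists2 u, box z r u & v = partial e f u /\
  forall s, box z s w -> box z s u.
have [ab abP] : exists ab : R[i] -> R * R, forall w, box z r w ->
    good 1 w (ab w).1 /\ good 'i%C w (ab w).2 /\
    f w - f z = (ab w).1 * (complex.Re w - complex.Re z) +
                    (ab w).2 * (complex.Im w - complex.Im z).
  suff /choice[ab abP] : forall w, exists p : R * R, box z r w ->
      good 1 w p.1 /\ good 'i%C w p.2 /\
      f w - f z = p.1 * (complex.Re w - complex.Re z) +
                  p.2 * (complex.Im w - complex.Im z) by exists ab.
  move=> w.
  have [wr|nwr] := pselect (box z r w); last by exists (0, 0).
  set h := complex.Re w - complex.Re z; set k := complex.Im w - complex.Im z.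
  have wE : w = z + h%:C * 1 + k%:C * 'i%C by rewrite line1i.
  have [hr kr] := wr; rewrite -/h -/k in hr kr.
  have [|s sh s1] := @MVT_line _ 1 f z h.
    by move=> t th; apply: (df _ _).1; apply: box_line1; exact: le_lt_trans hr.
  have [|t tk t1] := @MVT_line _ 'i%C f (z + h%:C * 1) k.
    move=> t th; apply: (df _ _).2; apply: box_line1i => //.
    exact: le_lt_trans kr.
  exists (partial 1 f (z + s%:C * 1),
          partial 'i%C f (z + h%:C * 1 + t%:C * 'i%C)) => _ /=.
  split; [|split].
  - exists (z + s%:C * 1); first by apply: box_line1; exact: le_lt_trans hr.
    split=> // q [hq _]; apply: box_line1; exact: le_lt_trans hq.
  - exists (z + h%:C * 1 + t%:C * 'i%C).
      by apply: box_line1i => //; exact: le_lt_trans kr.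
    by split=> // q [hq kq]; apply: box_line1i => //; exact: le_lt_trans kq.
  - rewrite [in LHS]wE (mulrC _ h) (mulrC _ k) -s1 -t1.
    by rewrite [RHS]addrC addrA subrK.
have lim_part (e : R[i]) (a : R[i] -> R) :
    {for (z : R[i]^o), continuous (partial e f : R[i]^o -> R)} ->
    (forall w, box z r w -> good e w (a w)) ->
    (a : R[i]^o -> R) w @[w --> (z : R[i]^o)] --> partial e f z.
  move=> /continuous_boxP ce aP A /nbhs_ballP[eps /= /ce[q q0 qf] eA].
  apply/(nbhs_boxP z); exists (Num.min q r); first by rewrite lt_min q0.
  move=> w wqr; have wq : box z q w by apply: box_subset wqr; rewrite ge_min lexx.
  have wr : box z r w by apply: box_subset wqr; rewrite ge_min lexx orbT.
  have [v vr [av /(_ _ wq) vq]] := aP _ wr.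
  by apply: eA; rewrite /ball /= av distrC qf.
exists (fst \o ab), (snd \o ab); split.
- by apply: lim_part => // w /abP[].
- by apply: lim_part => // w /abP[_ []].
- by exists r => // w /abP[_ []].
Qed.

Lemma C1_at_continuous f z : C1_at f z ->
  {for (z : R[i]^o), continuous (f : R[i]^o -> R)}.
Proof.
move=> [[r r0 df] c1 ci].
have [a [b [ca cb [q q0 E]]]] := caratheodory (And3 (ex_intro2 _ _ r r0 df) c1 ci).
have /cvgrPdist_lt/(_ 1 ltr01)/(nbhs_boxP z)[ra ra0 ha] := ca.
have /cvgrPdist_lt/(_ 1 ltr01)/(nbhs_boxP z)[rb rb0 hb] := cb.
apply/continuous_boxP => eps e0.
pose M := 2 + `|partial 1 f z| + `|partial 'i%C f z|.
have M0 : 0 < M by rewrite /M -addrA ltr_wpDr // addr_ge0.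
exists (Num.min (Num.min q (eps / M)) (Num.min ra rb)).
  by rewrite !lt_min q0 ra0 rb0 divr_gt0.
move=> w [].
rewrite !lt_min => /andP[/andP[h1 h2] /andP[h3 h4]] /andP[/andP[k1 k2] /andP[k3 k4]].
rewrite (E w) //; have /= haw := ha w (conj h3 k3); have /= hbw := hb w (conj h4 k4).
apply: (le_lt_trans (ler_normD _ _)); rewrite !normrM.
have A : `|a w| <= 1 + `|partial 1 f z|.
  rewrite -lerBlDr; apply: (le_trans (lerB_dist _ _)).
  by rewrite distrC ltW.
have B : `|b w| <= 1 + `|partial 'i%C f z|.
  rewrite -lerBlDr; apply: (le_trans (lerB_dist _ _)).
  by rewrite distrC ltW.
have eM : eps = (1 + `|partial 1 f z|) * (eps / M) + (1 + `|partial 'i%C f z|) * (eps / M).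
  rewrite -mulrDl; rewrite addrACA -[1 + 1]/2 addrA -/M mulrC divfK //.
  by rewrite gt_eqF.
rewrite [ltRHS]eM; apply: ler_ltD.
  by apply: ler_pM => //; exact: ltW.
apply: (@le_lt_trans _ _ ((1 + `|partial 'i%C f z|) * `|complex.Im w - complex.Im z|)).
  by rewrite ler_wpM2r.
by rewrite ltr_pM2l // ltr_pwDl.
Qed.

Lemma is_derive_curve f z (c : R -> R[i]) (t x' y' : R) : C1_at f z ->
  c t = z ->
  is_derive t 1 (fun s => complex.Re (c s)) x' ->
  is_derive t 1 (fun s => complex.Im (c s)) y' ->
  is_derive t 1 (f \o c) (partial 1 f z * x' + partial 'i%C f z * y').
Proof.
move=> C1f ctz dx dy.
have cx : {for t, continuous (fun s => complex.Re (c s))}.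
  by apply: differentiable_continuous; apply/derivable1_diffP; case: dx.
have cy : {for t, continuous (fun s => complex.Im (c s))}.
  by apply: differentiable_continuous; apply/derivable1_diffP; case: dy.
have cc : c s @[s --> t] --> (z : R[i]^o).
  move=> A /(nbhs_boxP z)[r r0 rA].
  have /cvgrPdist_lt/(_ _ r0) X := cx; have /cvgrPdist_lt/(_ _ r0) Y := cy.
  change (nbhs t (c @^-1` A)); move: X Y; apply: filterS2 => s X Y.
  by apply: rA; rewrite /box /= -ctz distrC (distrC (complex.Im _)).
have cc0 : c (h + t) @[h --> 0^'] --> (z : R[i]^o).
  apply: cvg_within_filter.
  have : (h + t) @[h --> (0 : R)] --> t.
    by rewrite -[X in _ --> X]add0r; apply: cvgD; [exact: cvg_id|exact: cvg_cst].
  by move=> /cvg_comp; apply.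
have [a [b [ca cb [q q0 E]]]] := caratheodory C1f.
apply/is_derive_cvgP; move: dx dy => /is_derive_cvgP dx /is_derive_cvgP dy.
have : (a (c (h + t)) * (h^-1 * (complex.Re (c (h + t)) - complex.Re (c t))) +
       b (c (h + t)) * (h^-1 * (complex.Im (c (h + t)) - complex.Im (c t)))) @[h --> 0^'] -->
       partial 1 f z * x' + partial 'i%C f z * y'.
  apply: cvgD; apply: cvgM => //.
  - exact: (cvg_comp _ _ cc0 ca).
  - exact: (cvg_comp _ _ cc0 cb).
apply: cvg_trans; apply: near_eq_cvg.
have : \forall h \near 0^', box z q (c (h + t)).
  have Bq : nbhs (z : R[i]^o) (box z q) by apply/(nbhs_boxP z); exists q.
  exact: (cc0 _ Bq).
apply: filterS => h /E /=; rewrite ctz => ->.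
by ring.
Qed.

End C1.

(** * Holomorphic changes of variable *)
Section Antiderivative.
Variable R : realType.

Lemma antiderivative (phi : R -> R) (a b : R) : a < b ->
  (forall x, a <= x <= b -> {for x, continuous phi}) ->
  exists Phi : R -> R, forall x, a < x -> x < b -> is_derive x 1 Phi (phi x).
Proof.
move=> ab cphi.
exists (fun x => \int[@lebesgue_measure R]_(t in [set` `[a, x]]) phi t)%R => x ax xb.
have int : (@lebesgue_measure R).-integrable `[a, b] (EFin \o phi).
  apply: continuous_compact_integrable; first exact: segment_compact.
  apply: continuous_in_subspaceT => y; rewrite inE /= in_itv /=; exact: cphi.
have [|d dE] := continuous_FTC1_closed xb int ax.
  by apply: cphi; rewrite !ltW.
by apply: DeriveDef; [exact: d | rewrite -derive1E; exact: dE].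
Qed.

End Antiderivative.

Section HolomorphicCurve.
Variable R : realType.
Implicit Types (z w e : R[i]) (tau : R[i]^o -> R[i]^o).

Definition cderiv tau (z : R[i]^o) : R[i] := 'D_(1 : R[i]^o) tau z.

(** The complex difference quotient is restricted to the increments t e with t
    real.  Its limit is the same for e = 1 and e = i: this is where the
    Cauchy-Riemann equations enter. *)
Lemma is_derive_holomorphic tau (z : R[i]^o) e : derivable tau z (1 : R[i]^o) ->
  e = 1 \/ e = 'i%C ->
  is_derive (0 : R) 1 (fun t => complex.Re (tau (z + t%:C * e)))
    (complex.Re (cderiv tau z * e)) /\
  is_derive (0 : R) 1 (fun t => complex.Im (tau (z + t%:C * e)))
    (complex.Im (cderiv tau z * e)).
Proof.
move=> dtau eE.
have e0 : e != 0.
  by case: eE => ->; rewrite eq_complex /= ?oner_eq0 ?andbF.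
have eb (r t : R) : `|t| < r -> box 0 r (t%:C * e).
  by move=> tr; rewrite -[t%:C * e]add0r; case: eE => ->;
    [exact: box_line1 | exact: box_linei].
have k0 : (t%:C * e : R[i]^o) @[t --> 0^'] --> (0 : R[i]^o)^'.
  move=> A HA.
  have /(nbhs_boxP (0 : R[i]^o))[r r0 rA] :
    nbhs (0 : R[i]^o) (fun y => y != 0 -> A y) := HA.
  change (nbhs (0 : R) (fun t => t != 0 -> A (t%:C * e))).
  apply/nbhs_ballP; exists r => //= t.
  rewrite /ball /= sub0r normrN => tr t0; apply: rA; first exact: eb.
  by rewrite mulf_neq0 // -[0]/(0%:C) (inj_eq (@complexI R)).
have lim : (e * ((t%:C * e)^-1 * (tau (z + t%:C * e) - tau z)) : R[i]^o)
    @[t --> 0^'] --> (cderiv tau z * e : R[i]^o).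
  rewrite mulrC; apply: cvgM; first exact: cvg_cst.
  have := cvg_comp _ _ k0 dtau; apply: cvg_trans; apply: near_eq_cvg.
  by apply: nearW => t /=; rewrite /GRing.scale /= mulr1 (addrC z).
have limE (t : R) : t != 0 -> e * ((t%:C * e)^-1 * (tau (z + t%:C * e) - tau z)) =
    (t^-1)%:C * (tau (z + t%:C * e) - tau z).
  move=> t0; rewrite mulrA invfM mulrCA mulfV // mulr1.
  by rewrite fmorphV.
have part (p : R[i] -> R) : (forall u v, p (u - v) = p u - p v) ->
   (forall (a : R) u, p (a%:C * u) = a * p u) ->
   (forall v (r : R) w, box v r w -> `|p w - p v| < r) ->
   is_derive (0 : R) 1 (fun t => p (tau (z + t%:C * e))) (p (cderiv tau z * e)).
  move=> pB pZ pbox; apply/is_derive_cvgP; apply/cvgrPdist_lt => eps eps0.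
  have : nbhs (cderiv tau z * e : R[i]^o) (box (cderiv tau z * e) eps).
    by apply/(nbhs_boxP (cderiv tau z * e : R[i]^o)); exists eps.
  move=> /lim H; change (nbhs (0 : R) (fun t => t != 0 ->
    box (cderiv tau z * e) eps
      (e * ((t%:C * e)^-1 * (tau (z + t%:C * e) - tau z))))) in H.
  rewrite near_withinE; move: H; apply: filterS => t H t0.
  have := H t0; rewrite limE // => /pbox.
  by rewrite pZ pB mul0r !addr0 distrC.
split; apply: part.
- by move=> [? ?] [? ?].
- by move=> a [b c] /=; rewrite mul0r subr0.
- by move=> v r w [].
- by move=> [? ?] [? ?].
- by move=> a [b c] /=; rewrite mul0r addr0.
- by move=> v r w [].
Qed.

Lemma is_derive_comp_holomorphic (f : R[i] -> R) tau (z : R[i]^o) e :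
  derivable tau z (1 : R[i]^o) -> e = 1 \/ e = 'i%C -> C1_at f (tau z) ->
  is_derive (0 : R) 1 (on_line e (f \o tau) z)
    (partial 1 f (tau z) * complex.Re (cderiv tau z * e) +
     partial 'i%C f (tau z) * complex.Im (cderiv tau z * e)).
Proof.
move=> dtau eE C1f; have [dre dim] := is_derive_holomorphic dtau eE.
apply: (is_derive_curve (c := fun t => tau (z + t%:C * e))) => //.
by rewrite mul0r addr0.
Qed.

End HolomorphicCurve.

(** * Symmetry of mixed partial derivatives *)
Section Schwarz.
Variable R : realType.
Implicit Types (z w d e : R[i]) (f : R[i] -> R).

(** The second difference is the increment along d of w |-> f (w + h e) - f w;
    the mean value theorem along d, and then along e, applies to it. *)
Lemma second_difference d e f z (h : R) :
  (forall s t : R, `|s| <= `|h| -> `|t| <= `|h| ->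
     has_partial d f (z + s%:C * d + t%:C * e) /\
     has_partial e (partial d f) (z + s%:C * d + t%:C * e)) ->
  exists s t : R, [/\ `|s| <= `|h|, `|t| <= `|h| &
    f (z + h%:C * d + h%:C * e) - f (z + h%:C * d) - (f (z + h%:C * e) - f z) =
    h * (h * partial e (partial d f) (z + s%:C * d + t%:C * e))].
Proof.
move=> df; pose G w := f (w + h%:C * e) - f w.
have dG (s : R) : `|s| <= `|h| ->
    is_derive (0 : R) 1 (on_line d G (z + s%:C * d))
    (partial d f (z + s%:C * d + h%:C * e) - partial d f (z + s%:C * d)).
  move=> sh.
  have -> : on_line d G (z + s%:C * d) =
      on_line d f (z + s%:C * d + h%:C * e) - on_line d f (z + s%:C * d).
    apply/funext => t.
    suff X : f (z + s%:C * d + t%:C * d + h%:C * e) - f (z + s%:C * d + t%:C * d) =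
      f (z + s%:C * d + h%:C * e + t%:C * d) - f (z + s%:C * d + t%:C * d) by exact: X.
    by rewrite (addrAC _ (h%:C * e)).
  have [d1 _] := df s h sh (lexx _).
  have [d2 _] := df s 0 sh ltac:(by rewrite normr0).
  rewrite mul0r addr0 in d2.
  have E1 := is_derive_on_line (e := d) (f := f) (s := 0)
    (z := z + s%:C * d + h%:C * e).
  have E2 := is_derive_on_line (e := d) (f := f) (s := 0) (z := z + s%:C * d).
  rewrite !mul0r !addr0 in E1 E2.
  by apply: is_deriveB; [exact: E1 | exact: E2].
have [t th E] : exists2 t : R, `|t| <= `|h| &
    G (z + h%:C * d) - G z = h * partial d G (z + t%:C * d).
  by apply: MVT_line => s sh; have [] := dG s sh.
have := dG t th => -[_]; rewrite -derive1E -/(partial d G (z + t%:C * d)) => Gt.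
have [u uh E2] : exists2 u : R, `|u| <= `|h| &
    partial d f (z + t%:C * d + h%:C * e) - partial d f (z + t%:C * d) =
    h * partial e (partial d f) (z + t%:C * d + u%:C * e).
  by apply: MVT_line => s sh; have [] := df t s th sh.
by exists t, u; split=> //; rewrite -E2 -Gt -E.
Qed.

(** The second difference does not change when d and e are exchanged, so that
    [second_difference] gives two points near z at which the two mixed
    derivatives have the same value. *)
Lemma mixed_partials_along d e f z (r : R) : 0 < r ->
  (forall s t : R, `|s| < r -> `|t| < r ->
     [/\ has_partial d f (z + s%:C * d + t%:C * e),
         has_partial e f (z + s%:C * d + t%:C * e),
         has_partial e (partial d f) (z + s%:C * d + t%:C * e) &
         has_partial d (partial e f) (z + s%:C * d + t%:C * e)]) ->
  (forall eps, 0 < eps -> exists2 r : R, 0 < r & forall s t : R,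
     `|s| < r -> `|t| < r ->
     `|partial e (partial d f) (z + s%:C * d + t%:C * e)
       - partial e (partial d f) z| < eps) ->
  (forall eps, 0 < eps -> exists2 r : R, 0 < r & forall s t : R,
     `|s| < r -> `|t| < r ->
     `|partial d (partial e f) (z + s%:C * d + t%:C * e)
       - partial d (partial e f) z| < eps) ->
  partial e (partial d f) z = partial d (partial e f) z.
Proof.
move=> r0 df c1 c2.
apply/eqP; rewrite -subr_eq0 -normr_le0; apply/ler_addgt0Pr => eps eps0.
rewrite add0r.
have e20 : 0 < eps / 2 by rewrite divr_gt0.
have [r1 r10 h1] := c1 _ e20; have [r2 r20 h2] := c2 _ e20.
pose h := Num.min r (Num.min r1 r2) / 2.
have m0 : 0 < Num.min r (Num.min r1 r2) by rewrite !lt_min r0 r10 r20.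
have h0 : 0 < h by rewrite divr_gt0.
have hm : h < Num.min r (Num.min r1 r2) by rewrite ltr_pdivrMr // ltr_pMr ?ltr1n.
move: hm; rewrite !lt_min => /and3P[hr hr1 hr2].
have nh : `|h| = h by rewrite gtr0_norm.
have [|s [t [sh th E1]]] := @second_difference d e f z h.
  move=> s t; rewrite nh => sh th.
  have [A B C D] := df s t (le_lt_trans sh hr) (le_lt_trans th hr).
  exact: conj A C.
have [|s' [t' [sh' th' E2]]] := @second_difference e d f z h.
  move=> u v; rewrite nh => uh vh.
  have [A B C D] := df v u (le_lt_trans vh hr) (le_lt_trans uh hr).
  by rewrite addrAC; exact: (conj B D).
rewrite nh in sh th sh' th'.
have E : partial e (partial d f) (z + s%:C * d + t%:C * e) =
         partial d (partial e f) (z + t'%:C * d + s'%:C * e).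
  have hn : h != 0 by rewrite gt_eqF.
  suff X : h * (h * partial e (partial d f) (z + s%:C * d + t%:C * e)) =
           h * (h * partial d (partial e f) (z + t'%:C * d + s'%:C * e)).
    exact: (mulfI hn (mulfI hn X)).
  rewrite (addrAC z (t'%:C * d)); apply: etrans (esym E1) (etrans _ E2).
  rewrite (addrAC z (h%:C * e)).
  move: (f _) (f (z + h%:C * d)) (f (z + h%:C * e)) (f z) => a b c k; ring.
have := h1 _ _ (le_lt_trans sh hr1) (le_lt_trans th hr1).
have := h2 _ _ (le_lt_trans th' hr2) (le_lt_trans sh' hr2).
rewrite -E.
move: (partial e (partial d f) (z + _ + _)) (partial e (partial d f) z)
  (partial d (partial e f) z) => x y y' A B.
have -> : y - y' = (x - y') - (x - y) by rewrite opprB [RHS]addrC addrA subrK.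
apply: le_trans (ler_normB _ _) _; apply: ltW.
by rewrite [ltRHS]splitr ltrD.
Qed.

Lemma Schwarz f z (r : R) : 0 < r ->
  (forall w, box z r w ->
     [/\ has_partial 1 f w, has_partial 'i%C f w,
         has_partial 'i%C (partial 1 f) w & has_partial 1 (partial 'i%C f) w]) ->
  {for (z : R[i]^o),
     continuous (partial 'i%C (partial 1 f) : R[i]^o -> R)} ->
  {for (z : R[i]^o),
     continuous (partial 1 (partial 'i%C f) : R[i]^o -> R)} ->
  partial 'i%C (partial 1 f) z = partial 1 (partial 'i%C f) z.
Proof.
move=> r0 df /continuous_boxP c1 /continuous_boxP c2.
apply: (@mixed_partials_along 1 'i%C f z r r0).
- by move=> s t sr tr; apply: df; exact: box_line1i.
- move=> eps /c1[r1 r10 h]; exists r1 => // s t sr tr.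
  by apply: h; exact: box_line1i.
- move=> eps /c2[r1 r10 h]; exists r1 => // s t sr tr.
  by apply: h; exact: box_line1i.
Qed.

End Schwarz.

(** * The Poincare lemma on a box *)
Section PoincareLemma.
Variable R : realType.
Implicit Types (z w e : R[i]) (f p q : R[i] -> R).

Lemma continuous_slice1 p (x y : R) :
  {for ((x +i* y) : R[i]^o), continuous (p : R[i]^o -> R)} ->
  {for x, continuous (fun s => p (s +i* y))}.
Proof.
move=> /continuous_boxP c; apply/cvgrPdist_lt => eps /c[r r0 h].
apply/nbhs_ballP; exists r => // s; rewrite /ball /= => sr.
by rewrite distrC; apply: h; rewrite /box /= subrr normr0 distrC.
Qed.

Lemma continuous_slicei p (x y : R) :
  {for ((x +i* y) : R[i]^o), continuous (p : R[i]^o -> R)} ->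
  {for y, continuous (fun s => p (x +i* s))}.
Proof.
move=> /continuous_boxP c; apply/cvgrPdist_lt => eps /c[r r0 h].
apply/nbhs_ballP; exists r => // s; rewrite /ball /= => sr.
by rewrite distrC; apply: h; rewrite /box /= subrr normr0 distrC.
Qed.

Lemma line1E (x y s : R) : (x +i* y) + s%:C * 1 = (s + x) +i* y.
Proof. by rewrite mulr1; apply/eqP; rewrite eq_complex /= addr0 addrC !eqxx. Qed.

Lemma lineiE (x y s : R) : (x +i* y) + s%:C * 'i%C = x +i* (s + y).
Proof.
by apply/eqP; rewrite eq_complex /= !mulr0 mul0r mulr1 subr0 !addr0 addrC !eqxx.
Qed.

(** Compactness of the vertical segment, by [interval_induction] on the property
    that one r serves for the whole segment. *)
Lemma uniform_vertical k (x a b : R) : a <= b ->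
  (forall y, a <= y <= b ->
    {for ((x +i* y) : R[i]^o), continuous (k : R[i]^o -> R)}) ->
  forall eps, 0 < eps -> exists2 r : R, 0 < r & forall y s : R,
    a <= y <= b -> `|s| < r -> `|k ((s + x) +i* y) - k (x +i* y)| < eps.
Proof.
move=> ab ck eps eps0.
apply: (@interval_induction R (fun c d => exists2 r : R, 0 < r & forall y s : R,
    c <= y <= d -> `|s| < r -> `|k ((s + x) +i* y) - k (x +i* y)| < eps) a b ab).
- move=> t /ck/continuous_boxP/(_ (eps / 2)) [|r r0 h]; first by rewrite divr_gt0.
  exists r => // c d ac ct td db rc dr; exists r => // y s /andP[cy yd] sr.
  have yr : `|y - t| < r.
    move: (lt_le_trans rc cy) (le_lt_trans yd dr); rewrite ltr_norml => *.
    by apply/andP; split; lra.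
  have A : `|k ((s + x) +i* y) - k (x +i* t)| < eps / 2.
    by apply: h; rewrite /box /= addrK.
  have B : `|k (x +i* y) - k (x +i* t)| < eps / 2.
    by apply: h; rewrite /box /= subrr normr0.
  move: A B; move: (k _) (k (x +i* y)) (k (x +i* t)) => u v w A B.
  have -> : u - v = (u - w) - (v - w) by ring.
  by apply: le_lt_trans (ler_normB _ _) _; rewrite [ltRHS]splitr ltrD.
- move=> c m d _ _ [r1 r10 h1] [r2 r20 h2].
  exists (Num.min r1 r2); first by rewrite lt_min r10.
  move=> y s /andP[cy yd]; rewrite lt_min => /andP[s1 s2].
  have [ym|my] := leP y m; first by apply: h1; rewrite ?cy.
  by apply: h2; rewrite ?yd ?ltW.
Qed.

Lemma is_derive_slicei p (x y : R) : has_partial 'i%C p (x +i* y) ->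
  is_derive y 1 (fun t => p (x +i* t)) (partial 'i%C p (x +i* y)).
Proof.
move=> dp; have E := @is_derive_on_line R 'i%C p (x +i* 0) y.
rewrite lineiE addr0 in E; move: (E dp).
suff -> : on_line 'i%C p (x +i* 0) = fun t => p (x +i* t) by [].
by apply/funext => t; rewrite /on_line lineiE addr0.
Qed.

Lemma is_derive_shift0 (F : R -> R) (y l : R) :
  is_derive y 1 F l -> is_derive (0 : R) 1 (fun t => F (t + y)) l.
Proof.
rewrite !is_derive_cvgP; apply: cvg_trans; apply: near_eq_cvg.
by apply: nearW => h; rewrite addr0 add0r.
Qed.

Lemma MVT_ball (F dF : R -> R) (c rho y : R) :
  (forall t, `|t - c| < rho -> is_derive t 1 F (dF t)) -> `|y - c| < rho ->
  exists2 t, `|t - c| < rho & F y - F c = dF t * (y - c).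
Proof.
move=> dF' yr.
have cF (a b : R) : (forall t, a <= t <= b -> `|t - c| < rho) ->
    {within `[a, b], continuous F}.
  move=> hab; apply: derivable_within_continuous => t.
  by rewrite in_itv /= => /hab/dF'[].
have [cy|yc] := leP c y.
- have b t : c <= t <= y -> `|t - c| < rho.
    by move: yr; rewrite !ltr_norml => /andP[? ?] /andP[? ?]; apply/andP; split; lra.
  have [||t] := @MVT_segment R F dF c y cy.
  + move=> t; rewrite in_itv /= => /andP[? ?]; apply: dF'.
    by apply: b; rewrite !ltW.
  + exact: cF.
  by rewrite in_itv /= => /b ? ?; exists t.
- have b t : y <= t <= c -> `|t - c| < rho.
    by move: yr; rewrite !ltr_norml => /andP[? ?] /andP[? ?]; apply/andP; split; lra.
  have [||t] := @MVT_segment R F dF y c (ltW yc).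
  + move=> t; rewrite in_itv /= => /andP[? ?]; apply: dF'.
    by apply: b; rewrite !ltW.
  + exact: cF.
  rewrite in_itv /= => /b ? E; exists t => //.
  by rewrite -opprB E -mulrN opprB.
Qed.

(** f integrates p along the horizontal line through the center, and then q along
    vertical lines.  Only the x-derivative of the second part is not immediate:
    by the mean value theorem in y, the error made on its difference quotient is
    an increment of the x-derivative of q, small by [uniform_vertical].  Half the
    box is given up to keep closed segments inside the domain. *)
Lemma poincare_box (z0 : R[i]) (r : R) p q : 0 < r ->
  (forall w : R[i], box z0 r w ->
    [/\ {for (w : R[i]^o), continuous (p : R[i]^o -> R)},
        {for (w : R[i]^o), continuous (q : R[i]^o -> R)} &
        {for (w : R[i]^o), continuous (partial 1 q : R[i]^o -> R)}]) ->
  (forall w : R[i], box z0 r w ->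
    [/\ has_partial 'i%C p w, has_partial 1 q w &
        partial 'i%C p w = partial 1 q w]) ->
  exists f : R[i] -> R, forall w, box z0 (r / 2) w ->
    is_derive (0 : R) 1 (on_line 1 f w) (p w) /\
    is_derive (0 : R) 1 (on_line 'i%C f w) (q w).
Proof.
move=> r0 cpq dpq.
set x0 := complex.Re z0; set y0 := complex.Im z0.
have r20 : 0 < r / 2 by rewrite divr_gt0.
have r2r : r / 2 < r by rewrite ltr_pdivrMr // ltr_pMr ?ltr1n.
have inb (x y : R) : `|x - x0| <= r / 2 -> `|y - y0| <= r / 2 ->
    box z0 r (x +i* y).
  by move=> xr yr; split; [apply: le_lt_trans xr r2r|apply: le_lt_trans yr r2r].
have nb (c t : R) : c - r / 2 <= t <= c + r / 2 -> `|t - c| <= r / 2.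
  by move=> /andP[? ?]; rewrite ler_norml; apply/andP; split; lra.
have nb' (c t : R) : `|t - c| < r / 2 -> c - r / 2 < t /\ t < c + r / 2.
  by rewrite ltr_norml => /andP[? ?]; split; lra.
have ltb (c : R) : c - r / 2 < c + r / 2 by lra.
have y00 : `|y0 - y0| <= r / 2 by rewrite subrr normr0 ltW.
have [A dA] : exists A : R -> R, forall x, x0 - r / 2 < x -> x < x0 + r / 2 ->
    is_derive x 1 A (p (x +i* y0)).
  apply: antiderivative => // x /nb xr; apply: (@continuous_slice1 p).
  by have [] := cpq _ (inb _ _ xr y00).
have [B dB] : exists B : R -> R -> R, forall x, `|x - x0| < r / 2 ->
    forall y, `|y - y0| < r / 2 -> is_derive y 1 (B x) (q (x +i* y)).
  suff /choice[B dB] : forall x, exists b : R -> R, `|x - x0| < r / 2 ->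
    forall y, `|y - y0| < r / 2 -> is_derive y 1 b (q (x +i* y)) by exists B.
  move=> x; have [xr|] := ltP (`|x - x0|) (r / 2); last by exists (fun=> 0).
  have [|b db] := @antiderivative R (fun y => q (x +i* y)) _ _ (ltb y0).
    move=> y /nb yr; apply: (@continuous_slicei q).
    by have [] := cpq _ (inb _ _ (ltW xr) yr).
  by exists b => _ y /nb'[? ?]; exact: db.
exists (fun w => A (complex.Re w) +
  (B (complex.Re w) (complex.Im w) - B (complex.Re w) y0)) => -[x y] [/= xr yr].
rewrite -/x0 -/y0 in xr yr; split; last first.
  have -> : on_line 'i%C (fun w => A (complex.Re w) +
     (B (complex.Re w) (complex.Im w) - B (complex.Re w) y0)) (x +i* y) =
     cst (A x) + ((fun t => B x (t + y)) - cst (B x y0)).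
    by apply/funext => t; rewrite /on_line lineiE.
  rewrite -[q _]add0r -[q _]subr0.
  apply: is_deriveD; apply: is_deriveB.
  by apply: is_derive_shift0; exact: dB.
have -> : on_line 1 (fun w => A (complex.Re w) +
     (B (complex.Re w) (complex.Im w) - B (complex.Re w) y0)) (x +i* y) =
     (fun t => A (t + x)) + (fun t => B (t + x) y - B (t + x) y0).
  by apply/funext => t; rewrite /on_line line1E.
have -> : p (x +i* y) = p (x +i* y0) + (p (x +i* y) - p (x +i* y0)) by ring.
apply: is_deriveD.
  by apply: is_derive_shift0; have [? ?] := nb' _ _ xr; exact: dA.
apply/is_derive_quotientP => eps eps0.
have er0 : 0 < eps / r by rewrite divr_gt0.
have [|rho rho0 H] := @uniform_vertical (partial 1 q) x _ _ (ltW (ltb y0)) _ _ er0.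
  by move=> t /nb tr; have [] := cpq _ (inb _ _ (ltW xr) tr).
exists (Num.min rho (r / 2 - `|x - x0|)); first by rewrite lt_min rho0 subr_gt0.
move=> h h0; rewrite lt_min => /andP[hrho hx].
rewrite addr0 !add0r.
have hxr s : `|s| <= `|h| -> `|s + x - x0| < r / 2.
  move=> sh; rewrite -addrA; apply: le_lt_trans (ler_normD _ _) _.
  by rewrite -ltrBrDr; exact: le_lt_trans hx.
pose D t := B (h + x) t - B x t - h * p (x +i* t).
have dD t : `|t - y0| < r / 2 -> is_derive t 1 D
    (q ((h + x) +i* t) - q (x +i* t) - h * partial 'i%C p (x +i* t)).
  move=> tr; have -> : D = (B (h + x) - B x) - (h *: (fun t => p (x +i* t))).
    by apply/funext.
  apply: is_deriveB.
    by apply: is_deriveB; apply: dB => //; exact: hxr.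
  apply: is_deriveZ; apply: is_derive_slicei.
  by have [] := dpq _ (inb _ _ (ltW xr) (ltW tr)).
have [t tr E] := MVT_ball dD yr.
have [s sh E2] : exists2 s : R, `|s| <= `|h| &
    q ((x +i* t) + h%:C * 1) - q (x +i* t) =
    h * partial 1 q ((x +i* t) + s%:C * 1).
  apply: MVT_line => s sh; rewrite line1E.
  by have [] := dpq _ (inb _ _ (ltW (hxr _ sh)) (ltW tr)).
rewrite !line1E in E2.
have [_ _ pE] := dpq _ (inb _ _ (ltW xr) (ltW tr)).
rewrite E2 pE -mulrBr in E.
have -> : h^-1 * (B (h + x) y - B (h + x) y0 - (B x y - B x y0))
    - (p (x +i* y) - p (x +i* y0)) = h^-1 * (D y - D y0).
  rewrite /D; move: (p (x +i* y)) (p (x +i* y0)) => u v; field.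
  exact: h0.
rewrite E -mulrA mulKf // normrM.
have kb : `|partial 1 q ((s + x) +i* t) - partial 1 q (x +i* t)| < eps / r.
  apply: H; last exact: le_lt_trans sh hrho.
  by have [? ?] := nb' _ _ tr; rewrite !ltW.
apply: (@le_lt_trans _ _ (eps / r * (r / 2))).
  by apply: ler_pM => //; exact: ltW.
rewrite mulrA divfK ?gt_eqF // ltr_pdivrMr // ltr_pMr ?ltr1n //.
Qed.

End PoincareLemma.

(** * Smooth real functions *)
Section Smooth.
Variable R : realType.
Implicit Types (z w e : R[i]) (f g : R[i] -> R) (D : set R[i]^o) (k : nat).

Definition axis e := e = 1 \/ e = 'i%C.

Definition is_partial e f z (l : R) := is_derive (0 : R) 1 (on_line e f z) l.

Lemma is_partialP e f z l :
  is_partial e f z l <-> has_partial e f z /\ partial e f z = l.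
Proof.
split=> [[df <-]|[df <-]].
  by split; [exact: df | rewrite /partial derive1E].
by apply: DeriveDef; [exact: df | rewrite -derive1E].
Qed.

Lemma has_partialP e f z : has_partial e f z -> is_partial e f z (partial e f z).
Proof. by move=> h; apply/is_partialP. Qed.

Lemma near_line e z D : axis e -> nbhs (z : R[i]^o) D ->
  \forall t \near (0 : R), D (z + t%:C * e).
Proof.
move=> eE /nbhs_boxP[r r0 rD]; apply/nbhs_ballP; exists r => // t.
rewrite /ball /= sub0r normrN => tr; apply: rD.
by case: eE => ->; [exact: box_line1 | exact: box_linei].
Qed.

Lemma is_partial_ext e f g z l : axis e ->
  (\forall w \near (z : R[i]^o), f w = g w) ->
  is_partial e f z l -> is_partial e g z l.
Proof.
by move=> eE fg; apply: near_eq_is_derive; exact: (near_line (D := fun w => f w = g w)).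
Qed.

Lemma partial_ext e f g z : axis e ->
  (\forall w \near (z : R[i]^o), f w = g w) -> partial e f z = partial e g z.
Proof.
move=> eE fg; rewrite /partial !derive1E; apply: near_eq_derive.
exact: (near_line (D := fun w => f w = g w)).
Qed.

Lemma open_near D z (P : R[i] -> Prop) : open D -> D z -> (forall w, D w -> P w) ->
  \forall w \near (z : R[i]^o), P w.
Proof. by move=> oD Dz DP; apply: filterS (open_nbhs_nbhs (conj oD Dz)). Qed.

Lemma continuous_ext_on D f g (z : R[i]^o) : open D -> D z ->
  (forall w, D w -> f w = g w) ->
  {for z, continuous (f : R[i]^o -> R)} -> {for z, continuous (g : R[i]^o -> R)}.
Proof.
move=> oD Dz fg cf.
move=> A; rewrite -(fg z Dz) => fzA.
have fA : nbhs z (fun w => A (f w)) := cf A fzA.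
change (nbhs z (fun w => A (g w))).
by move: fA (open_near oD Dz fg); apply: filterS2 => w ? <-.
Qed.

Section PartialRules.
Variables (e : R[i]) (z : R[i]).

Lemma is_partial_cst (c : R) : is_partial e (fun=> c) z 0.
Proof. exact: is_derive_cst. Qed.

Lemma is_partialD f g l m : is_partial e f z l -> is_partial e g z m ->
  is_partial e (fun w => f w + g w) z (l + m).
Proof. exact: is_deriveD. Qed.

Lemma is_partialN f l : is_partial e f z l -> is_partial e (fun w => - f w) z (- l).
Proof. exact: is_deriveN. Qed.

Lemma is_partialM f g l m : is_partial e f z l -> is_partial e g z m ->
  is_partial e (fun w => f w * g w) z (l * g z + f z * m).
Proof.
move=> fl gm; have := is_deriveM fl gm; rewrite !on_line0.
by rewrite /GRing.scale /= addrC (mulrC (g z)).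
Qed.

Lemma is_partialV f l : f z != 0 -> is_partial e f z l ->
  is_partial e (fun w => (f w)^-1) z (- l * ((f z)^-1 * (f z)^-1)).
Proof.
move=> fz0 fl; have f0 : on_line e f z 0 != 0 by rewrite on_line0.
have := @is_deriveV R (on_line e f z) 0 l 1 f0 fl; rewrite on_line0.
suff -> : - l * ((f z)^-1 * (f z)^-1) = - (f z) ^- 2 *: l by [].
by rewrite /GRing.scale /= -exprVn; ring.
Qed.

End PartialRules.

Lemma Ck_on0 k D f : Ck_on k D f ->
  forall z : R[i]^o, D z -> {for z, continuous (f : R[i]^o -> R)}.
Proof. by case: k => [|k] []. Qed.

Lemma Ck_onS k D f : Ck_on k.+1 D f ->
  [/\ forall z : R[i]^o, D z -> {for z, continuous (f : R[i]^o -> R)},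
      forall e z, axis e -> D z -> has_partial e f z &
      forall e, axis e -> Ck_on k D (partial e f)].
Proof.
move=> [cf [df f1 fi]]; split => //.
- by move=> e z [->|->] /df[].
- by move=> e [->|->].
Qed.

Lemma Ck_onSI k D f :
  (forall z : R[i]^o, D z -> {for z, continuous (f : R[i]^o -> R)}) ->
  (forall e z, axis e -> D z -> has_partial e f z) ->
  (forall e, axis e -> Ck_on k D (partial e f)) -> Ck_on k.+1 D f.
Proof.
move=> cf df kf; split=> //; split.
- by move=> z Dz; split; apply: df => //; [left|right].
- by apply: kf; left.
- by apply: kf; right.
Qed.

Lemma Ck_on_ext k D f g : open D -> (forall z, D z -> f z = g z) ->
  Ck_on k D f -> Ck_on k D g.
Proof.
move=> oD; elim: k f g => [|k IH] f g fg.
- move=> [cf _]; split => // z Dz.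
  exact: continuous_ext_on oD Dz fg (cf z Dz).
- move=> /Ck_onS[cf df kf]; apply: Ck_onSI.
  + by move=> z Dz; exact: continuous_ext_on oD Dz fg (cf z Dz).
  + move=> e z eE Dz.
    have fl := has_partialP (df _ _ eE Dz).
    by have [] := (is_partialP _ _ _ _).1
      (is_partial_ext eE (open_near oD Dz fg) fl).
  + move=> e eE; apply: IH (kf e eE) => z Dz; apply: partial_ext => //.
    exact: open_near Dz fg.
Qed.

Lemma Ck_onW k D f : Ck_on k.+1 D f -> Ck_on k D f.
Proof.
elim: k f => [|k IH] f; first by move=> [cf _]; split.
move=> /Ck_onS[cf df kf]; apply: Ck_onSI => // e eE.
by apply: IH; exact: kf.
Qed.

Lemma Ck_on_cst k D (c : R) : Ck_on k D (fun=> c).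
Proof.
elim: k c => [|k IH] c; first by split => // z _; exact: (@cst_continuous R[i]^o R c z).
apply: Ck_onSI; first by move=> z _; exact: (@cst_continuous R[i]^o R c z).
- by move=> e z _ _; have [] := (is_partialP _ _ _ _).1 (is_partial_cst e z c).
- move=> e _; suff -> : partial e (fun=> c) = (fun=> 0) by [].
  apply/funext => z.
  by have [] := (is_partialP _ _ _ _).1 (is_partial_cst e z c).
Qed.

Lemma Ck_onD k D f g : open D -> Ck_on k D f -> Ck_on k D g ->
  Ck_on k D (fun w => f w + g w).
Proof.
move=> oD; elim: k f g => [|k IH] f g.
  by move=> [cf _] [cg _]; split => // z Dz; exact: (continuousD (cf z Dz) (cg z Dz)).
move=> /Ck_onS[cf df kf] /Ck_onS[cg dg kg].
have E e z : axis e -> D z ->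
    is_partial e (fun w => f w + g w) z (partial e f z + partial e g z).
  by move=> eE Dz; apply: is_partialD; apply: has_partialP; [exact: df|exact: dg].
apply: Ck_onSI.
- by move=> z Dz; exact: (continuousD (cf z Dz) (cg z Dz)).
- by move=> e z eE Dz; have [] := (is_partialP _ _ _ _).1 (E e z eE Dz).
- move=> e eE; apply: Ck_on_ext (IH _ _ (kf e eE) (kg e eE)) => // z Dz.
  by have [_ ->] := (is_partialP _ _ _ _).1 (E e z eE Dz).
Qed.

Lemma Ck_onM k D f g : open D -> Ck_on k D f -> Ck_on k D g ->
  Ck_on k D (fun w => f w * g w).
Proof.
move=> oD; elim: k f g => [|k IH] f g.
  by move=> [cf _] [cg _]; split => // z Dz; exact: (continuousM (cf z Dz) (cg z Dz)).
move=> /[dup] /Ck_onW f' /Ck_onS[cf df kf] /[dup] /Ck_onW g' /Ck_onS[cg dg kg].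
have E e z : axis e -> D z -> is_partial e (fun w => f w * g w) z
    (partial e f z * g z + f z * partial e g z).
  by move=> eE Dz; apply: is_partialM; apply: has_partialP; [exact: df|exact: dg].
apply: Ck_onSI.
- by move=> z Dz; exact: (continuousM (cf z Dz) (cg z Dz)).
- by move=> e z eE Dz; have [] := (is_partialP _ _ _ _).1 (E e z eE Dz).
- move=> e eE.
  apply: Ck_on_ext (Ck_onD oD (IH _ _ (kf e eE) g') (IH _ _ f' (kg e eE))) => //.
  by move=> z Dz; have [_ ->] := (is_partialP _ _ _ _).1 (E e z eE Dz).
Qed.

Lemma Ck_onN k D f : open D -> Ck_on k D f -> Ck_on k D (fun w => - f w).
Proof.
move=> oD kf; apply: Ck_on_ext (Ck_onM oD (Ck_on_cst k D (-1)) kf) => //.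
by move=> z _; rewrite mulN1r.
Qed.

Lemma Ck_onV k D f : open D -> (forall z, D z -> f z != 0) ->
  Ck_on k D f -> Ck_on k D (fun w => (f w)^-1).
Proof.
move=> oD f0; elim: k => [|k IH].
  by move=> [cf _]; split => // z Dz; exact: (continuousV (f0 z Dz) (cf z Dz)).
move=> /[dup] /Ck_onW /IH f' /Ck_onS[cf df kf].
have E e z : axis e -> D z -> is_partial e (fun w => (f w)^-1) z
    (- partial e f z * ((f z)^-1 * (f z)^-1)).
  by move=> eE Dz; apply: is_partialV; [exact: f0|apply: has_partialP; exact: df].
apply: Ck_onSI.
- by move=> z Dz; exact: (continuousV (f0 z Dz) (cf z Dz)).
- by move=> e z eE Dz; have [] := (is_partialP _ _ _ _).1 (E e z eE Dz).
- move=> e eE.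
  apply: Ck_on_ext (Ck_onM oD (Ck_onN oD (kf e eE)) (Ck_onM oD f' f')) => //.
  by move=> z Dz; have [_ ->] := (is_partialP _ _ _ _).1 (E e z eE Dz).
Qed.

Lemma smooth_partial D f e : axis e -> smooth_on D f -> smooth_on D (partial e f).
Proof. by move=> eE sf k; have [_ _] := Ck_onS (sf k.+1); exact. Qed.

Lemma smooth_has_partial D f e z : axis e -> smooth_on D f -> D z ->
  has_partial e f z.
Proof. by move=> eE sf Dz; have [_ h _] := Ck_onS (sf 1%N); exact: h. Qed.

Lemma smooth_continuous D f (z : R[i]^o) : smooth_on D f -> D z ->
  {for z, continuous (f : R[i]^o -> R)}.
Proof. by move=> sf Dz; exact: (Ck_on0 (sf 0%N)). Qed.

Lemma smooth_ext D f g : open D -> (forall z, D z -> f z = g z) ->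
  smooth_on D f -> smooth_on D g.
Proof. by move=> oD fg sf k; exact: Ck_on_ext (sf k). Qed.

Lemma smooth_sub D D' f : D' `<=` D -> smooth_on D f -> smooth_on D' f.
Proof.
move=> D'D sf k; elim: k f sf => [|k IH] f sf.
  by split => // z /D'D Dz; exact: smooth_continuous sf Dz.
apply: Ck_onSI.
- by move=> z /D'D Dz; exact: smooth_continuous sf Dz.
- by move=> e z eE /D'D Dz; exact: smooth_has_partial eE sf Dz.
- by move=> e eE; apply: IH; exact: smooth_partial.
Qed.

(** Primitives of smooth forms are recognized as smooth by this lemma: their
    partial derivatives are given. *)
Lemma smooth_of_partials D f :
  (forall z : R[i]^o, D z -> {for z, continuous (f : R[i]^o -> R)}) ->
  (forall e z, axis e -> D z -> has_partial e f z) ->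
  (forall e, axis e -> smooth_on D (partial e f)) -> smooth_on D f.
Proof.
move=> cf df kf [|k]; first by split.
by apply: Ck_onSI => // e eE; exact: kf.
Qed.

Lemma smooth_C1_at D f z : open D -> smooth_on D f -> D z -> C1_at f z.
Proof.
move=> oD sf Dz; split.
- have /nbhs_boxP[r r0 rD] : nbhs (z : R[i]^o) D by exact: open_nbhs_nbhs.
  exists r => // w /rD Dw; split; apply: smooth_has_partial sf Dw; by [left|right].
- by apply: smooth_continuous (smooth_partial _ sf) Dz; left.
- by apply: smooth_continuous (smooth_partial _ sf) Dz; right.
Qed.

Lemma smooth_Schwarz D f z : open D -> smooth_on D f -> D z ->
  partial 'i%C (partial 1 f) z = partial 1 (partial 'i%C f) z.
Proof.
move=> oD sf Dz.
have a1 : axis 1 by left.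
have ai : axis 'i%C by right.
have /nbhs_boxP[r r0 rD] : nbhs (z : R[i]^o) D by exact: open_nbhs_nbhs.
apply: (Schwarz r0).
- move=> w /rD Dw; split.
  + exact: smooth_has_partial a1 sf Dw.
  + exact: smooth_has_partial ai sf Dw.
  + exact: smooth_has_partial ai (smooth_partial a1 sf) Dw.
  + exact: smooth_has_partial a1 (smooth_partial ai sf) Dw.
- exact: smooth_continuous (smooth_partial ai (smooth_partial a1 sf)) Dz.
- exact: smooth_continuous (smooth_partial a1 (smooth_partial ai sf)) Dz.
Qed.

End Smooth.

(** * Wirtinger calculus *)
Section Wirtinger.
Variable R : realType.
Implicit Types (z w e : R[i]) (f g : R[i] -> R[i]) (D : set R[i]^o).

Lemma Re_mul (x y : R[i]) : complex.Re (x * y) =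
  complex.Re x * complex.Re y - complex.Im x * complex.Im y.
Proof. by case: x y => [? ?] [? ?]. Qed.

Lemma Im_mul (x y : R[i]) : complex.Im (x * y) =
  complex.Re x * complex.Im y + complex.Im x * complex.Re y.
Proof. by case: x y => [? ?] [? ?]. Qed.

Lemma Re_add (x y : R[i]) : complex.Re (x + y) = complex.Re x + complex.Re y.
Proof. by case: x y => [? ?] [? ?]. Qed.

Lemma Im_add (x y : R[i]) : complex.Im (x + y) = complex.Im x + complex.Im y.
Proof. by case: x y => [? ?] [? ?]. Qed.

Lemma Re_opp (x : R[i]) : complex.Re (- x) = - complex.Re x.
Proof. by case: x. Qed.

Lemma Im_opp (x : R[i]) : complex.Im (- x) = - complex.Im x.
Proof. by case: x. Qed.

Lemma Re_conjc (x : R[i]) : complex.Re x^*%C = complex.Re x.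
Proof. by case: x. Qed.

Lemma Im_conjc (x : R[i]) : complex.Im x^*%C = - complex.Im x.
Proof. by case: x. Qed.

Lemma Re_inv (x : R[i]) : complex.Re x^-1 =
  complex.Re x * (complex.Re x * complex.Re x + complex.Im x * complex.Im x)^-1.
Proof. by case: x. Qed.

Lemma Im_inv (x : R[i]) : complex.Im x^-1 =
  - (complex.Im x * (complex.Re x * complex.Re x + complex.Im x * complex.Im x)^-1).
Proof. by case: x. Qed.

Lemma complex_inj (x y : R[i]) : complex.Re x = complex.Re y ->
  complex.Im x = complex.Im y -> x = y.
Proof. by case: x y => [? ?] [? ?] /= -> ->. Qed.

Lemma mulii : 'i%C * 'i%C = -1 :> R[i].
Proof. by rewrite -expr2 sqr_i. Qed.

Definition is_cpartial e f z (l : R[i]) :=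
  is_partial e (fun w => complex.Re (f w)) z (complex.Re l) /\
  is_partial e (fun w => complex.Im (f w)) z (complex.Im l).

Lemma is_cpartial_val e f z l : is_cpartial e f z l -> cpartial e f z = l.
Proof.
move=> [/is_partialP[_ fr] /is_partialP[_ fi]].
by rewrite /cpartial fr fi; case: l {fr fi}.
Qed.

Lemma is_cpartial_cst e z (c : R[i]) : is_cpartial e (fun=> c) z 0.
Proof. by split; exact: is_partial_cst. Qed.

Lemma is_cpartialD e f g z l m : is_cpartial e f z l -> is_cpartial e g z m ->
  is_cpartial e (fun w => f w + g w) z (l + m).
Proof.
move=> [fr fi] [gr gi]; split; rewrite ?Re_add ?Im_add.
  by under eq_fun do rewrite Re_add; exact: is_partialD.
by under eq_fun do rewrite Im_add; exact: is_partialD.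
Qed.

Lemma is_cpartialN e f z l : is_cpartial e f z l ->
  is_cpartial e (fun w => - f w) z (- l).
Proof.
move=> [fr fi]; split; rewrite ?Re_opp ?Im_opp.
  by under eq_fun do rewrite Re_opp; exact: is_partialN.
by under eq_fun do rewrite Im_opp; exact: is_partialN.
Qed.

Lemma is_cpartial_conj e f z l : is_cpartial e f z l ->
  is_cpartial e (fun w => (f w)^*%C) z l^*%C.
Proof.
move=> [fr fi]; split; rewrite ?Re_conjc ?Im_conjc.
  by under eq_fun do rewrite Re_conjc.
by under eq_fun do rewrite Im_conjc; exact: is_partialN.
Qed.

Lemma is_cpartialM e f g z l m : is_cpartial e f z l -> is_cpartial e g z m ->
  is_cpartial e (fun w => f w * g w) z (l * g z + f z * m).
Proof.
move=> [fr fi] [gr gi]; split.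
- under eq_fun do rewrite Re_mul.
  have -> : complex.Re (l * g z + f z * m) =
    (complex.Re l * complex.Re (g z) + complex.Re (f z) * complex.Re m) +
    - (complex.Im l * complex.Im (g z) + complex.Im (f z) * complex.Im m).
    by rewrite Re_add !Re_mul; ring.
  by apply: is_partialD; [|apply: is_partialN]; exact: is_partialM.
- under eq_fun do rewrite Im_mul.
  have -> : complex.Im (l * g z + f z * m) =
    (complex.Re l * complex.Im (g z) + complex.Re (f z) * complex.Im m) +
    (complex.Im l * complex.Re (g z) + complex.Im (f z) * complex.Re m).
    by rewrite Im_add !Im_mul; ring.
  by apply: is_partialD; exact: is_partialM.
Qed.

Lemma is_cpartial_ext D e f g z l : axis e -> open D -> D z ->
  (forall w, D w -> f w = g w) -> is_cpartial e f z l -> is_cpartial e g z l.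
Proof.
move=> eE oD Dz fg [fr fi]; split.
- by apply: is_partial_ext fr => //; apply: (open_near oD Dz) => w /fg ->.
- by apply: is_partial_ext fi => //; apply: (open_near oD Dz) => w /fg ->.
Qed.

(** a = f_z and b = f_zbar.  As a relation, which carries the existence of the
    partial derivatives, this is stable under sums, products and conjugation
    without side conditions: the derivatives of a composed expression are read off
    the proof term that assembles the rules. *)
Definition is_wirt f z (a b : R[i]) :=
  is_cpartial 1 f z (a + b) /\ is_cpartial 'i%C f z ('i%C * (a - b)).

Lemma is_wirt_dz f z a b : is_wirt f z a b -> dz f z = a.
Proof.
move=> [/is_cpartial_val f1 /is_cpartial_val fi].
rewrite /dz f1 fi mulrA mulii; by field.
Qed.

Lemma is_wirt_dzbar f z a b : is_wirt f z a b -> dzbar f z = b.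
Proof.
move=> [/is_cpartial_val f1 /is_cpartial_val fi].
rewrite /dzbar f1 fi mulrA mulii; by field.
Qed.

Lemma is_wirt_cst z c : is_wirt (fun=> c) z 0 0.
Proof. by split; rewrite ?subr0 ?mulr0 ?addr0; exact: is_cpartial_cst. Qed.

Lemma is_wirtD f g z a b a' b' : is_wirt f z a b -> is_wirt g z a' b' ->
  is_wirt (fun w => f w + g w) z (a + a') (b + b').
Proof.
move=> [f1 fi] [g1 gi]; split; first by rewrite addrACA; exact: is_cpartialD.
by rewrite opprD addrACA mulrDr; exact: is_cpartialD.
Qed.

Lemma is_wirtN f z a b : is_wirt f z a b -> is_wirt (fun w => - f w) z (- a) (- b).
Proof.
move=> [f1 fi]; split; first by rewrite -opprD; exact: is_cpartialN.
by rewrite -opprD mulrN; exact: is_cpartialN.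
Qed.

Lemma is_wirtB f g z a b a' b' : is_wirt f z a b -> is_wirt g z a' b' ->
  is_wirt (fun w => f w - g w) z (a - a') (b - b').
Proof. by move=> ? ?; apply: is_wirtD => //; exact: is_wirtN. Qed.

Lemma is_wirtM f g z a b a' b' : is_wirt f z a b -> is_wirt g z a' b' ->
  is_wirt (fun w => f w * g w) z (a * g z + f z * a') (b * g z + f z * b').
Proof.
move=> [f1 fi] [g1 gi]; split.
  have -> : a * g z + f z * a' + (b * g z + f z * b') =
    (a + b) * g z + f z * (a' + b') by ring.
  exact: is_cpartialM.
have -> : 'i%C * (a * g z + f z * a' - (b * g z + f z * b')) =
  ('i%C * (a - b)) * g z + f z * ('i%C * (a' - b')) by ring.
exact: is_cpartialM.
Qed.

Lemma conj_i : ('i%C : R[i])^*%C = - 'i%C.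
Proof. by apply: complex_inj; rewrite /= ?oppr0. Qed.

Lemma conjD (x y : R[i]) : (x + y)^*%C = x^*%C + y^*%C.
Proof. exact: rmorphD. Qed.

Lemma conjB (x y : R[i]) : (x - y)^*%C = x^*%C - y^*%C.
Proof. exact: rmorphB. Qed.

Lemma conjM (x y : R[i]) : (x * y)^*%C = x^*%C * y^*%C.
Proof. exact: rmorphM. Qed.

Lemma conjN (x : R[i]) : (- x)^*%C = - x^*%C.
Proof. exact: rmorphN. Qed.

Lemma is_wirt_conj f z a b : is_wirt f z a b ->
  is_wirt (fun w => (f w)^*%C) z b^*%C a^*%C.
Proof.
move=> [f1 fi]; split.
  by rewrite addrC -conjD; exact: is_cpartial_conj.
suff -> : 'i%C * (b^*%C - a^*%C) = ('i%C * (a - b))^*%C by exact: is_cpartial_conj.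
by rewrite conjM conjB conj_i; ring.
Qed.

Lemma is_wirt_ext D f g z a b : open D -> D z ->
  (forall w, D w -> f w = g w) -> is_wirt f z a b -> is_wirt g z a b.
Proof.
move=> oD Dz fg [f1 fi]; split.
- exact: (is_cpartial_ext (or_introl erefl) oD Dz fg f1).
- exact: (is_cpartial_ext (or_intror erefl) oD Dz fg fi).
Qed.

Lemma is_wirt_uniq f z a b a' b' : is_wirt f z a b -> is_wirt f z a' b' ->
  a = a' /\ b = b'.
Proof.
move=> f1 f2; rewrite -(is_wirt_dz f1) -(is_wirt_dzbar f1).
by rewrite (is_wirt_dz f2) (is_wirt_dzbar f2).
Qed.

(** A real differential is 2 Re (a dz) with a = f_z, and f_zbar is then the
    conjugate of a.  Closed real 1-forms are given by their a below. *)
Lemma is_wirt_real (f : R[i] -> R) z a :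
  is_wirt (fun w => (f w)%:C) z a a^*%C <->
  is_partial 1 f z (2 * complex.Re a) /\
  is_partial 'i%C f z (- (2 * complex.Im a)).
Proof.
have E1 : complex.Re (a + a^*%C) = 2 * complex.Re a.
  by rewrite Re_add Re_conjc; ring.
have E2 : complex.Re ('i%C * (a - a^*%C)) = - (2 * complex.Im a).
  by rewrite Re_mul Im_add Im_opp Im_conjc /=; ring.
have E3 : complex.Im (a + a^*%C) = 0 by rewrite Im_add Im_conjc subrr.
have E4 : complex.Im ('i%C * (a - a^*%C)) = 0.
  by rewrite Im_mul Re_add Re_opp Re_conjc /=; ring.
split=> [[[f1 _] [fi _]]|[f1 fi]]; first by rewrite -E1 -E2.
rewrite -E1 in f1; rewrite -E2 in fi.
split; split => //; rewrite ?E3 ?E4; exact: is_partial_cst.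
Qed.

Definition csmooth D f :=
  smooth_on D (fun w => complex.Re (f w)) /\
  smooth_on D (fun w => complex.Im (f w)).

Lemma csmooth_is_cpartial D f e z : csmooth D f -> axis e -> D z ->
  is_cpartial e f z (cpartial e f z).
Proof.
move=> [fr fi] eE Dz; split; apply: has_partialP;
  exact: smooth_has_partial eE _ Dz.
Qed.

Lemma csmooth_wirt D f z : csmooth D f -> D z ->
  is_wirt f z (dz f z) (dzbar f z).
Proof.
move=> sf Dz; rewrite /dz /dzbar; split.
  have -> : 2^-1 * (cpartial 1 f z - 'i%C * cpartial 'i%C f z) +
     2^-1 * (cpartial 1 f z + 'i%C * cpartial 'i%C f z) = cpartial 1 f z.
    by move: (cpartial 1 f z) (cpartial 'i%C f z) => x y; field.
  by apply: csmooth_is_cpartial sf _ Dz; left.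
have -> : 'i%C * (2^-1 * (cpartial 1 f z - 'i%C * cpartial 'i%C f z) -
     2^-1 * (cpartial 1 f z + 'i%C * cpartial 'i%C f z)) = cpartial 'i%C f z.
  move: (cpartial 1 f z) (cpartial 'i%C f z) => x y.
  have -> : 2^-1 * (x - 'i%C * y) - 2^-1 * (x + 'i%C * y) = - 'i%C * y.
    by field.
  by rewrite mulrA mulrN mulii opprK mul1r.
by apply: csmooth_is_cpartial sf _ Dz; right.
Qed.

Section Closure.
Variable D : set R[i]^o.
Hypothesis oD : open D.

Lemma smoothD (f g : R[i] -> R) : smooth_on D f -> smooth_on D g ->
  smooth_on D (fun w => f w + g w).
Proof. by move=> sf sg k; exact: Ck_onD. Qed.

Lemma smoothM (f g : R[i] -> R) : smooth_on D f -> smooth_on D g ->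
  smooth_on D (fun w => f w * g w).
Proof. by move=> sf sg k; exact: Ck_onM. Qed.

Lemma smoothN (f : R[i] -> R) : smooth_on D f -> smooth_on D (fun w => - f w).
Proof. by move=> sf k; exact: Ck_onN. Qed.

Lemma smoothV (f : R[i] -> R) : (forall z, D z -> f z != 0) ->
  smooth_on D f -> smooth_on D (fun w => (f w)^-1).
Proof. by move=> f0 sf k; exact: Ck_onV. Qed.

Lemma smooth_cst (c : R) : smooth_on D (fun=> c).
Proof. by move=> k; exact: Ck_on_cst. Qed.

Lemma csmooth_cst c : csmooth D (fun=> c).
Proof. by split; exact: smooth_cst. Qed.

Lemma csmooth_real (f : R[i] -> R) : smooth_on D f -> csmooth D (fun w => (f w)%:C).
Proof. by split => //; exact: smooth_cst. Qed.

Lemma csmoothD f g : csmooth D f -> csmooth D g -> csmooth D (fun w => f w + g w).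
Proof.
move=> [? ?] [? ?]; split.
  by under eq_fun do rewrite Re_add; exact: smoothD.
by under eq_fun do rewrite Im_add; exact: smoothD.
Qed.

Lemma csmoothN f : csmooth D f -> csmooth D (fun w => - f w).
Proof.
move=> [? ?]; split.
  by under eq_fun do rewrite Re_opp; exact: smoothN.
by under eq_fun do rewrite Im_opp; exact: smoothN.
Qed.

Lemma csmoothB f g : csmooth D f -> csmooth D g -> csmooth D (fun w => f w - g w).
Proof. by move=> ? ?; apply: csmoothD => //; exact: csmoothN. Qed.

Lemma csmooth_conj f : csmooth D f -> csmooth D (fun w => (f w)^*%C).
Proof.
move=> [? ?]; split; first by under eq_fun do rewrite Re_conjc.
by under eq_fun do rewrite Im_conjc; exact: smoothN.
Qed.

Lemma csmoothM f g : csmooth D f -> csmooth D g -> csmooth D (fun w => f w * g w).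
Proof.
move=> [? ?] [? ?]; split.
  under eq_fun do rewrite Re_mul.
  by apply: smoothD; [|apply: smoothN]; exact: smoothM.
under eq_fun do rewrite Im_mul.
by apply: smoothD; exact: smoothM.
Qed.

Lemma csmoothV f : (forall z, D z -> f z != 0) -> csmooth D f ->
  csmooth D (fun w => (f w)^-1).
Proof.
move=> f0 [fr fi].
have s : smooth_on D (fun w => (complex.Re (f w) * complex.Re (f w) +
    complex.Im (f w) * complex.Im (f w))^-1).
  apply: smoothV; last by apply: smoothD; exact: smoothM.
  move=> z /f0; apply: contra_neq; case: (f z) => a b /= h.
  have /eqP := h; rewrite -!expr2 paddr_eq0 ?sqr_ge0 // !sqrf_eq0.
  by move=> /andP[/eqP -> /eqP ->].
split; first by under eq_fun do rewrite Re_inv; exact: smoothM.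
by under eq_fun do rewrite Im_inv; apply: smoothN; exact: smoothM.
Qed.

Lemma csmooth_cpartial f e : axis e -> csmooth D f -> csmooth D (cpartial e f).
Proof. by move=> eE [fr fi]; split; exact: smooth_partial. Qed.

Lemma csmooth_dz f : csmooth D f -> csmooth D (dz f).
Proof.
move=> sf; apply: csmoothM; first exact: csmooth_cst.
apply: csmoothB; first by apply: csmooth_cpartial sf; left.
apply: csmoothM; first exact: csmooth_cst.
by apply: csmooth_cpartial sf; right.
Qed.

(** The derivatives of 1/f come from those of the constant f (1/f), once 1/f is
    known to be smooth. *)
Lemma is_wirtV f z a b : (forall z, D z -> f z != 0) -> csmooth D f -> D z ->
  is_wirt f z a b ->
  is_wirt (fun w => (f w)^-1) z (- a / (f z * f z)) (- b / (f z * f z)).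
Proof.
move=> f0 sf Dz fw; have gw := csmooth_wirt (csmoothV f0 sf) Dz.
have fz0 := f0 z Dz.
have H1 := is_wirt_ext oD Dz (fun w Dw => mulfV (f0 w Dw)) (is_wirtM fw gw).
have [A B] := is_wirt_uniq H1 (is_wirt_cst z 1).
have sol (x c : R[i]) : x / f z + f z * c = 0 -> c = - x / (f z * f z).
  move=> E; have -> : c = ((x / f z + f z * c) - x / f z) / f z.
    by rewrite addrC addKr mulrC mulKf.
  by rewrite E sub0r mulNr mulNr -mulrA invfM.
by rewrite -(sol _ _ A) -(sol _ _ B).
Qed.

Lemma cpartial_comm f z : csmooth D f -> D z ->
  cpartial 'i%C (cpartial 1 f) z = cpartial 1 (cpartial 'i%C f) z.
Proof.
move=> [fr fi] Dz; apply: complex_inj.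
- exact: smooth_Schwarz oD fr Dz.
- exact: smooth_Schwarz oD fi Dz.
Qed.

Lemma cpartial_lin f g e z (c d : R[i]) : axis e -> D z ->
  csmooth D f -> csmooth D g ->
  cpartial e (fun w => c * (f w + d * g w)) z =
  c * (cpartial e f z + d * cpartial e g z).
Proof.
move=> eE Dz sf sg.
have F := csmooth_is_cpartial sf eE Dz; have G := csmooth_is_cpartial sg eE Dz.
have := is_cpartialM (is_cpartial_cst e z c)
  (is_cpartialD F (is_cpartialM (is_cpartial_cst e z d) G)).
by rewrite !mul0r !add0r => /is_cpartial_val.
Qed.

Lemma dz_dzbar f z : csmooth D f -> D z ->
  dz (dzbar f) z =
    4^-1 * (cpartial 1 (cpartial 1 f) z + cpartial 'i%C (cpartial 'i%C f) z) /\
  dzbar (dz f) z =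
    4^-1 * (cpartial 1 (cpartial 1 f) z + cpartial 'i%C (cpartial 'i%C f) z).
Proof.
move=> sf Dz.
have a1 : axis (1 : R[i]) by left.
have ai : axis ('i%C : R[i]) by right.
have s1 := csmooth_cpartial a1 sf; have si := csmooth_cpartial ai sf.
have bE : dzbar f = (fun w => 2^-1 * (cpartial 1 f w + 'i%C * cpartial 'i%C f w)).
  by [].
have zE : dz f = (fun w => 2^-1 * (cpartial 1 f w + (- 'i%C) * cpartial 'i%C f w)).
  by apply/funext => w; rewrite /dz mulNr.
split.
- rewrite /dz bE !cpartial_lin // cpartial_comm //.
  move: (cpartial 1 _ z) (cpartial 'i%C _ z) (cpartial 1 (cpartial 'i%C f) z) => x y t.
  have := mulii; move: 'i%C => ii E.
  have -> : 2^-1 * (2^-1 * (x + ii * t) - ii * (2^-1 * (t + ii * y))) =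
    4^-1 * (x - (ii * ii) * y) by field; rewrite ?pnatr_eq0.
  by rewrite E mulN1r opprK.
- rewrite /dzbar zE !cpartial_lin // cpartial_comm //.
  move: (cpartial 1 _ z) (cpartial 'i%C _ z) (cpartial 1 (cpartial 'i%C f) z) => x y t.
  have := mulii; move: 'i%C => ii E.
  have -> : 2^-1 * (2^-1 * (x + - ii * t) + ii * (2^-1 * (t + - ii * y))) =
    4^-1 * (x - (ii * ii) * y) by field; rewrite ?pnatr_eq0.
  by rewrite E mulN1r opprK.
Qed.

End Closure.

(** For holomorphic tau, (f o tau)_z = (f_z o tau) tau': a chart change multiplies
    the coefficient of dz by tau', and that of dzbar by its conjugate. *)
Lemma is_wirt_comp_holomorphic D f (tau : R[i]^o -> R[i]^o) (z : R[i]^o) :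
  open D -> csmooth D f -> D (tau z) -> derivable tau z (1 : R[i]^o) ->
  is_wirt (f \o tau) z (dz f (tau z) * cderiv tau z)
    (dzbar f (tau z) * (cderiv tau z)^*%C).
Proof.
move=> oD [fr fi] Dt dt.
have C1r := smooth_C1_at oD fr Dt; have C1i := smooth_C1_at oD fi Dt.
have H e : axis e -> is_cpartial e (f \o tau) z
   (cpartial 1 f (tau z) * (complex.Re (cderiv tau z * e))%:C +
    cpartial 'i%C f (tau z) * (complex.Im (cderiv tau z * e))%:C).
  move=> eE; split.
  - have := is_derive_comp_holomorphic dt eE C1r.
    by rewrite Re_add !Re_mul /= !mulr0 !subr0.
  - have := is_derive_comp_holomorphic dt eE C1i.
    by rewrite Im_add !Im_mul /= !mulr0 !add0r.
have [H1 Hi] := (H 1 (or_introl erefl), H 'i%C (or_intror erefl)).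
move: H1 Hi; rewrite /dz /dzbar mulr1 Re_mul Im_mul /= mulr0 mulr1 mulr0 sub0r mulr1 addr0.
move: (cpartial 1 f (tau z)) (cpartial 'i%C f (tau z)) (cderiv tau z) => x y t.
set u := complex.Re t; set v := complex.Im t => H1 Hi.
have tE : t = u%:C + 'i%C * v%:C.
  by apply: complex_inj; rewrite /= ?mul0r ?mul1r ?subr0 ?subrr ?addr0 ?add0r.
have tbE : t^*%C = u%:C - 'i%C * v%:C.
  by rewrite tE conjD conjM conj_i !conjc_real mulNr.
have i2 := mulii.
split.
- suff -> : 2^-1 * (x - 'i%C * y) * t + 2^-1 * (x + 'i%C * y) * t^*%C =
    x * u%:C + y * v%:C by [].
  rewrite tbE tE; move: 'i%C i2 u%:C v%:C => ii E a b.
  have -> : 2^-1 * (x - ii * y) * (a + ii * b) + 2^-1 * (x + ii * y) * (a - ii * b)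
    = x * a - (ii * ii) * (y * b) by field; rewrite ?pnatr_eq0.
  by rewrite E mulN1r opprK.
- suff -> : 'i%C * (2^-1 * (x - 'i%C * y) * t - 2^-1 * (x + 'i%C * y) * t^*%C) =
    x * (- v)%:C + y * u%:C by [].
  have -> : (- v)%:C = - v%:C by apply: complex_inj; rewrite /= ?oppr0.
  rewrite tbE tE; move: 'i%C i2 u%:C v%:C => ii E a b.
  have -> : ii * (2^-1 * (x - ii * y) * (a + ii * b) - 2^-1 * (x + ii * y) * (a - ii * b))
    = (ii * ii) * (x * b - y * a) by field; rewrite ?pnatr_eq0.
  by rewrite E; ring.
Qed.

(** The real form 2 Re (psi dz) = p du + q dv has p = 2 Re psi and q = - 2 Im psi,
    and p_v = q_u says that psi_zbar is real. *)
Lemma local_primitive D (psi : R[i] -> R[i]) (z0 : R[i]) :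
  open D -> csmooth D psi -> D z0 ->
  (forall z, D z -> complex.Im (dzbar psi z) = 0) ->
  exists f : R[i] -> R, exists2 r : R, 0 < r & forall w, box z0 r w ->
    D w /\ is_wirt (fun w => (f w)%:C) w (psi w) (psi w)^*%C.
Proof.
move=> oD [sr si] Dz closed.
have /nbhs_boxP[r r0 rD] : nbhs (z0 : R[i]^o) D by exact: open_nbhs_nbhs.
have a1 : axis (1 : R[i]) by left.
have ai : axis ('i%C : R[i]) by right.
pose p w := 2 * complex.Re (psi w); pose q w := - (2 * complex.Im (psi w)).
have sp : smooth_on D p by apply: smoothM => //; exact: smooth_cst.
have sq : smooth_on D q.
  by apply: smoothN => //; apply: smoothM => //; exact: smooth_cst.
have [|w Dw|f fP] := @poincare_box R z0 r p q r0.
- move=> w /rD Dw; split; first exact: smooth_continuous sp Dw.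
    exact: smooth_continuous sq Dw.
  exact: smooth_continuous (smooth_partial a1 sq) Dw.
- have {}Dw := rD _ Dw.
  have hp := smooth_has_partial ai sp Dw; have hq := smooth_has_partial a1 sq Dw.
  split; [exact: hp | exact: hq |].
  have h1 := has_partialP (smooth_has_partial ai sr Dw).
  have h2 := has_partialP (smooth_has_partial a1 si Dw).
  have [_] := (is_partialP _ _ _ _).1 (is_partialM (is_partial_cst 'i%C w 2) h1).
  have [_] := (is_partialP _ _ _ _).1
     (is_partialN (is_partialM (is_partial_cst 1 w 2) h2)).
  rewrite !mul0r !add0r -/p -/q => -> ->.
  have := closed w Dw; rewrite /dzbar Im_mul Im_add (Im_mul 'i%C).
  have -> : (2^-1 : R[i]) = (2^-1 : R)%:C by rewrite fmorphV rmorph_nat.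
  rewrite /= !mul0r mul1r add0r addr0 => /eqP.
  rewrite mulf_eq0 invr_eq0 pnatr_eq0 /= addrC addr_eq0 => /eqP ->.
  by rewrite mulrN.
- exists f; exists (r / 2); first by rewrite divr_gt0.
  move=> w wr; split; last by apply/is_wirt_real; exact: fP.
  by apply: rD; apply: box_subset wr; rewrite ler_pdivrMr // ler_peMr ?ler1n // ltW.
Qed.

End Wirtinger.

(** * The Levi-Civita connection of the Heisenberg group *)
Section Ord.

Lemma ord3P (P : 'I_3 -> Prop) : P 0 -> P 1 -> P 2 -> forall k, P k.
Proof.
move=> P0 P1 P2 [[|[|[|//]]] Hk].
- by have -> : Ordinal Hk = 0 by exact: val_inj.
- by have -> : Ordinal Hk = 1 by exact: val_inj.
- by have -> : Ordinal Hk = 2 by exact: val_inj.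
Qed.

Lemma ord2P (P : 'I_2 -> Prop) : P 0 -> P 1 -> forall k, P k.
Proof.
move=> P0 P1 [[|[|//]] Hk].
- by have -> : Ordinal Hk = 0 by exact: val_inj.
- by have -> : Ordinal Hk = 1 by exact: val_inj.
Qed.

Lemma sum3E (V : nmodType) (F : 'I_3 -> V) : \sum_i F i = F 0 + F 1 + F 2.
Proof.
rewrite !big_ord_recl big_ord0 addr0 addrA.
by congr (_ + _ + _); congr F; exact: val_inj.
Qed.

Lemma sum2E (V : nmodType) (F : 'I_2 -> V) : \sum_i F i = F 0 + F 1.
Proof.
by rewrite !big_ord_recl big_ord0 addr0; congr (_ + _); congr F; exact: val_inj.
Qed.

End Ord.

Section Nil3.
Variable R : realType.
Implicit Types (x v w p q : 'rV[R]_3).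

Definition row3 (a b c : R) : 'rV[R]_3 := \row_(k < 3) [:: a; b; c]`_k.

Lemma row3E0 a b c : row3 a b c 0 0 = a. Proof. by rewrite mxE. Qed.
Lemma row3E1 a b c : row3 a b c 0 1 = b. Proof. by rewrite mxE. Qed.
Lemma row3E2 a b c : row3 a b c 0 2 = c. Proof. by rewrite mxE. Qed.
Definition row3E := (row3E0, row3E1, row3E2).

Lemma row3P v w : v 0 0 = w 0 0 -> v 0 1 = w 0 1 -> v 0 2 = w 0 2 -> v = w.
Proof. by move=> *; apply/rowP; apply: ord3P. Qed.

(** The coordinates of v in the frame (E1, E2, E3) at x; see [frame_coordE]. *)
Definition lcoord x v : 'rV[R]_3 :=
  row3 (v 0 0) (v 0 1) (v 0 2 + (x 0 1 * v 0 0 - x 0 0 * v 0 1) / 2).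

(** The left-invariant form dual to E3. *)
Definition contact_form x : 'rV[R]_3 := row3 (x 0 1 / 2) (- (x 0 0 / 2)) 1.

Lemma deltaE (k l : 'I_3) : (delta_mx 0 k : 'rV[R]_3) 0 l = (l == k)%:R.
Proof. by rewrite mxE eqxx. Qed.

Lemma nil3_metricE x (a b : 'I_3) : nil3_metric x a b =
  ((a == 0) && (b == 0))%:R + ((a == 1) && (b == 1))%:R +
  contact_form x 0 a * contact_form x 0 b.
Proof.
rewrite /nil3_metric; set om := 2^-1 *: _ + _.
have -> : om = contact_form x.
  by apply: row3P; rewrite /om /contact_form !row3E !mxE /=; ring.
rewrite !mxE !big_ord1 !mxE !eqxx /=.
by rewrite -!natrM !mulnb.
Qed.

Lemma mul_frame x w : w *m nil3_frame x =
  row3 (w 0 0) (w 0 1) (w 0 2 - x 0 1 / 2 * w 0 0 + x 0 0 / 2 * w 0 1).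
Proof.
by apply: row3P; rewrite row3E mxE sum3E !mxE /= ?mxE /=; field.
Qed.

Lemma lcoord_frame x w : lcoord x (w *m nil3_frame x) = w.
Proof. by rewrite mul_frame; apply: row3P; rewrite !row3E //; field. Qed.

Lemma frame_unit x : nil3_frame x \in unitmx.
Proof.
rewrite -row_free_unit; apply: inj_row_free => v v0.
rewrite -[v](lcoord_frame x) v0; apply: row3P; rewrite !row3E !mxE //.
by rewrite !mulr0 subr0 mul0r addr0.
Qed.

Lemma frame_coordE x v : frame_coord x v = lcoord x v.
Proof.
rewrite /frame_coord -[in LHS](_ : lcoord x v *m nil3_frame x = v).
  by rewrite mulmxK // frame_unit.
by rewrite mul_frame; apply: row3P; rewrite !row3E //; field.
Qed.

Lemma inner_nil3 x v w : inner (@nil3_metric R) x v w =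
  lcoord x v 0 0 * lcoord x w 0 0 + lcoord x v 0 1 * lcoord x w 0 1 +
  lcoord x v 0 2 * lcoord x w 0 2.
Proof.
rewrite /inner mxE sum3E !mxE !sum3E !nil3_metricE /= !row3E.
by field.
Qed.

Lemma is_derive_coord (n : nat) (x v : 'rV[R]_n) (k : 'I_n) :
  is_derive x v (fun y : 'rV[R]_n => y 0 k) (v 0 k).
Proof.
have lim : (fun h => h^-1 *: (((fun y : 'rV[R]_n => y 0 k) \o shift x) (h *: v)
    - x 0 k)) @ 0^' --> v 0 k.
  have : (fun _ : R => v 0 k) @ 0^' --> v 0 k by exact: cvg_cst.
  apply: cvg_trans; apply: near_eq_cvg; near=> h.
  have h0 : h != 0 by near: h; exact: nbhs_dnbhs_neq.
  by rewrite /= !mxE addrK /GRing.scale /= mulKf.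
apply: DeriveDef; first by apply/cvg_ex; exists (v 0 k).
exact: cvg_lim lim.
Unshelve. all: by end_near. Qed.

Definition contact_form_diff (m a : 'I_3) : R :=
  2^-1 * (((m == 1) && (a == 0))%:R - ((m == 0) && (a == 1))%:R).

Lemma is_derive_contact_form x (m a : 'I_3) :
  is_derive x (delta_mx 0 m : 'rV[R]_3) (fun y => contact_form y 0 a) (contact_form_diff m a).
Proof.
move: a; apply: ord3P; rewrite /contact_form_diff /=.
- under eq_fun do rewrite row3E0 mulrC.
  have := @is_deriveZ R 'rV[R]_3 R _ 2^-1 x _ _
     (is_derive_coord x (delta_mx 0 m) 1).
  by rewrite deltaE /= andbT andbF subr0 eq_sym.
- under eq_fun do rewrite row3E1 mulrC.
  have := is_deriveN (@is_deriveZ R 'rV[R]_3 R _ 2^-1 x _ _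
     (is_derive_coord x (delta_mx 0 m) 0)).
  by rewrite deltaE /= andbT andbF sub0r eq_sym mulrN.
- under eq_fun do rewrite row3E2.
  by rewrite !andbF subrr mulr0; exact: is_derive_cst.
Qed.

Lemma derive_nil3_metric x (m a b : 'I_3) :
  'D_(delta_mx 0 m : 'rV[R]_3) (fun y : 'rV[R]_3 => nil3_metric y a b) x =
  contact_form_diff m a * contact_form x 0 b + contact_form x 0 a * contact_form_diff m b.
Proof.
under eq_fun do rewrite nil3_metricE.
have H := is_deriveD (is_derive_cst (((a == 0) && (b == 0))%:R +
   ((a == 1) && (b == 1))%:R : R) x (delta_mx 0 m : 'rV[R]_3))
   (is_deriveM (is_derive_contact_form x m a) (is_derive_contact_form x m b)).
rewrite -[LHS]/('D_(delta_mx 0 m : 'rV[R]_3) (cst (((a == 0) && (b == 0))%:R +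
   ((a == 1) && (b == 1))%:R : R) +
   (fun y => contact_form y 0 a) * (fun y => contact_form y 0 b)) x).
by rewrite (@derive_val _ _ _ _ _ _ _ H) /GRing.scale /= add0r; ring.
Qed.

Definition nil3_inv x : 'M[R]_3 := \matrix_(k < 3)
  [:: row3 1 0 (- (x 0 1 / 2)); row3 0 1 (x 0 0 / 2);
      row3 (- (x 0 1 / 2)) (x 0 0 / 2)
        (1 + (x 0 0 / 2) ^+ 2 + (x 0 1 / 2) ^+ 2)]`_k.

Lemma nil3_invE x : invmx (nil3_metric x) = nil3_inv x.
Proof.
have E : nil3_metric x *m nil3_inv x = 1%:M.
  apply/matrixP; apply: ord3P; apply: ord3P;
  rewrite mxE sum3E !nil3_metricE !mxE /= ?mxE /=; by field.
have [u _] := mulmx1_unit E.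
by rewrite -[invmx _]mulmx1 -E mulKmx.
Qed.

(** The part of the covariant derivative of a velocity p that is quadratic in p. *)
Definition nil3_gamma x p : 'rV[R]_3 := \row_k \sum_(i < 3) \sum_(j < 3)
  christoffel (@nil3_metric R) x k i j * p 0 i * p 0 j.

(** Of the products E_i E_j only (E1, E3) and (E2, E3) contribute to the symmetric
    part of the connection: nabla_E1 E3 = nabla_E3 E1 = - E2 / 2 and
    nabla_E2 E3 = nabla_E3 E2 = E1 / 2, while nabla_E1 E2 and nabla_E2 E1 are
    opposite. *)
Lemma lcoord_nil3_gamma x p : lcoord x (nil3_gamma x p) =
  row3 (lcoord x p 0 1 * lcoord x p 0 2) (- (lcoord x p 0 0 * lcoord x p 0 2)) 0.
Proof.
have E k : nil3_gamma x p 0 k = [:: lcoord x p 0 2 * p 0 1; - (lcoord x p 0 2 * p 0 0);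
    - (x 0 1 / 2) * (lcoord x p 0 2 * p 0 1) + x 0 0 / 2 * (- (lcoord x p 0 2 * p 0 0))]`_k.
  rewrite mxE !sum3E /christoffel !sum3E !derive_nil3_metric nil3_invE.
  rewrite /contact_form_diff /= !row3E /= !mxE.
  by move: k; apply: ord3P; rewrite /= !row3E; field.
by apply: row3P; rewrite !row3E !E /= !row3E; field.
Qed.

End Nil3.

(** * Mean curvature of conformal maps *)
Section MeanCurvature.
Variable R : realType.
Implicit Types (X : R[i] -> 'rV[R]_3) (z e : R[i]).

Lemma vpartial2 (n : nat) (e d z : R[i]) (X : R[i] -> 'rV[R]_n) k :
  vpartial e (vpartial d X) z 0 k = partial e (partial d (fun w => X w 0 k)) z.
Proof.
rewrite mxE; congr (partial e _ z).
by apply/funext => w; rewrite mxE.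
Qed.

Definition laplacian (f : R[i] -> R) z : R :=
  partial 1 (partial 1 f) z + partial 'i%C (partial 'i%C f) z.

Lemma lcoordD (x p q : 'rV[R]_3) : lcoord x (p + q) = lcoord x p + lcoord x q.
Proof. by apply: row3P; rewrite !mxE /= ?mxE; field. Qed.

(** For a conformal map the trace of the second fundamental form is the scalar
    product of the normal with the tension; the parentheses are the coordinates
    of the tension in the left-invariant frame.  In the
    third, the u-derivative of the third coordinate of a plus the v-derivative of
    that of b, the products of first derivatives cancel. *)
Lemma mean_curvature_nil3 X z (lam : R) (N : 'rV[R]_3) :
  first_form (@nil3_metric R) X z = lam%:M -> lam != 0 ->
  let x := X z in let a := lcoord x (vpartial 1 X z) in
  let b := lcoord x (vpartial 'i%C X z) in
  let L k := laplacian (fun w => X w 0 k) z in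
  mean_curvature (@nil3_metric R) X (N *m nil3_frame x) z =
  (2 * lam)^-1 *
   ((L 0 + a 0 1 * a 0 2 + b 0 1 * b 0 2) * N 0 0 +
    (L 1 - a 0 0 * a 0 2 - b 0 0 * b 0 2) * N 0 1 +
    (L 2 + (x 0 1 * L 0 - x 0 0 * L 1) / 2) * N 0 2).
Proof.
move=> ff lam0 x a b L.
have nablaE e : lcoord x (nabla (@nil3_metric R) X e e z) =
    lcoord x (vpartial e (vpartial e X) z) +
    row3 (lcoord x (vpartial e X z) 0 1 * lcoord x (vpartial e X z) 0 2)
      (- (lcoord x (vpartial e X z) 0 0 * lcoord x (vpartial e X z) 0 2)) 0.
  by rewrite -lcoord_nil3_gamma -lcoordD.
have -> : mean_curvature (@nil3_metric R) X (N *m nil3_frame x) z =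
    2^-1 * (lam^-1 * (
      inner (@nil3_metric R) x (nabla (@nil3_metric R) X 1 1 z) (N *m nil3_frame x) +
      inner (@nil3_metric R) x (nabla (@nil3_metric R) X 'i%C 'i%C z) (N *m nil3_frame x))).
  rewrite /mean_curvature ff invmx_scalar mul_scalar_mx mxtraceZ /mxtrace sum2E.
  by rewrite /second_form (mxE _ _ 0 0) (mxE _ _ 1 1).
rewrite !inner_nil3 lcoord_frame (nablaE 1) (nablaE 'i%C) -/a -/b.
have LE k : L k = vpartial 1 (vpartial 1 X) z 0 k +
    vpartial 'i%C (vpartial 'i%C X) z 0 k.
  exact: (esym (congr2 +%R (vpartial2 1 1 z X k) (vpartial2 'i%C 'i%C z X k))).
rewrite !LE; clear LE nablaE ff; clearbody a b x.
move: (vpartial 1 (vpartial 1 X) z) (vpartial 'i%C (vpartial 'i%C X) z) => P Q.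
have addE (u v : 'rV[R]_3) k : (u + v) 0 k = u 0 k + v 0 k by rewrite mxE.
by rewrite !addE !row3E; field.
Qed.

End MeanCurvature.

(** * The harmonic map equation in the disk *)
Section Poincare.
Variable R : realType.
Implicit Types (y p : 'rV[R]_2) (g : R[i] -> R[i]) (z e : R[i]).

Definition defect y : R := 1 - (y 0 0 ^+ 2 + y 0 1 ^+ 2).

Lemma derive_poincare_metric y (m a b : 'I_2) : defect y != 0 ->
  'D_(delta_mx 0 m : 'rV[R]_2) (fun x : 'rV[R]_2 => poincare_metric x a b) y =
  (16 * y 0 m / defect y ^+ 3) *+ (a == b).
Proof.
move=> d0.
have dd : is_derive y (delta_mx 0 m : 'rV[R]_2) (fun x => defect x ^+ 2)
    (- 4 * defect y * y 0 m).
  have c k := is_derive_coord y (delta_mx 0 m : 'rV[R]_2) k.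
  apply: (is_derive_eq (is_deriveX 2 (is_deriveB
     (is_derive_cst (1 : R) y (delta_mx 0 m : 'rV[R]_2))
     (is_deriveD (is_deriveX 2 (c 0)) (is_deriveX 2 (c 1)))))).
  rewrite !mxE !eqxx /= /GRing.scale /= !expr1.
  have -> : (cst 1 - ((fun y0 : 'rV[R]_2 => y0 0 0) ^+ 2 +
     (fun y0 : 'rV[R]_2 => y0 0 1) ^+ 2)) y = defect y by [].
  by move: m {c}; apply: ord2P; rewrite /= ?mulr1 ?mulr0; ring.
have d20 : defect y ^+ 2 != 0 by rewrite expf_neq0.
have [de dv] := dd.
have dV := @deriveV R _ (fun x : 'rV[R]_2 => defect x ^+ 2) y
  (delta_mx 0 m) d20 de.
have hV := @derivableV R _ (fun x : 'rV[R]_2 => defect x ^+ 2) y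
  (delta_mx 0 m) d20 de.
have E : (fun x : 'rV[R]_2 => poincare_metric x a b) =
    (4 *+ (a == b)) *: (fun x : 'rV[R]_2 => (defect x ^+ 2)^-1).
  apply/funext => x; rewrite /poincare_metric mxE -/(defect x).
  suff -> : ((4 *+ (a == b)) *: (fun x : 'rV[R]_2 => (defect x ^+ 2)^-1)) x
    = (4 *+ (a == b)) * (defect x ^+ 2)^-1.
    by case: (a == b); rewrite ?mulr1n ?mulr0n ?mul0r.
  by [].
rewrite E (deriveZ _ hV) dV dv /GRing.scale /=.
by case: (a == b); rewrite ?mulr1n ?mulr0n ?mul0r //; field.
Qed.

Definition poincare_gamma y p : 'rV[R]_2 := \row_k \sum_(i < 2) \sum_(j < 2)
  christoffel (@poincare_metric R) y k i j * p 0 i * p 0 j.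

Lemma poincare_gammaE y p (k : 'I_2) : defect y != 0 -> poincare_gamma y p 0 k =
  (4 * (y 0 0 * p 0 0 + y 0 1 * p 0 1) * p 0 k -
   2 * y 0 k * (p 0 0 ^+ 2 + p 0 1 ^+ 2)) / defect y.
Proof.
move=> d0; have iE : invmx (poincare_metric y) = (defect y ^+ 2 / 4)%:M.
  by rewrite /poincare_metric invmx_scalar invf_div.
rewrite mxE !sum2E /christoffel !sum2E !derive_poincare_metric // iE !mxE.
move: k; apply: ord2P; rewrite /= ?mulr1n ?mulr0n; by field.
Qed.

Lemma mul_conj (x : R[i]) :
  x * x^*%C = (complex.Re x ^+ 2 + complex.Im x ^+ 2)%:C.
Proof. by apply: complex_inj; rewrite ?Re_mul ?Im_mul !Re_conjc !Im_conjc /=; ring. Qed.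

Lemma disk_defect (x : R[i]) : `|x| < 1 ->
  complex.Re x ^+ 2 + complex.Im x ^+ 2 < 1.
Proof.
move=> x1; have : `|x| ^+ 2 < 1 by rewrite expr_lt1.
by rewrite -add_Re2_Im2 -[1]/(1%:C) ltcR.
Qed.

Definition poincare_gamma_coord (G p : R[i]) (k : 'I_2) : R :=
  (4 * (complex.Re G * complex.Re p + complex.Im G * complex.Im p) *
     [:: complex.Re p; complex.Im p]`_k -
   2 * [:: complex.Re G; complex.Im G]`_k *
     (complex.Re p ^+ 2 + complex.Im p ^+ 2)) /
  (1 - (complex.Re G ^+ 2 + complex.Im G ^+ 2)).

Lemma tension_algebra (G p q : R[i]) (a b c d : R) :
  complex.Re G ^+ 2 + complex.Im G ^+ 2 < 1 ->
  a + poincare_gamma_coord G p 0 + (c + poincare_gamma_coord G q 0) = 0 ->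
  b + poincare_gamma_coord G p 1 + (d + poincare_gamma_coord G q 1) = 0 ->
  (a +i* b) + (c +i* d) =
  - (2 * G^*%C * (p * p + q * q)) / (1 - G * G^*%C).
Proof.
move=> m1 h0 h1.
have d0 : 1 - (complex.Re G ^+ 2 + complex.Im G ^+ 2) != 0.
  by rewrite subr_eq0 gt_eqF.
have -> : 1 - G * G^*%C = (1 - (complex.Re G ^+ 2 + complex.Im G ^+ 2))%:C.
  by rewrite mul_conj; apply: complex_inj; rewrite /= ?subr0 ?subrr ?oppr0 ?addr0.
have -> : (2 : R[i]) = 2%:C by rewrite rmorph_nat.
rewrite -fmorphV; move: h0 h1 d0; rewrite /poincare_gamma_coord /=.
case: G p q {m1} => [g1 g2] [p1 p2] [q1 q2] /= h0 h1 d0.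
apply: complex_inj; rewrite /=.
- rewrite -[LHS]subr0 -{1}h0; field; exact: d0.
- rewrite -[LHS]subr0 -{1}h1; field; exact: d0.
Qed.

(** Since p^2 + q^2 = 4 g_z g_zbar, this is
    g_zzbar = - 2 conj(g) g_z g_zbar / (1 - |g|^2). *)
Lemma tension_poincare g z : `|g z| < 1 ->
  tension (@poincare_metric R) (fun w => plane_point (g w)) z = 0 ->
  let p := cpartial 1 g z in let q := cpartial 'i%C g z in
  cpartial 1 (cpartial 1 g) z + cpartial 'i%C (cpartial 'i%C g) z =
  - (2 * (g z)^*%C * (p * p + q * q)) / (1 - g z * (g z)^*%C).
Proof.
move=> g1 t0 p q; set X := (fun w => plane_point (g w)) in t0.
have m1 := disk_defect g1.
have X0 : (fun w => X w 0 0) = (fun w => complex.Re (g w)).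
  by apply/funext => w; rewrite mxE.
have X1 : (fun w => X w 0 1) = (fun w => complex.Im (g w)).
  by apply/funext => w; rewrite mxE.
have Xz0 : X z 0 0 = complex.Re (g z) by rewrite mxE.
have Xz1 : X z 0 1 = complex.Im (g z) by rewrite mxE.
have dE : defect (X z) = 1 - (complex.Re (g z) ^+ 2 + complex.Im (g z) ^+ 2).
  by rewrite /defect Xz0 Xz1.
have d0 : defect (X z) != 0 by rewrite dE subr_eq0 gt_eqF.
have v0 e : vpartial e X z 0 0 = complex.Re (cpartial e g z) by rewrite mxE X0.
have v1 e : vpartial e X z 0 1 = complex.Im (cpartial e g z) by rewrite mxE X1.
have tk k : vpartial 1 (vpartial 1 X) z 0 k + poincare_gamma (X z) (vpartial 1 X z) 0 k +
  (vpartial 'i%C (vpartial 'i%C X) z 0 k + poincare_gamma (X z) (vpartial 'i%C X z) 0 k) = 0.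
  have E : tension (@poincare_metric R) X z =
    (vpartial 1 (vpartial 1 X) z + poincare_gamma (X z) (vpartial 1 X z)) +
    (vpartial 'i%C (vpartial 'i%C X) z + poincare_gamma (X z) (vpartial 'i%C X z)) := erefl.
  rewrite E in t0; have := congr1 (fun v : 'rV[R]_2 => v 0 k) t0.
  move: (vpartial 1 (vpartial 1 X) z) (vpartial 'i%C (vpartial 'i%C X) z)
    (poincare_gamma _ (vpartial 1 X z)) (poincare_gamma _ (vpartial 'i%C X z)) => a b c d.
  by rewrite !(mxE _ _ 0 k).
have w0 e : vpartial e (vpartial e X) z 0 0 =
    partial e (partial e (fun w => complex.Re (g w))) z :=
  etrans (vpartial2 e e z X 0) (congr1 (fun f => partial e (partial e f) z) X0).
have w1 e : vpartial e (vpartial e X) z 0 1 =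
    partial e (partial e (fun w => complex.Im (g w))) z :=
  etrans (vpartial2 e e z X 1) (congr1 (fun f => partial e (partial e f) z) X1).
have P e k : poincare_gamma (X z) (vpartial e X z) 0 k = _ := poincare_gammaE (vpartial e X z) k d0.
have P0 e : poincare_gamma (X z) (vpartial e X z) 0 0 =
    poincare_gamma_coord (g z) (cpartial e g z) 0.
  by rewrite P !v0 !v1 Xz0 Xz1 dE.
have P1 e : poincare_gamma (X z) (vpartial e X z) 0 1 =
    poincare_gamma_coord (g z) (cpartial e g z) 1.
  by rewrite P !v0 !v1 Xz0 Xz1 dE.
have h0 := etrans (esym (congr2 +%R (congr2 +%R (w0 1) (P0 1))
  (congr2 +%R (w0 'i%C) (P0 'i%C)))) (tk 0).
have h1 := etrans (esym (congr2 +%R (congr2 +%R (w1 1) (P1 1))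
  (congr2 +%R (w1 'i%C) (P1 'i%C)))) (tk 1).
exact: (tension_algebra m1 h0 h1).
Qed.

End Poincare.

(** * Pointwise algebra of the Gauss map *)
Section GaussAlgebra.
Variable R : realType.
Implicit Types (G mu f : R[i]) (a b : 'rV[R]_3).

Definition sqmod G : R := complex.Re G ^+ 2 + complex.Im G ^+ 2.

Definition dot a b : R := a 0 0 * b 0 0 + a 0 1 * b 0 1 + a 0 2 * b 0 2.

(** [vecu] and [vecv] are the real vectors a and b with (a - i b) / 2 = (f0, f1, f2):
    when this vector is X_z in the left-invariant frame, they are X_u and X_v. *)
Definition vecu f0 f1 f2 : 'rV[R]_3 :=
  row3 (2 * complex.Re f0) (2 * complex.Re f1) (2 * complex.Re f2).
Definition vecv f0 f1 f2 : 'rV[R]_3 :=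
  row3 (- (2 * complex.Im f0)) (- (2 * complex.Im f1)) (- (2 * complex.Im f2)).

(** The vectors (f0, f1, f2) that are isotropic for the complex bilinear product
    and orthogonal to the point of stereographic coordinate G form two lines,
    exchanged by conjugation.  These equations describe the one of correct
    orientation, with coordinate mu. *)
Definition isotropic G mu f0 f1 f2 :=
  [/\ f0 + 'i%C * f1 = mu, f0 - 'i%C * f1 = G^*%C * f2 & f2 = - G^*%C * mu].

Lemma normalize_scale (r : R) (v : 'rV[R]_3) : 0 < r ->
  v 0 0 ^+ 2 + v 0 1 ^+ 2 + v 0 2 ^+ 2 = 1 -> normalize (r *: v) = v.
Proof.
move=> r0 v1; rewrite /normalize sum3E.
have -> : (r *: v) 0 0 ^+ 2 + (r *: v) 0 1 ^+ 2 + (r *: v) 0 2 ^+ 2 = r ^+ 2.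
  by rewrite !mxE -[RHS]mulr1 -v1; ring.
by rewrite sqrtr_sqr gtr0_norm // scalerA mulVf ?gt_eqF // scale1r.
Qed.

Lemma sphere_pointE G : sphere_point G =
  row3 (2 * complex.Re G / (1 + sqmod G)) (2 * complex.Im G / (1 + sqmod G))
       ((1 - sqmod G) / (1 + sqmod G)).
Proof.
apply: row3P; rewrite row3E !mxE /= /sqmod; ring.
Qed.

Lemma sqmod_ge0 G : 0 <= sqmod G.
Proof. by rewrite addr_ge0 ?sqr_ge0. Qed.

Lemma sqmod_p1 G : 1 + sqmod G != 0.
Proof. by rewrite gt_eqF // ltr_pwDl // sqmod_ge0. Qed.

Lemma sphere_point_unit G : (sphere_point G) 0 0 ^+ 2 +
  (sphere_point G) 0 1 ^+ 2 + (sphere_point G) 0 2 ^+ 2 = 1.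
Proof.
rewrite sphere_pointE !row3E; move: (sqmod_p1 G); rewrite /sqmod => h.
by field.
Qed.

Lemma crossE a b : cross a b =
  row3 (a 0 1 * b 0 2 - a 0 2 * b 0 1) (a 0 2 * b 0 0 - a 0 0 * b 0 2)
       (a 0 0 * b 0 1 - a 0 1 * b 0 0).
Proof. by []. Qed.

Lemma normalize_cross a b (lam : R) : 0 < lam -> dot a a = lam -> dot b b = lam ->
  dot a b = 0 -> cross a b = lam *: normalize (cross a b).
Proof.
move=> l0 aa bb ab; rewrite /normalize sum3E.
have -> : (cross a b) 0 0 ^+ 2 + (cross a b) 0 1 ^+ 2 + (cross a b) 0 2 ^+ 2
   = lam ^+ 2.
  have -> : lam ^+ 2 = dot a a * dot b b - dot a b ^+ 2.
    by rewrite aa bb ab expr0n subr0.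
  by rewrite crossE !row3E /dot; ring.
by rewrite sqrtr_sqr gtr0_norm // scalerA mulfV ?gt_eqF // scale1r.
Qed.

(** a x b = lam N gives N . a = 0 and b = N x a.  As |G| < 1, the third coordinate
    of N does not vanish, and everything is expressed by the first two
    coordinates of a. *)
Lemma gauss_frame G a b (lam : R) : sqmod G < 1 -> 0 < lam ->
  dot a a = lam -> dot b b = lam -> dot a b = 0 ->
  normalize (cross a b) = sphere_point G ->
  [/\ a 0 2 = - (2 * complex.Re G * a 0 0 + 2 * complex.Im G * a 0 1) /
        (1 - sqmod G),
     b 0 0 = (2 * complex.Im G * a 0 2 - (1 - sqmod G) * a 0 1) / (1 + sqmod G),
     b 0 1 = ((1 - sqmod G) * a 0 0 - 2 * complex.Re G * a 0 2) / (1 + sqmod G) &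
     b 0 2 = (2 * complex.Re G * a 0 1 - 2 * complex.Im G * a 0 0) /
        (1 + sqmod G)].
Proof.
move=> m1 l0 aa bb ab nE.
have cE := normalize_cross l0 aa bb ab; rewrite nE sphere_pointE in cE.
have s0 := sqmod_p1 G.
have d0 : 1 - sqmod G != 0 by rewrite subr_eq0 gt_eqF.
have ln : lam != 0 by rewrite gt_eqF.
have c k : (cross a b) 0 k = lam * (sphere_point G) 0 k.
  by rewrite cE -sphere_pointE mxE.
move: (c 0) (c 1) (c 2); rewrite crossE sphere_pointE !row3E => c0 c1 c2.
move: aa bb ab; rewrite /dot => aa bb ab.
set m := sqmod G in c0 c1 c2 s0 d0 m1.
have sc x y : lam * (x / (1 + m)) = y -> x = (1 + m) * (y / lam).
  by move=> <-; field; rewrite ln.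
have n0 := sc _ _ (esym c0); have n1 := sc _ _ (esym c1).
have n2 := sc _ _ (esym c2).
have na : 2 * complex.Re G * a 0 0 + 2 * complex.Im G * a 0 1 + (1 - m) * a 0 2 = 0.
  by rewrite n0 n1 n2; field.
have B0 : b 0 0 = (2 * complex.Im G * a 0 2 - (1 - m) * a 0 1) / (1 + m).
  rewrite n1 n2; apply: (mulIf ln).
  rewrite -[in LHS]aa; apply/eqP; rewrite -subr_eq0; apply/eqP.
  rewrite -[RHS](mulr0 (a 0 0)) -ab; field; by rewrite s0.
have B1 : b 0 1 = ((1 - m) * a 0 0 - 2 * complex.Re G * a 0 2) / (1 + m).
  rewrite n0 n2; apply: (mulIf ln).
  rewrite -[in LHS]aa; apply/eqP; rewrite -subr_eq0; apply/eqP.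
  rewrite -[RHS](mulr0 (a 0 1)) -ab; field; by rewrite s0.
have B2 : b 0 2 = (2 * complex.Re G * a 0 1 - 2 * complex.Im G * a 0 0) / (1 + m).
  rewrite n0 n1; apply: (mulIf ln).
  rewrite -[in LHS]aa; apply/eqP; rewrite -subr_eq0; apply/eqP.
  rewrite -[RHS](mulr0 (a 0 2)) -ab; field; by rewrite s0.
have A2 : a 0 2 = - (2 * complex.Re G * a 0 0 + 2 * complex.Im G * a 0 1) / (1 - m).
  apply: (mulIf d0); rewrite divfK //; apply/eqP; rewrite -subr_eq0; apply/eqP.
  by rewrite -[RHS]na; ring.
by split.
Qed.

Lemma isotropic_of_gauss G f0 f1 f2 (lam : R) : sqmod G < 1 -> 0 < lam ->
  let a := vecu f0 f1 f2 in let b := vecv f0 f1 f2 in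
  dot a a = lam -> dot b b = lam -> dot a b = 0 ->
  normalize (cross a b) = sphere_point G ->
  isotropic G (f0 + 'i%C * f1) f0 f1 f2 /\ f0 + 'i%C * f1 != 0.
Proof.
move=> m1 l0 a b aa bb ab nE.
have [] := gauss_frame m1 l0 aa bb ab nE.
have s0 := sqmod_p1 G.
have d0 : 1 - sqmod G != 0 by rewrite subr_eq0 gt_eqF.
have ln : lam != 0 by rewrite gt_eqF.
move: aa; rewrite /dot !row3E.
move: s0 d0 {m1 bb ab nE a b}; rewrite /sqmod.
case: G f0 f1 f2 => [g1 g2] [p0 q0] [p1 q1] [p2 q2] /= s0 d0 aa A2 B0 B1 B2.
have e2 (x y : R) : 2 * x = y -> x = y / 2 by move=> <-; field.
have m2 (x y : R) : - (2 * x) = y -> x = - y / 2 by move=> <-; field.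
have {}A2 := e2 _ _ A2; have {}B0 := m2 _ _ B0; have {}B1 := m2 _ _ B1.
have {}B2 := m2 _ _ B2.
have I : isotropic (g1 +i* g2) (p0 +i* q0 + 'i%C * (p1 +i* q1)) (p0 +i* q0)
    (p1 +i* q1) (p2 +i* q2).
  split=> //; apply: complex_inj; rewrite /= ?B0 ?B1 ?B2 ?A2; field; by rewrite d0 s0.
split=> //; apply/negP => /eqP mu0; move: I; rewrite mu0 => -[E0 E1 E2].
rewrite mulr0 in E2; rewrite E2 mulr0 in E1.
have F0 : p0 +i* q0 = 0.
  have : (p0 +i* q0) * 2 = 0 by rewrite -[RHS](addr0 0) -{1}E0 -E1; ring.
  by move/eqP; rewrite mulf_eq0 pnatr_eq0 orbF => /eqP.
have F1 : p1 +i* q1 = 0.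
  move: E0; rewrite F0 add0r => /eqP; rewrite mulf_eq0 => /orP[|/eqP //].
  by rewrite eq_complex /= oner_eq0 andbF.
move: E2 F0 F1 => [x2 _] [x0 _] [x1 _].
by move: ln; rewrite -aa x0 x1 x2 !mulr0 !addr0 eqxx.
Qed.

Lemma gauss_of_isotropic G mu f0 f1 f2 : sqmod G < 1 -> mu != 0 ->
  isotropic G mu f0 f1 f2 ->
  let a := vecu f0 f1 f2 in let b := vecv f0 f1 f2 in
  exists2 lam : R, 0 < lam &
    [/\ dot a a = lam, dot b b = lam, dot a b = 0 &
       normalize (cross a b) = sphere_point G].
Proof.
move=> m1 mu0 [E0 E1 E2] a b.
have F0 : f0 = (mu + G^*%C * f2) / 2 by rewrite -E0 -E1; field.
have F1 : f1 = - 'i%C * (mu - G^*%C * f2) / 2.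
  rewrite -E0 -E1; have := @mulii R; move: 'i%C => ii i2.
  have -> : - ii * (f0 + ii * f1 - (f0 - ii * f1)) / 2 = - (ii * ii) * f1 by field.
  by rewrite i2 opprK mul1r.
have half : (2^-1 : R[i]) = (2^-1 : R)%:C by rewrite fmorphV rmorph_nat.
have r0 : 0 < sqmod mu.
  rewrite lt_neqAle sqmod_ge0 andbT eq_sym /sqmod.
  apply: contra mu0; rewrite paddr_eq0 ?sqr_ge0 // !sqrf_eq0 => /andP[/eqP h1 /eqP h2].
  by apply/eqP; apply: complex_inj.
have s0 := sqmod_p1 G.
have sp : 0 < 1 + sqmod G by rewrite ltr_pwDl // sqmod_ge0.
exists (sqmod mu * (1 + sqmod G) ^+ 2).
  by rewrite mulr_gt0 // exprn_gt0.
have [aE bE] : a = vecu ((mu + G^*%C * (- G^*%C * mu)) / 2)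
     (- 'i%C * (mu - G^*%C * (- G^*%C * mu)) / 2) (- G^*%C * mu) /\
   b = vecv ((mu + G^*%C * (- G^*%C * mu)) / 2)
     (- 'i%C * (mu - G^*%C * (- G^*%C * mu)) / 2) (- G^*%C * mu).
  by rewrite /a /b F0 F1 E2.
have nE : cross a b = (sqmod mu * (1 + sqmod G) ^+ 2) *: sphere_point G.
  rewrite sphere_pointE aE bE crossE half.
  move: s0; rewrite /sqmod; case: G mu {mu0 E0 E1 E2 F0 F1 m1 a b aE bE r0 sp} =>
    [g1 g2] [p q] /= s0.
  by apply: row3P; rewrite [RHS]mxE !row3E /=; field.
split; last first.
  by rewrite nE normalize_scale ?sphere_point_unit // mulr_gt0 // exprn_gt0.
all: rewrite ?aE ?bE half /dot !row3E /sqmod.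
all: case: G mu {mu0 E0 E1 E2 F0 F1 m1 a b aE bE r0 sp nE s0} => [g1 g2] [p q] /=.
all: by field.
Qed.

Lemma isotropic_split G mu f0 f1 f2 : isotropic G mu f0 f1 f2 ->
  [/\ f0 = (mu + G^*%C * (- G^*%C * mu)) / 2,
      f1 = - 'i%C * (mu - G^*%C * (- G^*%C * mu)) / 2 & f2 = - G^*%C * mu].
Proof.
move=> [E0 E1 E2]; rewrite -E2; split=> //; first by rewrite -E0 -E1; field.
rewrite -E0 -E1; have := @mulii R; move: 'i%C => ii i2.
have -> : - ii * (f0 + ii * f1 - (f0 - ii * f1)) / 2 = - (ii * ii) * f1 by field.
by rewrite i2 opprK mul1r.
Qed.

Lemma isotropic_products G mu f0 f1 f2 : isotropic G mu f0 f1 f2 ->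
  [/\ (f0 * f1^*%C - f1 * f0^*%C) / 2 =
        'i%C * (sqmod mu * (1 - sqmod G ^+ 2) / 4)%:C,
      complex.Re (f1 * f2^*%C) =
        - (complex.Im G * sqmod mu * (1 - sqmod G) / 2) &
      complex.Re (f0 * f2^*%C) =
        - (complex.Re G * sqmod mu * (1 - sqmod G) / 2)].
Proof.
move=> /isotropic_split[-> -> ->].
have -> : (2^-1 : R[i]) = (2^-1 : R)%:C by rewrite fmorphV rmorph_nat.
rewrite /sqmod; case: G mu => [g1 g2] [p q]; split.
- by apply: complex_inj; rewrite /=; field.
- by rewrite /=; field.
- by rewrite /=; field.
Qed.

(** Here S3 = (phi3)_zbar, M = F_zzbar and B = (conj g)_zbar.  The first two
    equations are the zbar-derivatives of the relations of [isotropic]; the third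
    is the vanishing of the normal component of the tension.  Eliminating B leaves
    three real linear equations for s, t, h. *)
Lemma minimal_algebra G mu B f0 f1 f2 (s t h : R) : sqmod G < 1 -> mu != 0 ->
  isotropic G mu f0 f1 f2 ->
  let S3 := h%:C + (f0 * f1^*%C - f1 * f0^*%C) / 2 in
  let M := s%:C + 'i%C * t%:C in
  S3 = - (B * mu + G^*%C * M) ->
  s%:C - 'i%C * t%:C = B * f2 + G^*%C * S3 ->
  (s + complex.Re (f1 * f2^*%C)) * (2 * complex.Re G) +
  (t - complex.Re (f0 * f2^*%C)) * (2 * complex.Im G) + h * (1 - sqmod G) = 0 ->
  B = - ('i%C / 4) * mu^*%C * ((1 - sqmod G) ^+ 2)%:C.
Proof.
move=> m1 mu0 iso S3 M; have [k1 k2 k3] := isotropic_products iso.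
rewrite {}/S3 {}/M k1 k2 k3; have [_ _ ->] := isotropic_split iso.
set kap := sqmod mu * (1 - sqmod G ^+ 2) / 4 => e1 e2 e3.
have Bm : B * mu = - (h%:C + 'i%C * kap%:C + G^*%C * (s%:C + 'i%C * t%:C)).
  by rewrite e1; ring.
have {e2} : s%:C - 'i%C * t%:C = G^*%C * (h%:C + 'i%C * kap%:C) +
   G^*%C * (h%:C + 'i%C * kap%:C + G^*%C * (s%:C + 'i%C * t%:C)).
  have -> : h%:C + 'i%C * kap%:C + G^*%C * (s%:C + 'i%C * t%:C) = - (B * mu).
    by rewrite Bm opprK.
  rewrite e2; ring.
have p0 := sqmod_p1 G.
(* u + i v is the deviation of M from - (i/2) G |mu|^2 (1 - |G|^2); the equations
   become homogeneous in u, v, h. *)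
pose u := s - complex.Im G * sqmod mu * (1 - sqmod G) / 2.
pose v := t + complex.Re G * sqmod mu * (1 - sqmod G) / 2.
have e3' : 2 * (complex.Re G * u + complex.Im G * v) + h * (1 - sqmod G) = 0.
  by rewrite -[RHS]e3 /u /v; field.
move=> /[dup] /(congr1 (@complex.Re R)) re /(congr1 (@complex.Im R)) im.
have hre : u = 2 * complex.Re G * h +
    (complex.Re G * (complex.Re G * u + complex.Im G * v) +
     complex.Im G * (complex.Re G * v - complex.Im G * u)).
  move: re {im e1 Bm k1 k2 k3 iso e3 e3'}; rewrite /u /v /kap /sqmod.
  case: G mu {mu0 m1 p0 u v kap} => [g1 g2] [p q] /= re.
  lra.
have him : - v = - (2 * complex.Im G * h) +
    (complex.Re G * (complex.Re G * v - complex.Im G * u) -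
     complex.Im G * (complex.Re G * u + complex.Im G * v)).
  move: im {re e1 Bm k1 k2 k3 iso e3 e3' hre}; rewrite /u /v /kap /sqmod.
  case: G mu {mu0 m1 p0 u v kap} => [g1 g2] [p q] /= im.
  lra.
(* With w = conj(G) (u + i v), the equations hre and him multiplied by G read
   conj(w) = 2 |G|^2 h + |G|^2 w, so that w is real and (1 - |G|^2) w = 2 |G|^2 h;
   the third is 2 w + (1 - |G|^2) h = 0. *)
have wim : complex.Re G * v - complex.Im G * u = 0.
  apply: (mulfI p0); rewrite mulr0.
  have -> : (1 + sqmod G) * (complex.Re G * v - complex.Im G * u) =
   complex.Re G * (- (2 * complex.Im G * h) +
    (complex.Re G * (complex.Re G * v - complex.Im G * u) -
     complex.Im G * (complex.Re G * u + complex.Im G * v)) - - v) +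
   complex.Im G * (2 * complex.Re G * h +
    (complex.Re G * (complex.Re G * u + complex.Im G * v) +
     complex.Im G * (complex.Re G * v - complex.Im G * u)) - u).
    by rewrite /sqmod; ring.
  by rewrite -hre -him !subrr !mulr0 addr0.
have h0 : h = 0.
  have p2 : (1 + sqmod G) ^+ 2 != 0 by rewrite expf_neq0.
  apply: (mulfI p2); rewrite mulr0.
  have -> : (1 + sqmod G) ^+ 2 * h = (1 - sqmod G) *
     (2 * (complex.Re G * u + complex.Im G * v) + h * (1 - sqmod G)) +
     2 * (complex.Re G * (2 * complex.Re G * h +
    (complex.Re G * (complex.Re G * u + complex.Im G * v) +
     complex.Im G * (complex.Re G * v - complex.Im G * u)) - u)
     - complex.Im G * (- (2 * complex.Im G * h) +
    (complex.Re G * (complex.Re G * v - complex.Im G * u) -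
     complex.Im G * (complex.Re G * u + complex.Im G * v)) - - v)).
    by rewrite /sqmod; ring.
  by rewrite e3' -hre -him !subrr !mulr0 subrr mulr0 addr0.
have wre : complex.Re G * u + complex.Im G * v = 0.
  by move: e3'; rewrite h0 mul0r addr0 => /eqP; rewrite mulf_eq0 pnatr_eq0 => /eqP.
have u0 : u = 0 by rewrite hre h0 wim wre !mulr0 !addr0.
have v0 : v = 0.
  by apply/eqP; rewrite -oppr_eq0; apply/eqP; rewrite him h0 wim wre !mulr0 subr0 oppr0 addr0.
apply: (mulIf mu0); rewrite Bm h0.
have sE : s = complex.Im G * sqmod mu * (1 - sqmod G) / 2.
  by apply/eqP; rewrite -subr_eq0 -/u u0.
have tE : t = - (complex.Re G * sqmod mu * (1 - sqmod G) / 2).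
  by apply/eqP; rewrite -subr_eq0 opprK -/v v0.
rewrite sE tE /kap.
move: (mul_conj mu) => mm.
have -> : - ('i%C / 4) * mu^*%C * ((1 - sqmod G) ^+ 2)%:C * mu =
   - ('i%C / 4) * ((1 - sqmod G) ^+ 2)%:C * (sqmod mu)%:C.
  by rewrite /sqmod -mm; ring.
have -> : ('i%C / 4 : R[i]) = 'i%C * (4^-1 : R)%:C by rewrite fmorphV rmorph_nat.
move: (sqmod mu) => r; rewrite /sqmod.
case: G {mu0 m1 p0 u v kap k1 k2 k3 iso e3 e3' hre him wim wre u0 v0 sE tE re im e1 Bm mm} => g1 g2.
by apply: complex_inj; rewrite /=; field.
Qed.

End GaussAlgebra.

(** * Necessity of the representation formula *)
Section RealFunctions.
Variable R : realType.
Implicit Types (f : R[i] -> R) (D : set R[i]^o) (z : R[i]).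

Lemma cpartial_real f e z : axis e ->
  cpartial e (fun w => (f w)%:C) z = (partial e f z)%:C.
Proof.
move=> eE; rewrite /cpartial; apply: complex_inj => //=.
by have [_ ->] := (is_partialP _ _ _ _).1 (is_partial_cst e z (0 : R)).
Qed.

Lemma smooth_real_wirt D f z : smooth_on D f -> D z ->
  is_wirt (fun w => (f w)%:C) z (dz (fun w => (f w)%:C) z)
    (dz (fun w => (f w)%:C) z)^*%C /\
  partial 1 f z = 2 * complex.Re (dz (fun w => (f w)%:C) z) /\
  partial 'i%C f z = - (2 * complex.Im (dz (fun w => (f w)%:C) z)).
Proof.
move=> sf Dz.
have a1 : axis (1 : R[i]) by left.
have ai : axis ('i%C : R[i]) by right.
have h1 := has_partialP (smooth_has_partial a1 sf Dz).
have hi := has_partialP (smooth_has_partial ai sf Dz).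
pose d := (partial 1 f z / 2) +i* (- (partial 'i%C f z / 2)).
have r1 : partial 1 f z = 2 * complex.Re d by rewrite /=; field.
have ri : partial 'i%C f z = - (2 * complex.Im d) by rewrite /=; field.
have w : is_wirt (fun w => (f w)%:C) z d d^*%C.
  by apply/is_wirt_real; rewrite -r1 -ri.
by rewrite (is_wirt_dz w).
Qed.

Lemma dzbar_dz_real D f z : open D -> smooth_on D f -> D z ->
  dzbar (dz (fun w => (f w)%:C)) z = (laplacian f z / 4)%:C.
Proof.
move=> oD sf Dz.
have a1 : axis (1 : R[i]) by left.
have ai : axis ('i%C : R[i]) by right.
have [_ ->] := dz_dzbar oD (csmooth_real sf) Dz.
have E e : axis e -> cpartial e (cpartial e (fun w => (f w)%:C)) z =
    (partial e (partial e f) z)%:C.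
  move=> eE; rewrite -(cpartial_real _ _ eE); congr (cpartial e _ z).
  by apply/funext => w; exact: cpartial_real.
have -> := E 1 a1; have -> := E 'i%C ai.
rewrite /laplacian; move: (partial 1 _ z) (partial 'i%C _ z) => x y.
have -> : (4^-1 : R[i]) = (4^-1 : R)%:C by rewrite fmorphV rmorph_nat.
by apply: complex_inj; rewrite /=; ring.
Qed.

(** The partial derivatives of f are smooth by hypothesis, which makes f of class
    C1, hence continuous, and then smooth. *)
Lemma real_primitive_smooth D f (psi : R[i] -> R[i]) : open D -> csmooth D psi ->
  (forall z, D z -> is_wirt (fun w => (f w)%:C) z (psi z) (psi z)^*%C) ->
  smooth_on D f.
Proof.
move=> oD [sr si] fw.
have a1 : axis (1 : R[i]) by left.
have ai : axis ('i%C : R[i]) by right.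
have H z : D z -> is_partial 1 f z (2 * complex.Re (psi z)) /\
    is_partial 'i%C f z (- (2 * complex.Im (psi z))).
  by move=> /fw /is_wirt_real.
have s1 : smooth_on D (partial 1 f).
  apply: (smooth_ext oD _ (smoothM oD (smooth_cst D 2) sr)) => z /H[/is_partialP[_ ->]].
  by [].
have s2 : smooth_on D (partial 'i%C f).
  apply: (smooth_ext oD _ (smoothN oD (smoothM oD (smooth_cst D 2) si))) => z.
  by move=> /H[_ /is_partialP[_ ->]].
have df e z : axis e -> D z -> has_partial e f z.
  by move=> [->|->] /H[/is_partialP[? _] /is_partialP[? _]].
apply: smooth_of_partials => //; last by move=> e [->|->].
move=> z Dz; apply: C1_at_continuous; split.
- have /nbhs_boxP[r r0 rD] : nbhs (z : R[i]^o) D by exact: open_nbhs_nbhs.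
  by exists r => // w /rD Dw; split; apply: df.
- exact: smooth_continuous s1 Dz.
- exact: smooth_continuous s2 Dz.
Qed.

End RealFunctions.

Section ChartForward.
Variable R : realType.
Variables (D : set R[i]^o) (G : R[i] -> R[i]) (X : R[i] -> 'rV[R]_3).
Hypothesis oD : open D.
Hypothesis sG : csmooth D G.
Hypothesis G1 : forall z, D z -> `|G z| < 1.
Hypothesis sX : forall k, smooth_on D (fun w => X w 0 k).

Let xc (k : 'I_3) (w : R[i]) : R[i] := (X w 0 k)%:C.
(** The coordinates of X_z in the basis of the coordinate fields. *)
Definition psi (k : 'I_3) : R[i] -> R[i] := dz (fun w => (X w 0 k)%:C).

(** The third coordinate of X_z in the left-invariant frame; the first two are
    those of [psi]. *)
Definition phi3 (w : R[i]) : R[i] :=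
  psi 2 w + 2^-1 * (xc 1 w * psi 0 w - xc 0 w * psi 1 w).

(** The value - 4 i g_z / (1 - |g|^2)^2 that F_z has to take. *)
Definition rep_Fz (w : R[i]) : R[i] :=
  - 4 * 'i%C * (dz G w * ((1 - G w * (G w)^*%C)^-1 * (1 - G w * (G w)^*%C)^-1)).

Lemma defect_sqmod z : 1 - G z * (G z)^*%C = (1 - sqmod (G z))%:C.
Proof.
rewrite mul_conj -/(sqmod (G z)).
by apply: complex_inj; rewrite /= ?subr0 ?subrr ?oppr0 ?addr0.
Qed.

Lemma defect_neq0 z : D z -> 1 - G z * (G z)^*%C != 0.
Proof.
move=> /G1/disk_defect m1; rewrite defect_sqmod -[0]/(0%:C).
by rewrite (inj_eq (@complexI R)) subr_eq0 gt_eqF.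
Qed.

Lemma lcoord_vpartial z : D z ->
  lcoord (X z) (vpartial 1 X z) = vecu (psi 0 z) (psi 1 z) (phi3 z) /\
  lcoord (X z) (vpartial 'i%C X z) = vecv (psi 0 z) (psi 1 z) (phi3 z).
Proof.
move=> Dz.
have E k : vpartial 1 X z 0 k = 2 * complex.Re (psi k z) /\
    vpartial 'i%C X z 0 k = - (2 * complex.Im (psi k z)).
  have [_ [h1 h2]] := smooth_real_wirt (sX k) Dz.
  by split; [rewrite mxE h1 | rewrite mxE h2].
have half : (2^-1 : R[i]) = (2^-1 : R)%:C by rewrite fmorphV rmorph_nat.
rewrite /phi3 half; split; apply: row3P; rewrite !row3E ?(E _).1 ?(E _).2 //.
- rewrite /xc; case: (psi 0 z) (psi 1 z) (psi 2 z) => [? ?] [? ?] [? ?] /=.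
  by field.
- rewrite /xc; case: (psi 0 z) (psi 1 z) (psi 2 z) => [? ?] [? ?] [? ?] /=.
  by field.
Qed.

Lemma unit_normalE z : D z -> unit_normal X z =
  normalize (cross (vecu (psi 0 z) (psi 1 z) (phi3 z))
                   (vecv (psi 0 z) (psi 1 z) (phi3 z))).
Proof.
move=> Dz; rewrite /unit_normal !frame_coordE.
by have [-> ->] := lcoord_vpartial Dz.
Qed.

Lemma first_formE z : D z ->
  let a := vecu (psi 0 z) (psi 1 z) (phi3 z) in
  let b := vecv (psi 0 z) (psi 1 z) (phi3 z) in
  [/\ first_form (@nil3_metric R) X z 0 0 = dot a a,
      first_form (@nil3_metric R) X z 0 1 = dot a b,
      first_form (@nil3_metric R) X z 1 0 = dot b a &
      first_form (@nil3_metric R) X z 1 1 = dot b b].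
Proof.
move=> Dz a b; have [E1 E2] := lcoord_vpartial Dz.
by split; rewrite mxE inner_nil3 /= ?E1 ?E2.
Qed.

Lemma psi_wirt k z : D z ->
  is_wirt (xc k) z (psi k z) (psi k z)^*%C /\
  is_wirt (psi k) z (dz (psi k) z) (laplacian (fun w => X w 0 k) z / 4)%:C.
Proof.
move=> Dz; have [w _] := smooth_real_wirt (sX k) Dz.
split; first exact: w.
have := csmooth_wirt (csmooth_dz oD (csmooth_real (sX k))) Dz.
by rewrite (dzbar_dz_real oD (sX k) Dz); exact.
Qed.

Lemma phi3_algebra (p0 p1 : R[i]) (x0 x1 l0 l1 l2 : R) :
  (l2 + (x1 * l0 - x0 * l1) / 2)%:C + (p0 * p1^*%C - p1 * p0^*%C) / 2 =
  l2%:C + (0 * (x1%:C * p0 - x0%:C * p1) +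
    2^-1 * ((p1^*%C * p0 + x1%:C * l0%:C) - (p0^*%C * p1 + x0%:C * l1%:C))).
Proof.
have half : (2^-1 : R[i]) = (2^-1 : R)%:C by rewrite fmorphV rmorph_nat.
rewrite half; case: p0 p1 => [? ?] [? ?].
by apply: complex_inj; rewrite /=; field.
Qed.

(** The first term is real and the second imaginary.  The latter comes from the
    derivatives of the coefficients x1 and x2 of E1 and E2, i.e. from
    [E1, E2] = E3. *)
Lemma phi3_dzbar z : D z -> exists a, is_wirt phi3 z a
  ((laplacian (fun w => X w 0 2) z / 4 +
     (X z 0 1 * (laplacian (fun w => X w 0 0) z / 4) -
      X z 0 0 * (laplacian (fun w => X w 0 1) z / 4)) / 2)%:C +
   (psi 0 z * (psi 1 z)^*%C - psi 1 z * (psi 0 z)^*%C) / 2).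
Proof.
move=> Dz.
have [x0 p0] := psi_wirt 0 Dz; have [x1 p1] := psi_wirt 1 Dz.
have [x2 p2] := psi_wirt 2 Dz.
have := is_wirtD p2 (is_wirtM (is_wirt_cst z 2^-1)
  (is_wirtB (is_wirtM x1 p0) (is_wirtM x0 p1))).
move=> H; eexists; rewrite phi3_algebra; exact: H.
Qed.

(** [minimal_algebra], with the hypotheses in the form in which the rules for
    [is_wirt] and [mean_curvature_nil3] deliver them. *)
Lemma forward_algebra g mu B f0 f1 f2 (x0 x1 l0 l1 l2 lam : R) :
  sqmod g < 1 -> mu != 0 -> lam != 0 -> isotropic g mu f0 f1 f2 ->
  (l2 / 4 + (x1 * (l0 / 4) - x0 * (l1 / 4)) / 2)%:C +
    (f0 * f1^*%C - f1 * f0^*%C) / 2 =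
    - B * mu + - g^*%C * ((l0 / 4)%:C + (0 * f1 + 'i%C * (l1 / 4)%:C)) ->
  (l0 / 4)%:C - (0 * f1 + 'i%C * (l1 / 4)%:C) =
    B * f2 + g^*%C * ((l2 / 4 + (x1 * (l0 / 4) - x0 * (l1 / 4)) / 2)%:C +
    (f0 * f1^*%C - f1 * f0^*%C) / 2) ->
  (2 * lam)^-1 *
   ((l0 + 2 * complex.Re f1 * (2 * complex.Re f2) +
      - (2 * complex.Im f1) * - (2 * complex.Im f2)) *
        (2 * complex.Re g / (1 + sqmod g)) +
    (l1 - 2 * complex.Re f0 * (2 * complex.Re f2) -
      - (2 * complex.Im f0) * - (2 * complex.Im f2)) *
        (2 * complex.Im g / (1 + sqmod g)) +
    (l2 + (x1 * l0 - x0 * l1) / 2) * ((1 - sqmod g) / (1 + sqmod g))) = 0 ->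
  B = - ('i%C / 4) * mu^*%C * ((1 - sqmod g) ^+ 2)%:C.
Proof.
move=> m1 mu0 ln iso e1 e2 e3; have s0 := sqmod_p1 g.
apply: (minimal_algebra m1 mu0 iso (s := l0 / 4) (t := l1 / 4)
  (h := l2 / 4 + (x1 * (l0 / 4) - x0 * (l1 / 4)) / 2)).
- by rewrite e1 mul0r add0r; ring.
- by rewrite -e2 mul0r add0r.
- move/eqP: e3; rewrite mulf_eq0 invr_eq0 mulf_eq0 pnatr_eq0 /= (negPf ln) /=.
  move=> /eqP e3; apply: (mulfI s0); rewrite mulr0.
  rewrite -[RHS](mul0r ((1 + sqmod g) ^+ 2 / 4)) -[in RHS]e3.
  move: s0; case: f0 f1 f2 {iso e1 e2 e3} => [? ?] [? ?] [? ?] /= s0.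
  by field.
Qed.

Lemma rep_Fz_algebra (mu : R[i]) (d : R) : d%:C != 0 :> R[i] ->
  mu = - 4 * 'i%C * ((- ('i%C / 4) * mu^*%C * (d ^+ 2)%:C)^*%C *
     (d%:C^-1 * d%:C^-1)).
Proof.
move=> d0.
have -> : (- ('i%C / 4) * mu^*%C * (d ^+ 2)%:C)^*%C =
   'i%C / 4 * mu * (d%:C * d%:C).
  have -> : ('i%C / 4 : R[i]) = 'i%C * (4^-1 : R)%:C by rewrite fmorphV rmorph_nat.
  by case: mu => p q; apply: complex_inj; rewrite /=; ring.
move: d0; move: d%:C => e e0.
have -> : - 4 * 'i%C * ('i%C / 4 * mu * (e * e) * (e^-1 * e^-1)) =
   - ('i%C * 'i%C) * mu by move: 'i%C => ii; field.
by rewrite mulii opprK mul1r.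
Qed.

(** The relations of [isotropic] hold on all of D for the coordinate
    psi 0 + i psi 1, so they can be differentiated; [minimal_algebra] then
    identifies this coordinate with [rep_Fz]. *)
Lemma representation :
  (forall z, D z -> exists2 lam : R, 0 < lam &
     first_form (@nil3_metric R) X z = lam%:M) ->
  (forall z, D z -> unit_normal X z = sphere_point (G z)) ->
  (forall z, D z -> mean_curvature (@nil3_metric R) X
     (unit_normal X z *m nil3_frame (X z)) z = 0) ->
  forall z, D z -> isotropic (G z) (rep_Fz z) (psi 0 z) (psi 1 z) (phi3 z).
Proof.
move=> conf gauss mini.
pose mu w := psi 0 w + 'i%C * psi 1 w.
have iso z : D z -> isotropic (G z) (mu z) (psi 0 z) (psi 1 z) (phi3 z) /\
    mu z != 0.
  move=> Dz; have [lam lam0 ff] := conf z Dz.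
  have [f00 f01 f10 f11] := first_formE Dz; rewrite ff !mxE /= in f00 f01 f11.
  apply: (isotropic_of_gauss (lam := lam)) => //.
  - exact: disk_defect (G1 Dz).
  - by rewrite -gauss // unit_normalE.
move=> z Dz; have [isz mu0] := iso z Dz.
suff <- : mu z = rep_Fz z by [].
have [x0 p0] := psi_wirt 0 Dz; have [x1 p1] := psi_wirt 1 Dz.
have [a3 p3] := phi3_dzbar Dz.
have m1 : sqmod (G z) < 1 by exact: disk_defect (G1 Dz).
have cG := is_wirt_conj (csmooth_wirt sG Dz).
have muw := is_wirtD p0 (is_wirtM (is_wirt_cst z 'i%C) p1).
have e1 : _ /\ _ := is_wirt_uniq p3 (is_wirt_ext oD Dz
   (fun w Dw => esym (let: And3 _ _ e := (iso w Dw).1 in e))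
   (is_wirtM (is_wirtN cG) muw)).
have e2 : _ /\ _ := is_wirt_uniq (is_wirtB p0 (is_wirtM (is_wirt_cst z 'i%C) p1))
   (is_wirt_ext oD Dz (fun w Dw => esym (let: And3 _ e _ := (iso w Dw).1 in e))
   (is_wirtM cG p3)).
have [lam lam0 ff] := conf z Dz.
have := mini z Dz.
have ln : lam != 0 by rewrite gt_eqF.
rewrite (mean_curvature_nil3 _ ff ln) gauss // sphere_pointE.
have [-> ->] := lcoord_vpartial Dz; rewrite !row3E => e3.
have := forward_algebra m1 mu0 ln isz e1.2 e2.2 e3.
move=> /(congr1 (@conjc R)); rewrite conjcK => E.
rewrite /rep_Fz E defect_sqmod.
have d0 : (1 - sqmod (G z))%:C != 0 :> R[i].
  by rewrite -defect_sqmod; exact: defect_neq0.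
exact: rep_Fz_algebra d0.
Qed.

End ChartForward.

(** * Closedness of the representation forms *)
Lemma rep_x3z_algebra (R : realType) (f0 f1 : R[i]) (x0 x1 l0 l1 : R) :
  (- ((x1 * l0 - x0 * l1) / 2))%:C =
  (f0 * f1^*%C - f1 * f0^*%C) / 2 -
  (0 * (x1%:C * f0 - x0%:C * f1) +
   2^-1 * (f1^*%C * f0 + x1%:C * l0%:C - (f0^*%C * f1 + x0%:C * l1%:C))).
Proof.
have half : (2^-1 : R[i]) = (2^-1 : R)%:C by rewrite fmorphV rmorph_nat.
rewrite half; case: f0 f1 => [? ?] [? ?].
by apply: complex_inj; rewrite /=; field.
Qed.

Section ChartBackward.
Variable R : realType.
Variables (D : set R[i]^o) (G : R[i] -> R[i]).
Hypothesis oD : open D.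
Hypothesis sG : csmooth D G.
Hypothesis G1 : forall z, D z -> `|G z| < 1.
Hypothesis harm : forall z, D z ->
  let p := cpartial 1 G z in let q := cpartial 'i%C G z in
  cpartial 1 (cpartial 1 G) z + cpartial 'i%C (cpartial 'i%C G) z =
  - (2 * (G z)^*%C * (p * p + q * q)) / (1 - G z * (G z)^*%C).

(** With a = g_z, b = g_zbar and d = 1 - |g|^2, the left-hand side is the
    zbar-derivative of mu = - 4 i a d^-2, the harmonic map equation being used for that of a:
    the terms in b cancel. *)
Lemma rep_Fz_dzbar_algebra (g a b : R[i]) : 1 - g * g^*%C != 0 ->
  let d := 1 - g * g^*%C in
  let mu := - 4 * 'i%C * (a * (d^-1 * d^-1)) in
  0 * (a * (d^-1 * d^-1)) + - 4 * 'i%C *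
    (4^-1 * (- (2 * g^*%C * ((a + b) * (a + b) +
               'i%C * (a - b) * ('i%C * (a - b)))) / d) * (d^-1 * d^-1) +
     a * (- (0 - (b * g^*%C + g * a^*%C)) / (d * d) * d^-1 +
          d^-1 * (- (0 - (b * g^*%C + g * a^*%C)) / (d * d)))) =
  - ('i%C / 2) * g * (sqmod mu * (1 - sqmod g))%:C.
Proof.
move=> d0 d mu.
have E1 : (sqmod mu * (1 - sqmod g))%:C = mu * mu^*%C * d.
  by rewrite mul_conj rmorphM /= -defect_sqmod.
have E2 : mu^*%C = 4 * 'i%C * (a^*%C * (d^-1 * d^-1)).
  have dc : d^*%C = d.
    by rewrite /d (defect_sqmod (fun=> g) 0) conjc_real.
  rewrite /mu !conjM conjN conj_i !conjc_inv dc.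
  have -> : (4 : R[i])^*%C = 4 by exact: conjc_nat.
  by ring.
rewrite E1 E2 /mu -/d; move: d0; rewrite -/d; have := @mulii R.
have dE : g * g^*%C = 1 - d by rewrite /d opprB addrC subrK.
move: dE; clearbody d; move: 'i%C g^*%C a^*%C => ii gc ac dE i2 d0.
have -> : (a + b) * (a + b) + ii * (a - b) * (ii * (a - b)) = 4 * (a * b).
  have -> : ii * (a - b) * (ii * (a - b)) = (ii * ii) * ((a - b) * (a - b)) by ring.
  by rewrite i2; ring.
rewrite sub0r opprK.
have -> : - (ii / 2) * g * (- 4 * ii * (a * (d^-1 * d^-1)) *
    (4 * ii * (ac * (d^-1 * d^-1))) * d) =
    8 * ii * (ii * ii) * (g * a * ac * (d^-1 * d^-1 * d^-1)) by field.
rewrite i2; field.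
exact: d0.
Qed.

Lemma csmooth_inv_defect : csmooth D (fun w => (1 - G w * (G w)^*%C)^-1).
Proof.
apply: csmoothV => //; first by move=> z; exact: (defect_neq0 G1).
apply: csmoothB => //; first exact: csmooth_cst.
by apply: csmoothM => //; exact: csmooth_conj.
Qed.

Lemma rep_Fz_dzbar z : D z -> exists a, is_wirt (rep_Fz G) z a
  (- ('i%C / 2) * G z * (sqmod (rep_Fz G z) * (1 - sqmod (G z)))%:C).
Proof.
move=> Dz; have wG := csmooth_wirt sG Dz.
have wd := csmooth_wirt (csmooth_dz oD sG) Dz.
have sdef : csmooth D (fun w => 1 - G w * (G w)^*%C).
  apply: csmoothB => //; first exact: csmooth_cst.
  by apply: csmoothM => //; exact: csmooth_conj.
have wk := is_wirtV oD (fun w Dw => defect_neq0 G1 Dw) sdef Dz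
  (is_wirtB (is_wirt_cst z 1) (is_wirtM wG (is_wirt_conj wG))).
have [_ lap] := dz_dzbar oD sG Dz.
rewrite harm // (is_cpartial_val wG.1) (is_cpartial_val wG.2) in lap.
rewrite lap in wd.
have := is_wirtM (is_wirt_cst z (- 4 * 'i%C)) (is_wirtM wd (is_wirtM wk wk)).
have E := @rep_Fz_dzbar_algebra (G z) (dz G z) (dzbar G z) (defect_neq0 G1 Dz).
by move=> H; eexists; exact: (eq_ind _ (fun l => is_wirt _ z _ l) H _ E).
Qed.

Lemma conj_dz_rep_Fz z : D z -> (dz G z)^*%C =
  - ('i%C / 4) * (rep_Fz G z)^*%C * ((1 - sqmod (G z)) ^+ 2)%:C.
Proof.
move=> Dz; have d0 := defect_neq0 G1 Dz; rewrite defect_sqmod in d0.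
rewrite /rep_Fz defect_sqmod; move: (dz G z) => b.
rewrite !conjM conjN conj_i !conjc_inv conjc_real.
have -> : (4 : R[i])^*%C = 4 by exact: conjc_nat.
have -> : ((1 - sqmod (G z)) ^+ 2)%:C = (1 - sqmod (G z))%:C ^+ 2.
  by rewrite rmorphXn.
move: d0 (@mulii R); move: (_ - _)%:C => d d0.
move: 'i%C b^*%C => ii a i2.
have -> : - (ii / 4) * (- 4 * - ii * (a * (d^-1 * d^-1))) * d ^+ 2 = - (ii * ii) * a.
  by field.
by rewrite i2 opprK mul1r.
Qed.

(** The coordinates f0, f1, f2 solving [isotropic] for mu = [rep_Fz]. *)
Definition rep_x1z w := (rep_Fz G w + (G w)^*%C * (- (G w)^*%C * rep_Fz G w)) * 2^-1.
Definition rep_x2z w :=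
  - 'i%C * (rep_Fz G w - (G w)^*%C * (- (G w)^*%C * rep_Fz G w)) * 2^-1.
Definition rep_phi3 w := - (G w)^*%C * rep_Fz G w.

(** The first two derivatives are real, which is the closedness of dx1 and dx2.
    The third is imaginary, because mu_zbar = - (i/2) g |mu|^2 (1 - |g|^2). *)
Lemma rep_dzbar z : D z ->
  let l : R[i] := - ('i%C / 2) * G z * (sqmod (rep_Fz G z) * (1 - sqmod (G z)))%:C in
  [/\ exists a, is_wirt rep_x1z z a (complex.Re l)%:C,
      exists a, is_wirt rep_x2z z a (complex.Im l)%:C &
      exists a, is_wirt rep_phi3 z a
       ('i%C * (sqmod (rep_Fz G z) * (1 - sqmod (G z) ^+ 2) / 4)%:C)].
Proof.
move=> Dz l; have [a wh] := rep_Fz_dzbar Dz; rewrite -/l in wh.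
have wG := is_wirt_conj (csmooth_wirt sG Dz).
have w3 := is_wirtM (is_wirtN wG) wh; rewrite -/rep_phi3 in w3.
have half : (2^-1 : R[i]) = (2^-1 : R)%:C by rewrite fmorphV rmorph_nat.
have quarter : ('i%C / 4 : R[i]) = 'i%C * (4^-1 : R)%:C by rewrite fmorphV rmorph_nat.
rewrite conj_dz_rep_Fz // in wG w3.
have E3 : - (- ('i%C / 4) * (rep_Fz G z)^*%C * ((1 - sqmod (G z)) ^+ 2)%:C) *
    rep_Fz G z + - (G z)^*%C * l =
    'i%C * (sqmod (rep_Fz G z) * (1 - sqmod (G z) ^+ 2) / 4)%:C.
  rewrite /l half quarter /sqmod; case: (rep_Fz G z) (G z) => [? ?] [? ?].
  by apply: complex_inj; rewrite /=; field.
rewrite E3 in w3.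
have wp := is_wirtM wG w3.
have E0 : - ('i%C / 4) * (rep_Fz G z)^*%C * ((1 - sqmod (G z)) ^+ 2)%:C *
    (- (G z)^*%C * rep_Fz G z) +
    (G z)^*%C * ('i%C * (sqmod (rep_Fz G z) * (1 - sqmod (G z) ^+ 2) / 4)%:C) = l^*%C.
  rewrite /l half quarter /sqmod; case: (rep_Fz G z) (G z) => [? ?] [? ?].
  by apply: complex_inj; rewrite /=; field.
rewrite E0 in wp.
split; last by eexists; exact: w3.
- have := is_wirtM (is_wirtD wh wp) (is_wirt_cst z 2^-1) => H; eexists.
  suff -> : (complex.Re l)%:C = (l + l^*%C) * 2^-1 +
    (rep_Fz G z + (G z)^*%C * (- (G z)^*%C * rep_Fz G z)) * 0 by exact: H.
  rewrite half mulr0 addr0; case: (l) => x y.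
  by apply: complex_inj; rewrite /=; field.
- have := is_wirtM (is_wirtM (is_wirt_cst z (- 'i%C)) (is_wirtB wh wp))
    (is_wirt_cst z 2^-1) => H; eexists.
  suff -> : (complex.Im l)%:C = (0 * (rep_Fz G z - (G z)^*%C *
    (- (G z)^*%C * rep_Fz G z)) + - 'i%C * (l - l^*%C)) * 2^-1 +
    - 'i%C * (rep_Fz G z - (G z)^*%C * (- (G z)^*%C * rep_Fz G z)) * 0 by exact: H.
  rewrite half mulr0 addr0 mul0r add0r; case: (l) => x y.
  by apply: complex_inj; rewrite /=; field.
Qed.

Lemma isotropic_rep z : isotropic (G z) (rep_Fz G z) (rep_x1z z) (rep_x2z z) (rep_phi3 z).
Proof.
have E : 'i%C * rep_x2z z =
     (rep_Fz G z - (G z)^*%C * (- (G z)^*%C * rep_Fz G z)) * 2^-1.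
  by rewrite /rep_x2z mulrA mulrA mulrN mulii opprK mul1r.
by split; rewrite ?E /rep_x1z /rep_phi3 //; field.
Qed.

(** The coefficient phi3 - (x2 (x1)_z - x1 (x2)_z) / 2 of dx3 involves the primitives
    x1 and x2 already found.  Differentiating them produces an imaginary term, which
    cancels (phi3)_zbar. *)
Lemma rep_x3z_dzbar (x0 x1 : R[i] -> R) z : D z ->
  is_wirt (fun w => (x0 w)%:C) z (rep_x1z z) (rep_x1z z)^*%C ->
  is_wirt (fun w => (x1 w)%:C) z (rep_x2z z) (rep_x2z z)^*%C ->
  exists a (b : R), is_wirt
    (fun w => rep_phi3 w - 2^-1 * ((x1 w)%:C * rep_x1z w - (x0 w)%:C * rep_x2z w)) z a b%:C.
Proof.
move=> Dz wx0 wx1.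
have [[a0 w0] [a1 w1] [a3 w3]] := rep_dzbar Dz.
move: w0 w1 w3; move: (complex.Re _) (complex.Im _) => l0 l1 w0 w1 w3.
have := is_wirtB w3 (is_wirtM (is_wirt_cst z 2^-1)
  (is_wirtB (is_wirtM wx1 w0) (is_wirtM wx0 w1))) => H.
eexists; exists (- ((x1 z * l0 - x0 z * l1) / 2)).
have [k1 _ _] := isotropic_products (isotropic_rep z).
have := rep_x3z_algebra (rep_x1z z) (rep_x2z z) (x0 z) (x1 z) l0 l1.
rewrite -k1 in H.
move=> E; rewrite E; exact: H.
Qed.

End ChartBackward.

(** * The representation forms integrate to minimal immersions *)
Lemma orthogonal_free (R : realType) (s t lam : R) (a b : 'rV[R]_3) : lam != 0 ->
  dot a a = lam -> dot b b = lam -> dot a b = 0 ->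
  (forall k, s * a 0 k + t * b 0 k = 0) -> s = 0 /\ t = 0.
Proof.
move=> l0 aa bb ab c; split; apply: (mulIf l0); rewrite mul0r.
- have -> : s * lam = s * dot a a + t * dot a b by rewrite aa ab mulr0 addr0.
  have -> : s * dot a a + t * dot a b = a 0 0 * (s * a 0 0 + t * b 0 0) +
    a 0 1 * (s * a 0 1 + t * b 0 1) + a 0 2 * (s * a 0 2 + t * b 0 2).
    by rewrite /dot; ring.
  by rewrite !c !mulr0 !addr0.
- have -> : t * lam = s * dot a b + t * dot b b by rewrite bb ab mulr0 add0r.
  have -> : s * dot a b + t * dot b b = b 0 0 * (s * a 0 0 + t * b 0 0) +
    b 0 1 * (s * a 0 1 + t * b 0 1) + b 0 2 * (s * a 0 2 + t * b 0 2).
    by rewrite /dot; ring.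
  by rewrite !c !mulr0 !addr0.
Qed.

(** Each of the three components of the tension vanishes. *)
Lemma vanishing_algebra (R : realType) (g f0 f1 f2 : R[i])
    (x0 x1 l0 l1 l2 lam r : R) :
  l0 / 4 = complex.Re (- ('i%C / 2) * g * (r * (1 - sqmod g))%:C) ->
  l1 / 4 = complex.Im (- ('i%C / 2) * g * (r * (1 - sqmod g))%:C) ->
  (l2 / 4 + (x1 * (l0 / 4) - x0 * (l1 / 4)) / 2)%:C +
    'i%C * (r * (1 - sqmod g ^+ 2) / 4)%:C =
    'i%C * (r * (1 - sqmod g ^+ 2) / 4)%:C ->
  complex.Re (f1 * f2^*%C) = - (complex.Im g * r * (1 - sqmod g) / 2) ->
  complex.Re (f0 * f2^*%C) = - (complex.Re g * r * (1 - sqmod g) / 2) ->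
  (2 * lam)^-1 *
   ((l0 + 2 * complex.Re f1 * (2 * complex.Re f2) +
      - (2 * complex.Im f1) * - (2 * complex.Im f2)) *
        (2 * complex.Re g / (1 + sqmod g)) +
    (l1 - 2 * complex.Re f0 * (2 * complex.Re f2) -
      - (2 * complex.Im f0) * - (2 * complex.Im f2)) *
        (2 * complex.Im g / (1 + sqmod g)) +
    (l2 + (x1 * l0 - x0 * l1) / 2) * ((1 - sqmod g) / (1 + sqmod g))) = 0.
Proof.
have half : (2^-1 : R[i]) = (2^-1 : R)%:C by rewrite fmorphV rmorph_nat.
rewrite half => E0 E1 E3 k1 k0.
have {}E3 : l2 / 4 + (x1 * (l0 / 4) - x0 * (l1 / 4)) / 2 = 0.
  by apply: (@complexI R); apply: (addIr _ (etrans E3 _)); rewrite add0r.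
move: (1 + sqmod g)^-1 E0 E1 k1 k0 => s.
move: (1 - sqmod g) => d.
case: g f0 f1 f2 => [g1 g2] [p0 q0] [p1 q1] [p2 q2] /= E0 E1 k1 k0.
have -> : l0 + 2 * p1 * (2 * p2) + - (2 * q1) * - (2 * q2) = 0 by lra.
have -> : l1 - 2 * p0 * (2 * p2) - - (2 * q0) * - (2 * q2) = 0 by lra.
have -> : l2 + (x1 * l0 - x0 * l1) / 2 = 0 by lra.
by rewrite !mul0r !addr0 mulr0.
Qed.

Lemma formulas_algebra (R : realType) (g a f0 f1 f2 : R[i]) (x0 x1 d : R) :
  isotropic g (- 4 * 'i%C * (a * (d%:C^-1 * d%:C^-1))) f0 f1
    (f2 + 2^-1 * (x1%:C * f0 - x0%:C * f1)) ->
  let F := x0%:C + 'i%C * x1%:C in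
  let Fz := f0 + (0 * x1%:C + 'i%C * f1) in
  let Fzb := f0^*%C + (0 * x1%:C + 'i%C * f1^*%C) in
  [/\ Fz = - 4 * 'i%C * (a / d%:C ^+ 2),
      Fzb = - 4 * 'i%C * (g ^+ 2 * a^*%C / d%:C ^+ 2) &
      f2 = 4 * 'i%C * (g^*%C * a / d%:C ^+ 2) -
        'i%C / 4 * (F^*%C * Fz - F * Fzb^*%C)].
Proof.
have sqV : (d%:C ^+ 2)^-1 = d%:C^-1 * d%:C^-1 :> R[i] by rewrite expr2 invfM.
rewrite sqV => -[E0 E1 E2] F Fz Fzb.
have FzE : Fz = f0 + 'i%C * f1 by rewrite /Fz mul0r add0r.
have FzbE : Fzb^*%C = f0 - 'i%C * f1.
  by rewrite /Fzb mul0r add0r conjD conjM conj_i !conjcK mulNr.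
have FcE : F^*%C = x0%:C - 'i%C * x1%:C.
  by rewrite /F conjD conjM conj_i !conjc_real mulNr.
split.
- by rewrite FzE E0.
- have c4 : (4 : R[i])^*%C = 4 by exact: conjc_nat.
  rewrite -[Fzb]conjcK FzbE E1 E2.
  rewrite !(conjM, conjN, conj_i, conjcK, conjc_inv, conjc_real, c4).
  by ring.
- have -> : f2 = (f2 + 2^-1 * (x1%:C * f0 - x0%:C * f1)) -
     2^-1 * (x1%:C * f0 - x0%:C * f1) by rewrite addrK.
  rewrite E2 FzbE FcE FzE /F.
  have := @mulii R; move: 'i%C => ii i2.
  have -> : ii / 4 * ((x0%:C - ii * x1%:C) * (f0 + ii * f1) -
     (x0%:C + ii * x1%:C) * (f0 - ii * f1)) =
     2^-1 * (ii * ii) * (x0%:C * f1 - x1%:C * f0) by field.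
  by rewrite i2; ring.
Qed.

Section Sufficiency.
Variable R : realType.
Variables (D : set R[i]^o) (G : R[i] -> R[i]) (X : R[i] -> 'rV[R]_3).
Hypothesis oD : open D.
Hypothesis sG : csmooth D G.
Hypothesis G1 : forall z, D z -> `|G z| < 1.
Hypothesis sX : forall k, smooth_on D (fun w => X w 0 k).
Hypothesis iso : forall z, D z ->
  isotropic (G z) (rep_Fz G z) (psi X 0 z) (psi X 1 z) (phi3 X z).

Lemma rep_Fz_neq0 z : D z -> dz G z != 0 -> rep_Fz G z != 0.
Proof.
move=> Dz gz; have d0 := defect_neq0 G1 Dz.
rewrite /rep_Fz; apply: mulf_neq0.
  rewrite mulf_neq0 ?oppr_eq0 ?pnatr_eq0 //.
  by rewrite eq_complex /= oner_eq0 andbF.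
by apply: mulf_neq0 => //; rewrite mulf_neq0 ?invr_eq0.
Qed.

Lemma conformal_of_isotropic z : D z -> dz G z != 0 ->
  [/\ row_free (Defs.jacobian X z),
      exists2 lam : R, 0 < lam & first_form (@nil3_metric R) X z = lam%:M &
      unit_normal X z = sphere_point (G z)].
Proof.
move=> Dz gz.
have [lam lam0 [aa bb ab nE]] := gauss_of_isotropic
  (disk_defect (G1 Dz)) (rep_Fz_neq0 Dz gz) (iso Dz).
have [f00 f01 f10 f11] := first_formE sX Dz.
have [E1 E2] := lcoord_vpartial sX Dz.
split.
- apply: inj_row_free => v v0.
  have comb k : v 0 0 * vpartial 1 X z 0 k + v 0 1 * vpartial 'i%C X z 0 k = 0.
    have := congr1 (fun u : 'rV[R]_3 => u 0 k) v0.
    by rewrite mxE sum2E /Defs.jacobian !(mxE _ _ _ k).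
  have cc k : v 0 0 * lcoord (X z) (vpartial 1 X z) 0 k +
      v 0 1 * lcoord (X z) (vpartial 'i%C X z) 0 k = 0.
    move: k (comb 0) (comb 1) (comb 2).
    move: (vpartial 1 X z) (vpartial 'i%C X z) => p q.
    apply: ord3P; rewrite !row3E // => c0 c1 c2.
    have -> : v 0 0 * (p 0 2 + (X z 0 1 * p 0 0 - X z 0 0 * p 0 1) / 2) +
        v 0 1 * (q 0 2 + (X z 0 1 * q 0 0 - X z 0 0 * q 0 1) / 2) =
      (v 0 0 * p 0 2 + v 0 1 * q 0 2) +
      (X z 0 1 * (v 0 0 * p 0 0 + v 0 1 * q 0 0) -
       X z 0 0 * (v 0 0 * p 0 1 + v 0 1 * q 0 1)) / 2 by field.
    by rewrite c0 c1 c2 !mulr0 subr0 mul0r addr0.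
  rewrite E1 E2 in cc.
  have [v00 v01] := orthogonal_free (lt0r_neq0 lam0) aa bb ab cc.
  by apply/rowP; apply: ord2P; rewrite ?v00 ?v01 mxE.
- exists lam => //; apply/matrixP; apply: ord2P; apply: ord2P;
    rewrite ?f00 ?f01 ?f10 ?f11 [RHS]mxE /=.
  + by rewrite mulr1n.
  + by rewrite mulr0n.
  + by rewrite mulr0n -ab /dot; ring.
  + by rewrite mulr1n.
- by rewrite (unit_normalE sX Dz).
Qed.

Hypothesis harm : forall z, D z ->
  let p := cpartial 1 G z in let q := cpartial 'i%C G z in
  cpartial 1 (cpartial 1 G) z + cpartial 'i%C (cpartial 'i%C G) z =
  - (2 * (G z)^*%C * (p * p + q * q)) / (1 - G z * (G z)^*%C).

(** The mixed derivatives of x1, x2 and the real part of (phi3)_zbar are known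
    from [rep_dzbar]; with them the tension vanishes identically. *)
Lemma minimal_of_isotropic z : D z -> dz G z != 0 ->
  mean_curvature (@nil3_metric R) X (unit_normal X z *m nil3_frame (X z)) z = 0.
Proof.
move=> Dz gz; have [_ [lam lam0 ff] nE] := conformal_of_isotropic Dz gz.
have ln : lam != 0 by rewrite gt_eqF.
rewrite (mean_curvature_nil3 _ ff ln) nE sphere_pointE.
have [-> ->] := lcoord_vpartial sX Dz; rewrite !row3E.
have [[a0 w0] [a1 w1] [a3 w3]] := rep_dzbar oD sG G1 harm Dz.
have [_ p0] := psi_wirt oD sX 0 Dz; have [_ p1] := psi_wirt oD sX 1 Dz.
have [b3 p3] := phi3_dzbar oD sX Dz.
have q0 w : D w -> rep_x1z G w = psi X 0 w.
  by move=> /iso/isotropic_split[-> _ _].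
have q1 w : D w -> rep_x2z G w = psi X 1 w.
  by move=> /iso/isotropic_split[_ -> _].
have q3 w : D w -> rep_phi3 G w = phi3 X w.
  by move=> /iso/isotropic_split[_ _ ->].
have [_ e0] := is_wirt_uniq p0 (is_wirt_ext oD Dz q0 w0).
have [_ e1] := is_wirt_uniq p1 (is_wirt_ext oD Dz q1 w1).
have [_ e3] := is_wirt_uniq p3 (is_wirt_ext oD Dz q3 w3).
have [k1 k2 k3] := isotropic_products (iso Dz).
rewrite k1 in e3.
exact: (vanishing_algebra _ (complexI e0) (complexI e1) e3 k2 k3).
Qed.

End Sufficiency.

Section Formulas.
Variable R : realType.
Variables (D : set R[i]^o) (G : R[i] -> R[i]) (X : R[i] -> 'rV[R]_3).
Hypothesis sG : csmooth D G.
Hypothesis sX : forall k, smooth_on D (fun w => X w 0 k).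

Lemma isotropic_formulas z : D z ->
  isotropic (G z) (rep_Fz G z) (psi X 0 z) (psi X 1 z) (phi3 X z) ->
  let F := fun w => nil_F (X w) in
  [/\ dz F z = - 4 * 'i%C * (dz G z / (1 - `|G z| ^+ 2) ^+ 2),
       dzbar F z =
         - 4 * 'i%C * (G z ^+ 2 * dzbar (fun w => (G w)^*%C) z
                     / (1 - `|G z| ^+ 2) ^+ 2) &
       dz (fun w => (nil_h (X w))%:C) z =
         4 * 'i%C * ((G z)^*%C * dz G z / (1 - `|G z| ^+ 2) ^+ 2)
         - 'i%C / 4 * ((F z)^*%C * dz F z - F z * dz (fun w => (F w)^*%C) z)].
Proof.
move=> Dz isz F.
have [x0 _] := smooth_real_wirt (sX 0) Dz; have [x1 _] := smooth_real_wirt (sX 1) Dz.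
have FE : F = (fun w => (X w 0 0)%:C + 'i%C * (X w 0 1)%:C).
  by apply/funext => w; apply: complex_inj; rewrite /=; ring.
have wF := is_wirtD x0 (is_wirtM (is_wirt_cst z 'i%C) x1); rewrite -FE in wF.
have wFc := is_wirt_conj wF.
rewrite (is_wirt_dz wF) (is_wirt_dzbar wF) (is_wirt_dz wFc).
rewrite (is_wirt_dzbar (is_wirt_conj (csmooth_wirt sG Dz))).
have -> : F z = (X z 0 0)%:C + 'i%C * (X z 0 1)%:C by rewrite FE.
have dE : 1 - `|G z| ^+ 2 = (1 - sqmod (G z))%:C.
  by rewrite -add_Re2_Im2 -/(sqmod _) -[1]/(1%:C) -rmorphB.
rewrite dE; move: isz; rewrite /rep_Fz /phi3 defect_sqmod.
exact: formulas_algebra.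
Qed.

End Formulas.

(** * Primitives on simply connected spaces *)
Section LocallyConstant.
Variables (T : topologicalType) (V : Type).

Lemma connected_locally_constant (Q : set T) (D : T -> V) : connected Q ->
  (forall x, Q x -> \forall y \near x, Q y -> D y = D x) ->
  forall x y, Q x -> Q y -> D x = D y.
Proof.
move=> cQ loc x y Qx Qy.
suff E : [set z | Q z /\ D z = D x] = Q.
  by have : Q y by []; rewrite -E => -[_ ->].
apply: cQ; first by exists x.
- exists (interior [set z | Q z -> D z = D x]); first exact: open_interior.
  rewrite eqEsubset; split=> z.
  + move=> [Qz zx]; split => //; apply: filterS (loc z Qz) => u /= uz Qu.
    by rewrite uz.
  + by move=> [Qz /interior_subset/(_ Qz)].
- exists (~` interior [set z | Q z -> D z <> D x]).
    by apply: open_closedC; exact: open_interior.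
  rewrite eqEsubset; split=> z.
  + by move=> [Qz zx]; split => // /interior_subset/(_ Qz)/(_ zx).
  + move=> [Qz nz]; split => //; apply: contrapT => zx; apply: nz.
    by apply: filterS (loc z Qz) => u /= uz Qu; rewrite uz.
Qed.

End LocallyConstant.

(** A closed 1-form is given here by its local primitives only: [prim f q] says
    that f is one at q.  They exist near every point, and two of them differ by a
    constant near every point. *)
Section Along.
Variables (R : realType) (S : topologicalType).
Variable prim : (S -> R) -> S -> Prop.
Hypothesis prim_ex : forall p : S, exists f, \forall q \near p, prim f q.
Hypothesis prim_uniq : forall f g (p : S), (\forall q \near p, prim f q) ->
  (\forall q \near p, prim g q) -> \forall q \near p, f q - g q = f p - g p.

(** Phi is a primitive of the pull-back of the form by H, on Q. *)
Definition along (T : topologicalType) (Q : set T) (H : T -> S) (Phi : T -> R) :=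
  forall x f, Q x -> (\forall q \near H x, prim f q) ->
  \forall y \near x, Q y -> Phi y - f (H y) = Phi x - f (H x).

Section AlongTheory.
Variable T : topologicalType.
Implicit Types (Q A B : set T) (H : T -> S) (Phi Psi : T -> R).

Lemma along_uniq Q H Phi Psi : connected Q -> along Q H Phi -> along Q H Psi ->
  forall x y, Q x -> Q y -> Phi y - Phi x = Psi y - Psi x.
Proof.
move=> cQ aPhi aPsi x y Qx Qy.
have E : Phi x - Psi x = Phi y - Psi y.
  apply: (connected_locally_constant (D := Phi \- Psi) cQ _ Qx Qy) => z Qz /=.
  have [f fp] := prim_ex (H z).
  move: (aPhi z f Qz fp) (aPsi z f Qz fp); apply: filterS2 => u h1 h2 Qu.
  by rewrite /= -[Phi u](subrK (f (H u))) -[Psi u](subrK (f (H u))) h1 // h2 //; ring.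
by rewrite -[Phi y](subrK (Psi y)) -E; ring.
Qed.

Lemma along_sub A B H Phi : A `<=` B -> along B H Phi -> along A H Phi.
Proof.
move=> AB aP x f Ax fp; apply: filterS (aP x f (AB _ Ax) fp) => y h Ay.
by apply: h; exact: AB.
Qed.

Lemma along_ext Q H H' Phi : (forall x, Q x -> H x = H' x) ->
  along Q H Phi -> along Q H' Phi.
Proof.
move=> HH aP x f Qx; rewrite -HH // => fp.
by apply: filterS (aP x f Qx fp) => y h Qy; rewrite -HH // h.
Qed.

Lemma along_cst Q (p : S) (c : R) : along Q (fun=> p) (fun=> c).
Proof. by move=> x f _ _; exact: nearW. Qed.

(** On the connected set A :&: B the two primitives differ by a constant, which is
    used to shift the second one.  Closedness of A and B keeps each of them away
    from the points of the other set. *)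
Lemma along_glue A B H Phi Psi : closed A -> closed B -> connected (A `&` B) ->
  along A H Phi -> along B H Psi -> exists Theta, along (A `|` B) H Theta.
Proof.
move=> clA clB cAB aPhi aPsi.
have [k kP] : exists k, forall x, A x -> B x -> Phi x = Psi x + k.
  have [[x0 [Ax0 Bx0]]|nAB] := pselect (exists x, (A `&` B) x).
    exists (Phi x0 - Psi x0) => x Ax Bx.
    have := along_uniq cAB (along_sub (@subIsetl _ A B) aPhi)
      (along_sub (@subIsetr _ A B) aPsi) (conj Ax0 Bx0) (conj Ax Bx).
    by move=> E; rewrite -[Phi x](subrK (Phi x0)) E; ring.
  by exists 0 => x Ax Bx; case: nAB; exists x.
pose Theta x := if x \in A then Phi x else Psi x + k.
have ThA x : A x -> Theta x = Phi x by move=> Ax; rewrite /Theta mem_set.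
have ThB x : B x -> Theta x = Psi x + k.
  move=> Bx; have [Ax|nAx] := pselect (A x); first by rewrite ThA // kP.
  by rewrite /Theta memNset.
have off C x (P : T -> Prop) : closed C -> ~ C x -> \forall y \near x, C y -> P y.
  move=> clC nCx.
  have : nbhs x (~` C) by apply: open_nbhs_nbhs; split => //; exact: closed_openC.
  by apply: filterS => y nCy /nCy.
exists Theta => x f ABx fp.
have hA : \forall y \near x, A y -> Theta y - f (H y) = Theta x - f (H x).
  have [Ax|nAx] := pselect (A x); last exact: off.
  by apply: filterS (aPhi x f Ax fp) => y h Ay; rewrite !ThA ?h.
have hB : \forall y \near x, B y -> Theta y - f (H y) = Theta x - f (H x).
  have [Bx|nBx] := pselect (B x); last exact: off.
  apply: filterS (aPsi x f Bx fp) => y h By; rewrite !ThB //.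
  by rewrite addrAC h // addrAC.
by move: hA hB; apply: filterS2 => y h1 h2 [/h1|/h2].
Qed.

End AlongTheory.

Lemma along_comp (T T' : topologicalType) (Q : set T) (Q' : set T')
    (k : T' -> T) (H : T -> S) Phi :
  {within Q', continuous k} -> (forall x, Q' x -> Q (k x)) ->
  along Q H Phi -> along Q' (H \o k) (Phi \o k).
Proof.
move=> /subspace_continuousP ck kQ aP x f Q'x fp.
have := ck x Q'x _ (aP (k x) f (kQ _ Q'x) fp).
rewrite /= !near_simpl near_withinE; apply: filterS => y h Q'y.
exact: h Q'y (kQ _ Q'y).
Qed.

Lemma prim_open f (p : S) : (\forall q \near p, prim f q) ->
  \forall q \near p, \forall q' \near q, prim f q'.
Proof. exact: near_join. Qed.

Definition rect (a b c d : R) : set (R * R) :=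
  (fst @^-1` `[a, b]) `&` (snd @^-1` `[c, d]).

Lemma rectP a b c d (x : R * R) :
  rect a b c d x <-> (a <= x.1 <= b) /\ (c <= x.2 <= d).
Proof. by rewrite /rect /= !in_itv. Qed.

Lemma closed_rect a b c d : closed (rect a b c d).
Proof.
apply: closedI; apply: closed_comp; try exact: itv_closed.
- by move=> x _; exact: cvg_fst.
- by move=> x _; exact: cvg_snd.
Qed.

Lemma rect_glue1 a m b c d : a <= m -> m <= b ->
  rect a m c d `|` rect m b c d = rect a b c d.
Proof.
move=> am mb; rewrite eqEsubset; split=> x.
- move=> [] /rectP[/andP[x1 x2] x3]; apply/rectP; split => //; apply/andP; split.
  + exact: x1.
  + exact: le_trans x2 mb.
  + exact: le_trans am x1.
  + exact: x2.
- move=> /rectP[/andP[x1 x2] x3]; have [xm|mx] := leP x.1 m.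
  + by left; apply/rectP; rewrite x1.
  + by right; apply/rectP; rewrite (ltW mx).
Qed.

Lemma rect_glue2 a b c m d : c <= m -> m <= d ->
  rect a b c m `|` rect a b m d = rect a b c d.
Proof.
move=> am mb; rewrite eqEsubset; split=> x.
- move=> [] /rectP[x3 /andP[x1 x2]]; apply/rectP; split => //; apply/andP; split.
  + exact: x1.
  + exact: le_trans x2 mb.
  + exact: le_trans am x1.
  + exact: x2.
- move=> /rectP[x3 /andP[x1 x2]]; have [xm|mx] := leP x.2 m.
  + by left; apply/rectP; rewrite x1.
  + by right; apply/rectP; rewrite (ltW mx).
Qed.

Lemma continuous_pair_l (m y : R) : {for y, continuous (fun y : R => (m, y))}.
Proof.
move=> A /nbhs_ballP[eps /= eps0 eA]; apply/(nbhs_ballP y); exists eps => // z zy.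
by apply: eA; split => //; exact: ballxx.
Qed.

Lemma continuous_pair_r (m y : R) : {for y, continuous (fun y : R => (y, m))}.
Proof.
move=> A /nbhs_ballP[eps /= eps0 eA]; apply/(nbhs_ballP y); exists eps => // z zy.
by apply: eA; split => //; exact: ballxx.
Qed.

Lemma connected_rect1 a m b c d : a <= m -> m <= b ->
  connected (rect a m c d `&` rect m b c d).
Proof.
move=> am mb.
have -> : rect a m c d `&` rect m b c d = (fun y => (m, y)) @` `[c, d].
  rewrite eqEsubset; split=> [[x y]|_ [y yr <-]].
  - move=> [/rectP[/= /andP[_ xm] yr] /rectP[/= /andP[mx _] _]].
    exists y; first by rewrite /= in_itv.
    by congr (_, _); apply/eqP; rewrite eq_le xm mx.
  - by split; apply/rectP => /=; rewrite ?lexx ?am ?mb; move: yr; rewrite /= in_itv.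
apply: connected_continuous_connected; first exact: segment_connected.
by apply: continuous_subspaceT => y; exact: continuous_pair_l.
Qed.

Lemma connected_rect2 a b c m d : c <= m -> m <= d ->
  connected (rect a b c m `&` rect a b m d).
Proof.
move=> am mb.
have -> : rect a b c m `&` rect a b m d = (fun y => (y, m)) @` `[a, b].
  rewrite eqEsubset; split=> [[x y]|_ [y yr <-]].
  - move=> [/rectP[/= yr /andP[_ xm]] /rectP[/= _ /andP[mx _]]].
    exists x; first by rewrite /= in_itv.
    by congr (_, _); apply/eqP; rewrite eq_le xm mx.
  - by split; apply/rectP => /=; rewrite ?lexx ?am ?mb; move: yr; rewrite /= in_itv.
apply: connected_continuous_connected; first exact: segment_connected.
by apply: continuous_subspaceT => y; exact: continuous_pair_r.
Qed.

Lemma along_small (T : topologicalType) (Q A : set T) (H : T -> S) f :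
  {within Q, continuous H} -> A `<=` Q ->
  (forall x, A x -> \forall q \near H x, prim f q) -> along A H (f \o H).
Proof.
move=> /subspace_continuousP cH AQ fA x g Ax gx.
have := cH x (AQ _ Ax) _ (prim_uniq (fA x Ax) gx).
rewrite /= !near_simpl near_withinE; apply: filterS => y h Ay.
exact: h (AQ _ Ay).
Qed.

(** A small rectangle is mapped into the domain of one local primitive.  Continuous
    induction in the second variable, and then in the first, glues such rectangles
    along common sides. *)
Lemma along_square (H : R * R -> S) : {within rect 0 1 0 1, continuous H} ->
  exists Phi, along (rect 0 1 0 1) H Phi.
Proof.
move=> cH.
have loc (x y : R) : 0 <= x <= 1 -> 0 <= y <= 1 -> exists2 eps : R, 0 < eps &
    forall a b c d, 0 <= a -> b <= 1 -> 0 <= c -> d <= 1 ->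
    x - eps < a -> b < x + eps -> y - eps < c -> d < y + eps ->
    exists Phi, along (rect a b c d) H Phi.
  move=> xr yr; have sqxy : rect 0 1 0 1 (x, y) by apply/rectP.
  have [f fp] := prim_ex (H (x, y)).
  move/subspace_continuousP: (cH) => /(_ _ sqxy _ (prim_open fp)).
  rewrite /= !near_simpl near_withinE => /nbhs_ballP[eps /= eps0 he].
  exists eps => // a b c d a0 b1 c0 d1 xa bx yc dy.
  have sub : rect a b c d `<=` rect 0 1 0 1.
    move=> u /rectP[/andP[h1 h2] /andP[h3 h4]]; apply/rectP.
    by rewrite (le_trans a0 h1) (le_trans h2 b1) (le_trans c0 h3) (le_trans h4 d1).
  exists (f \o H); apply: (along_small cH sub) => u uab.
  apply: he (sub _ uab); move: uab => /rectP[/andP[h1 h2] /andP[h3 h4]].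
  by split; rewrite /ball /= ltr_norml; apply/andP; split; lra.
apply: (@interval_induction R (fun a b => exists Phi, along (rect a b 0 1) H Phi) 0 1 ler01).
- move=> x xr.
  pose Q c d := exists2 eps : R, 0 < eps & forall a b, 0 <= a -> b <= 1 ->
    x - eps < a -> b < x + eps -> exists Phi, along (rect a b c d) H Phi.
  suff [eps eps0 h] : Q 0 1 by exists eps => // c d c0 _ _ d1; exact: h.
  apply: (@interval_induction R Q 0 1 ler01).
  + move=> y yr; have [eps eps0 h] := loc x y xr yr; exists eps => //.
    move=> c d c0 _ _ d1 yc dy; exists eps => // a b a0 b1 xa bx.
    exact: h.
  + move=> c m d cm md [e1 e10 h1] [e2 e20 h2].
    exists (Num.min e1 e2); first by rewrite lt_min e10.
    move=> a b a0 b1 xa bx.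
    have l1 : Num.min e1 e2 <= e1 by rewrite ge_min lexx.
    have l2 : Num.min e1 e2 <= e2 by rewrite ge_min lexx orbT.
    have [||Phi aPhi] := h1 a b a0 b1; [lra|lra|].
    have [||Psi aPsi] := h2 a b a0 b1; [lra|lra|].
    rewrite -(rect_glue2 a b cm md).
    apply: along_glue aPhi aPsi; try exact: closed_rect.
    exact: connected_rect2.
- move=> a m b am mb [Phi aPhi] [Psi aPsi].
  rewrite -(rect_glue1 0 1 am mb).
  apply: along_glue aPhi aPsi; try exact: closed_rect.
  exact: connected_rect1.
Qed.

Lemma within_comp (T T' U : topologicalType) (Q : set T) (Q' : set T')
    (k : T' -> T) (H : T -> U) :
  {within Q, continuous H} -> {within Q', continuous k} ->
  (forall x, Q' x -> Q (k x)) -> {within Q', continuous (H \o k)}.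
Proof.
move=> /subspace_continuousP cH /subspace_continuousP ck kQ.
apply/subspace_continuousP => x Q'x A HA.
have := ck x Q'x _ (cH (k x) (kQ _ Q'x) A HA).
rewrite /= !near_simpl !near_withinE; apply: filterS => y h Q'y.
exact: h Q'y (kQ _ Q'y).
Qed.

Lemma affine_continuous (Q : set R) (a b : R) :
  {within Q, continuous (fun t : R => a * t + b)}.
Proof.
apply: continuous_subspaceT => t.
by apply: cvgD; [apply: cvgM; [exact: cvg_cst|exact: cvg_id]|exact: cvg_cst].
Qed.

(** As a relation, so that no choice of a path is needed. *)
Definition path_integral (p q : S) (alpha : R) :=
  exists (gamma : R -> S) (Phi : R -> R),
  [/\ {within `[0, 1], continuous gamma}, gamma 0 = p, gamma 1 = q,
      @along R `[0, 1] gamma Phi & Phi 1 - Phi 0 = alpha].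

Lemma I01 (t : R) : `[0, 1]%classic t <-> 0 <= t <= 1.
Proof. by rewrite /= in_itv. Qed.

Lemma path_integral_along (gamma : R -> S) : {within `[0, 1], continuous gamma} ->
  exists Phi, @along R `[0, 1] gamma Phi.
Proof.
move=> cg.
have [|Phi aPhi] := @along_square (gamma \o snd).
  apply: (within_comp cg); first by apply: continuous_subspaceT => x; exact: cvg_snd.
  by move=> x [].
exists (Phi \o (fun y => (0, y))).
have := along_comp (T' := R) (Q' := `[0, 1]%classic) (k := fun y => (0, y)) _ _ aPhi.
apply; first by apply: continuous_subspaceT => y; exact: continuous_pair_l.
by move=> y /I01 yr; apply/rectP; rewrite lexx ler01.
Qed.

Lemma path_integral_sym p q alpha :
  path_integral p q alpha -> path_integral q p (- alpha).
Proof.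
move=> [gamma [Phi [cg g0 g1 aPhi E]]].
have kI (t : R) : `[0, 1]%classic t -> `[0, 1]%classic (-1 * t + 1).
  by move=> /I01/andP[? ?]; apply/I01/andP; split; lra.
exists (gamma \o (fun t => -1 * t + 1)), (Phi \o (fun t => -1 * t + 1)); split.
- exact: within_comp cg (@affine_continuous _ _ _) kI.
- by rewrite /= mulr0 add0r.
- by rewrite /= mulr1 addNr.
- exact: along_comp (@affine_continuous _ _ _) kI aPhi.
- by rewrite /= mulr0 add0r mulr1 addNr -E opprB.
Qed.

Lemma path_integral_trans p q r alpha beta :
  path_integral p q alpha -> path_integral q r beta ->
  path_integral p r (alpha + beta).
Proof.
move=> [gamma [Phi [cg g0 g1 aPhi E]]] [delta [Psi [cd d0 d1 aPsi E']]].
pose A : set R := `[0, 2^-1]%classic; pose B : set R := `[2^-1, 1]%classic.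
have AP t : A t <-> 0 <= t <= 2^-1 by rewrite /A /= in_itv.
have BP t : B t <-> 2^-1 <= t <= 1 by rewrite /B /= in_itv.
have AB : A `|` B = `[0, 1]%classic.
  rewrite eqEsubset; split=> t.
    by move=> [/AP|/BP] /andP[? ?]; apply/I01/andP; split; lra.
  move=> /I01/andP[t0 t1]; have [th|ht] := leP t 2^-1.
    by left; apply/AP; rewrite t0.
  by right; apply/BP; rewrite t1 ltW.
have ABI : A `&` B = [set 2^-1].
  rewrite eqEsubset; split=> t; last first.
    by move=> ->; split; [apply/AP|apply/BP]; apply/andP; split; lra.
  by move=> [/AP/andP[_ h1] /BP/andP[h2 _]]; apply/eqP; rewrite eq_le h1 h2.
pose sigma t := if t <= 2^-1 then gamma (2 * t + 0) else delta (2 * t + -1).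
have sA t : A t -> (gamma \o (fun t => 2 * t + 0)) t = sigma t.
  by move=> /AP/andP[_ h]; rewrite /sigma h.
have sB t : B t -> (delta \o (fun t => 2 * t + -1)) t = sigma t.
  move=> /BP/andP[h _]; rewrite /sigma; case: ifP => //= h'.
  have -> : t = 2^-1 by apply/eqP; rewrite eq_le h h'.
  by rewrite mulfV ?pnatr_eq0 // subrr addr0 d0 g1.
have kA t : A t -> `[0, 1]%classic (2 * t + 0).
  by move=> /AP/andP[? ?]; apply/I01/andP; split; lra.
have kB t : B t -> `[0, 1]%classic (2 * t + -1).
  by move=> /BP/andP[? ?]; apply/I01/andP; split; lra.
have aA : along A sigma (Phi \o (fun t => 2 * t + 0)).
  by apply: along_ext sA _; exact: along_comp (@affine_continuous _ _ _) kA aPhi.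
have aB : along B sigma (Psi \o (fun t => 2 * t + -1)).
  by apply: along_ext sB _; exact: along_comp (@affine_continuous _ _ _) kB aPsi.
have clA : closed A by exact: itv_closed.
have clB : closed B by exact: itv_closed.
have [|Theta aT] := along_glue clA clB _ aA aB.
  by rewrite ABI; exact: connected1.
exists sigma, Theta; split.
- rewrite -AB; apply: withinU_continuous => //.
  + apply: (@subspace_eq_continuous _ _ _ (gamma \o (fun t => 2 * t + 0))).
      by move=> t; rewrite inE => /sA.
    exact: within_comp cg (@affine_continuous _ _ _) kA.
  + apply: (@subspace_eq_continuous _ _ _ (delta \o (fun t => 2 * t + -1))).
      by move=> t; rewrite inE => /sB.
    exact: within_comp cd (@affine_continuous _ _ _) kB.
- by rewrite /sigma invr_ge0 ler0n mulr0 addr0.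
- have -> : sigma 1 = delta (2 * 1 + -1) by rewrite -sB //; apply/BP/andP; split; lra.
  by rewrite -d1; congr delta; lra.
- by rewrite -AB.
- have A0 : A 0 by apply/AP/andP; split; lra.
  have Ah : A 2^-1 by apply/AP/andP; split; lra.
  have Bh : B 2^-1 by apply/BP/andP; split; lra.
  have B1 : B 1 by apply/BP/andP; split; lra.
  have TA := along_uniq (segment_connected (a := 0) (b := 2^-1))
    (along_sub (@subsetUl _ A B) aT) aA A0 Ah.
  have TB := along_uniq (segment_connected (a := 2^-1) (b := 1))
    (along_sub (@subsetUr _ A B) aT) aB Bh B1.
  move: TA TB; rewrite /= mulfV ?pnatr_eq0 // mulr0 !addr0 subrr => TA TB.
  have -> : alpha + beta = (Phi 1 - Phi 0) + (Psi 1 - Psi 0) by rewrite E E'.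
  have e1 : 2 * 1 + -1 = 1 :> R by lra.
  by rewrite e1 in TB; rewrite -TA -TB; ring.
Qed.

(** Two paths with the same ends form a loop.  Take a primitive along the square of
    a homotopy that contracts it: three sides are mapped to a point, so the
    increment along the fourth vanishes. *)
Lemma path_integral_uniq p q alpha beta : simply_connected R S ->
  path_integral p q alpha -> path_integral p q beta -> alpha = beta.
Proof.
move=> [_ sc] ha hb; apply/eqP; rewrite -subr_eq0; apply/eqP.
have [gamma [Phi [cg g0 g1 aPhi <-]]] :=
  path_integral_trans ha (path_integral_sym hb).
have [|H [cH H0 H1 Hs]] := sc gamma cg; first by rewrite g0 g1.
have rE : (`[0, 1] `*` `[0, 1])%classic = rect 0 1 0 1 by [].
rewrite rE in cH; have [Psi aPsi] := along_square cH.
have I0 : `[0, 1]%classic (0 : R) by apply/I01; rewrite lexx ler01.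
have I1 : `[0, 1]%classic (1 : R) by apply/I01; rewrite lexx ler01.
have kl (x : R) t : 0 <= x <= 1 -> `[0, 1]%classic t -> rect 0 1 0 1 (x, t).
  by move=> xr /I01 tr; apply/rectP.
have kr (x : R) t : 0 <= x <= 1 -> `[0, 1]%classic t -> rect 0 1 0 1 (t, x).
  by move=> xr /I01 tr; apply/rectP.
have vert (x : R) : 0 <= x <= 1 ->
    @along R `[0, 1] (H \o pair x) (Psi \o pair x).
  move=> xr; apply: along_comp (kl x ^~ xr) aPsi.
  by apply: continuous_subspaceT => y; exact: continuous_pair_l.
have hori (x : R) : 0 <= x <= 1 ->
    @along R `[0, 1] (H \o pair^~ x) (Psi \o pair^~ x).
  move=> xr; apply: along_comp (kr x ^~ xr) aPsi.
  by apply: continuous_subspaceT => y; exact: continuous_pair_r.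
have r0 : 0 <= (0 : R) <= 1 by rewrite lexx ler01.
have r1 : 0 <= (1 : R) <= 1 by rewrite lexx ler01.
have mem t : `[0, 1]%classic t -> t \in `[0, 1] by [].
have flat (H' : R -> S) Phi' : @along R `[0, 1] H' Phi' ->
    (forall t, `[0, 1]%classic t -> H' t = gamma 0) -> Phi' 1 = Phi' 0.
  move=> aP' E; have := along_uniq (segment_connected (a := 0) (b := 1))
     (along_ext E aP') (@along_cst R `[0, 1]%classic (gamma 0) 0) I0 I1.
  by rewrite subrr => /eqP; rewrite subr_eq0 => /eqP.
have E1 : Psi (1, 1) = Psi (1, 0).
  by apply: (flat _ _ (vert 1 r1)) => t /mem /H1.
have E2 : Psi (1, 0) = Psi (0, 0).
  by apply: (flat _ _ (hori 0 r0)) => t /mem /Hs[].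
have E3 : Psi (1, 1) = Psi (0, 1).
  by apply: (flat _ _ (hori 1 r1)) => t /mem /Hs[].
have E4 : forall t, `[0, 1]%classic t -> (H \o pair 0) t = gamma t.
  by move=> t /mem /H0.
rewrite (along_uniq (segment_connected (a := 0) (b := 1)) aPhi
  (along_ext E4 (vert 0 r0)) I0 I1) /=.
by rewrite -E3 E1 E2 subrr.
Qed.

(** The integral from z0 defines F.  Near p it differs from a local primitive f by a
    constant, because short paths starting at p stay in the domain of f. *)
Theorem global_primitive : simply_connected R S ->
  (forall (p : S) U, nbhs p U -> \forall q \near p, exists gamma : R -> S,
     [/\ {within `[0, 1], continuous gamma}, gamma 0 = p, gamma 1 = q &
         forall t, 0 <= t <= 1 -> U (gamma t)]) ->
  S -> exists F : S -> R, forall (p : S) f, (\forall q \near p, prim f q) ->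
    \forall q \near p, F q - f q = F p - f p.
Proof.
move=> sc lpc z0.
have [F FP] : exists F : S -> R, forall p, path_integral z0 p (F p).
  suff /choice[F FP] : forall p, exists alpha, path_integral z0 p alpha by exists F.
  move=> p; have [gamma [cg g0 g1]] := sc.1 z0 p.
  have [Phi aPhi] := path_integral_along cg.
  by exists (Phi 1 - Phi 0); exists gamma, Phi.
exists F => p f fp.
apply: filterS (lpc p _ (prim_open fp)) => q [gamma [cg g0 g1 gU]].
suff fpq : path_integral p q (f q - f p).
  have := path_integral_uniq sc (path_integral_trans (FP p) fpq) (FP q).
  by move=> <-; ring.
exists gamma, (f \o gamma); split; rewrite //= ?g0 ?g1 //.
by apply: (along_small cg) => // t /I01; exact: gU.
Qed.

End Along.

(** * Primitives of 1-forms on a Riemann surface *)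
Section Surface.
Variable R : realType.
Variable S : riemann_surface R.
Implicit Types (a b c : chart R S) (p q : S) (z w : R[i]).

Lemma near_chart_inv c z (U : S -> Prop) : chart_cod c z ->
  nbhs (chart_inv c z) U -> \forall w \near (z : R[i]^o), U (chart_inv c w).
Proof. by move=> cz nU; exact: (chart_inv_cont cz nU). Qed.

Lemma near_chart_map c p (U : R[i] -> Prop) : chart_dom c p ->
  nbhs (chart_map c p) U -> \forall q \near p, U (chart_map c q).
Proof. by move=> cp nU; exact: (chart_map_cont cp nU). Qed.

Lemma near_dom c p : chart_dom c p -> nbhs p (chart_dom c).
Proof. by move=> cp; apply: open_nbhs_nbhs; split => //; exact: chart_dom_open. Qed.

Lemma near_cod c z : chart_cod c z -> nbhs (z : R[i]^o) (chart_cod c).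
Proof. by move=> cp; apply: open_nbhs_nbhs; split => //; exact: chart_cod_open. Qed.

Lemma is_wirt_near (f g : R[i] -> R[i]) z l m :
  (\forall w \near (z : R[i]^o), f w = g w) ->
  is_wirt f z l m -> is_wirt g z l m.
Proof.
move=> fg; apply: (@is_wirt_ext R (interior [set w : R[i]^o | f w = g w])).
- exact: open_interior.
- exact: fg.
- by move=> w; exact: interior_subset.
Qed.

Definition transition a b : R[i]^o -> R[i]^o := chart_map a \o chart_inv b.

Lemma wirt_transition (f : S -> R[i]) a b z : atlas a -> atlas b ->
  chart_cod b z -> chart_dom a (chart_inv b z) ->
  forall D : set R[i]^o, open D -> D (transition a b z) ->
  csmooth D (fun w => f (chart_inv a w)) ->
  is_wirt (fun w => f (chart_inv b w)) z
    (dz (fun w => f (chart_inv a w)) (transition a b z) *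
       cderiv (transition a b) z)
    (dzbar (fun w => f (chart_inv a w)) (transition a b z) *
       (cderiv (transition a b) z)^*%C).
Proof.
move=> Aa Ab bz az D oD Dz sf.
have dt : derivable (transition a b) z (1 : R[i]^o).
  exact: (atlas_compatible Ab Aa bz az).
apply: is_wirt_near (is_wirt_comp_holomorphic oD sf Dz dt).
apply: filterS (near_chart_inv bz (near_dom az)) => w aw.
by rewrite /= /transition /= chart_mapK.
Qed.

Section Primitive.
Variables (g A : S -> R[i]).
Hypothesis sg : forall c, atlas c -> csmooth (chart_cod c) (fun w => g (chart_inv c w)).
Hypothesis sA : forall c, atlas c -> csmooth (chart_cod c) (fun w => A (chart_inv c w)).

(** The real form considered is 2 Re (A dg^(1,0)), where dg^(1,0) = g_z dz; this is
    its coefficient in the chart c. *)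
Definition one_form c : R[i] -> R[i] :=
  fun z => A (chart_inv c z) * dz (fun w => g (chart_inv c w)) z.

Hypothesis closed_form : forall c z, atlas c -> chart_cod c z ->
  complex.Im (dzbar (one_form c) z) = 0.

Definition primitive_at (f : S -> R) p := forall c, atlas c -> chart_dom c p ->
  is_wirt (fun w => (f (chart_inv c w))%:C) (chart_map c p)
    (one_form c (chart_map c p)) (one_form c (chart_map c p))^*%C.

Lemma csmooth_one_form c : atlas c -> csmooth (chart_cod c) (one_form c).
Proof.
move=> Ac; have oc := @chart_cod_open R S c.
by apply: csmoothM => //; [exact: sA|apply: csmooth_dz => //; exact: sg].
Qed.

(** The coefficient changes by the factor tau' because g_z does, A being a function
    on the surface. *)
Lemma one_form_transition a b z : atlas a -> atlas b ->
  chart_cod b z -> chart_dom a (chart_inv b z) ->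
  one_form b z = one_form a (transition a b z) * cderiv (transition a b) z.
Proof.
move=> Aa Ab bz az.
have cz : chart_cod a (transition a b z) by exact: chart_mapP.
have H := wirt_transition Aa Ab bz az (@chart_cod_open R S a) cz (sg Aa).
rewrite /one_form (is_wirt_dz H) mulrA; congr (A _ * _ * _).
by rewrite /transition /= chart_mapK.
Qed.

(** A primitive found in one chart is a primitive in all the others, by
    [one_form_transition]. *)
Lemma primitive_ex p : exists f, \forall q \near p, primitive_at f q.
Proof.
have [a Aa ap] := atlas_cover p.
have oa := @chart_cod_open R S a.
have [f [r r0 fP]] := local_primitive oa (csmooth_one_form Aa) (chart_mapP ap)
   (fun z => @closed_form a z Aa).
exists (f \o chart_map a).
have nbox : nbhs (chart_map a p : R[i]^o) (interior (box (chart_map a p) r : set R[i]^o)).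
  by apply/nbhs_interior; apply/(nbhs_boxP (chart_map a p)); exists r.
apply: filterS2 (near_dom ap) (near_chart_map ap nbox) => q aq bq c Ac cq.
pose D : set R[i]^o := interior (box (chart_map a p) r : set R[i]^o).
have oD : open D by exact: open_interior.
have Df w : D w -> chart_cod a w /\ is_wirt (fun w => (f w)%:C) w (one_form a w) (one_form a w)^*%C.
  by move=> /interior_subset/fP.
have sform : csmooth D (one_form a).
  have [sr si] := csmooth_one_form Aa.
  have DD : D `<=` chart_cod a by move=> w /Df[].
  by split; [exact: smooth_sub DD sr | exact: smooth_sub DD si].
have sf := real_primitive_smooth oD sform (fun w Dw => (Df w Dw).2).
have cz := chart_mapP cq.
have az : chart_dom a (chart_inv c (chart_map c q)) by rewrite chart_mapK.
have tq : transition a c (chart_map c q) = chart_map a q.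
  by rewrite /transition /= chart_mapK.
have dt : derivable (transition a c) (chart_map c q : R[i]^o) (1 : R[i]^o).
  exact: (atlas_compatible Ac Aa cz az).
have Dt : D (transition a c (chart_map c q)) by rewrite tq.
have H := is_wirt_comp_holomorphic oD (csmooth_real sf) Dt dt.
have [_ fw] := Df _ Dt.
rewrite (is_wirt_dz fw) (is_wirt_dzbar fw) -conjM in H.
by rewrite (one_form_transition Aa Ac cz az).
Qed.

Lemma constant_on_box (f : R[i] -> R) z r :
  (forall w, box z r w -> is_wirt (fun w => (f w)%:C) w 0 0) ->
  forall w, box z r w -> f w = f z.
Proof.
move=> f0 w wr.
have fz e u : axis e -> box z r u -> has_partial e f u /\ partial e f u = 0.
  move=> eE /f0; rewrite -[X in is_wirt _ _ _ X](@conjc0 R) => /is_wirt_real[h1 hi].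
  apply/is_partialP; case: eE => ->; first by move: h1; rewrite /= mulr0.
  by move: hi; rewrite /= mulr0 oppr0.
set h := complex.Re w - complex.Re z; set k := complex.Im w - complex.Im z.
have [hr kr] := wr; rewrite -/h -/k in hr kr.
have a1 : axis (1 : R[i]) by left.
have ai : axis ('i%C : R[i]) by right.
have [|s sh s1] := @MVT_line R 1 f z h.
  by move=> t th; apply: (fz _ _ a1 _).1; apply: box_line1; exact: le_lt_trans hr.
have [|t tk t1] := @MVT_line R 'i%C f (z + h%:C * 1) k.
  move=> t th; apply: (fz _ _ ai _).1; apply: box_line1i => //.
  exact: le_lt_trans kr.
rewrite (fz _ _ a1 _).2 ?mulr0 in s1; last by apply: box_line1; exact: le_lt_trans hr.
rewrite (fz _ _ ai _).2 ?mulr0 in t1; last first.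
  by apply: box_line1i => //; exact: le_lt_trans kr.
have wE : w = z + h%:C * 1 + k%:C * 'i%C by rewrite line1i.
rewrite wE; move/eqP: t1; rewrite subr_eq0 => /eqP ->.
by move/eqP: s1; rewrite subr_eq0 => /eqP ->.
Qed.

Lemma primitive_uniq f f' p : (\forall q \near p, primitive_at f q) ->
  (\forall q \near p, primitive_at f' q) ->
  \forall q \near p, f q - f' q = f p - f' p.
Proof.
move=> fp f'p; have [c Ac cp] := atlas_cover p.
have both : \forall q \near p, primitive_at f q /\ primitive_at f' q.
  by move: fp f'p; apply: filterS2.
have := both; rewrite -{1}(chart_mapK cp) => /(near_chart_inv (chart_mapP cp)) bothc.
have [r r0 rP] : exists2 r : R, 0 < r & forall w, box (chart_map c p) r w ->
    chart_cod c w /\ primitive_at f (chart_inv c w) /\ primitive_at f' (chart_inv c w).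
  apply/(nbhs_boxP (chart_map c p)).
  by move: (near_cod (chart_mapP cp)) bothc; apply: filterS2.
have K := @constant_on_box (fun w => f (chart_inv c w) - f' (chart_inv c w))
  (chart_map c p) r.
have {}K : forall w, box (chart_map c p) r w ->
    f (chart_inv c w) - f' (chart_inv c w) =
    f (chart_inv c (chart_map c p)) - f' (chart_inv c (chart_map c p)).
  apply: K => w /rP[cw [h h']].
  have := h c Ac (chart_invP cw); have := h' c Ac (chart_invP cw).
  rewrite chart_invK // => w' w0.
  have := is_wirtB w0 w'; rewrite !subrr.
  by under eq_fun do rewrite -rmorphB.
have nb : nbhs (chart_map c p : R[i]^o) (box (chart_map c p) r).
  by apply/(nbhs_boxP (chart_map c p)); exists r.
apply: filterS2 (near_dom cp) (near_chart_map cp nb) => q cq /K.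
by rewrite !chart_mapK.
Qed.

Lemma chart_paths p (U : set S) : nbhs p U -> \forall q \near p,
  exists gamma : R -> S, [/\ {within `[0, 1], continuous gamma},
    gamma 0 = p, gamma 1 = q & forall t, 0 <= t <= 1 -> U (gamma t)].
Proof.
move=> Up; have [c Ac cp] := atlas_cover p.
have [r r0 rP] : exists2 r : R, 0 < r & forall w, box (chart_map c p) r w ->
    chart_cod c w /\ U (chart_inv c w).
  apply/(nbhs_boxP (chart_map c p)).
  have := Up; rewrite -{1}(chart_mapK cp) => /(near_chart_inv (chart_mapP cp)).
  by move: (near_cod (chart_mapP cp)); apply: filterS2.
have nb : nbhs (chart_map c p : R[i]^o) (box (chart_map c p) r).
  by apply/(nbhs_boxP (chart_map c p)); exists r.
apply: filterS2 (near_dom cp) (near_chart_map cp nb) => q cq bq.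
set z := chart_map c p in rP nb bq *; set w := chart_map c q in bq *.
pose l (t : R) : R[i] := (complex.Re z + t * (complex.Re w - complex.Re z)) +i*
                (complex.Im z + t * (complex.Im w - complex.Im z)).
have lb t : 0 <= t <= 1 -> box z r (l t).
  move=> /andP[t0 t1]; have [wr wi] := bq.
  have sc (x : R) : `|x| < r -> `|t * x| < r.
    move=> xr; rewrite normrM (ger0_norm t0); apply: le_lt_trans xr.
    by rewrite ler_piMl.
  by split; rewrite /= addrC addKr; exact: sc.
exists (chart_inv c \o l); split.
- apply/subspace_continuousP => t; rewrite /= in_itv /= => /lb/rP[cl _].
  apply: cvg_within_filter.
  have cont_l : l s @[s --> t] --> (l t : R[i]^o).
    move=> V /(nbhs_boxP (l t))[e e0 eV].
    have cR (x y : R) : x + s * y @[s --> t] --> x + t * y.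
      by apply: cvgD; [exact: cvg_cst|apply: cvgM; [exact: cvg_id|exact: cvg_cst]].
    have /cvgrPdist_lt/(_ _ e0) h1 := cR (complex.Re z) (complex.Re w - complex.Re z).
    have /cvgrPdist_lt/(_ _ e0) h2 := cR (complex.Im z) (complex.Im w - complex.Im z).
    change (nbhs t (l @^-1` V)); move: h1 h2; apply: filterS2 => s h1 h2.
    by apply: eV; split; rewrite /l /= distrC.
  exact: (cvg_comp _ _ cont_l (chart_inv_cont cl)).
- have -> : (chart_inv c \o l) 0 = chart_inv c z.
    rewrite /=; congr (chart_inv c _).
    by apply: complex_inj; rewrite /= mul0r addr0.
  exact: chart_mapK.
- have -> : (chart_inv c \o l) 1 = chart_inv c w.
    rewrite /=; congr (chart_inv c _).
    by apply: complex_inj; rewrite /= mul1r addrC subrK.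
  exact: chart_mapK.
- by move=> t /lb/rP[].
Qed.

Theorem surface_primitive (z0 : S) (h0 : R) : simply_connected R S ->
  exists2 F : S -> R, F z0 = h0 & forall p, primitive_at F p.
Proof.
move=> sc.
have [F FP] := global_primitive primitive_ex primitive_uniq sc chart_paths z0.
exists (fun p => F p - F z0 + h0); first by rewrite subrr add0r.
move=> p c Ac cp; have [f fp] := primitive_ex p.
have := FP p f fp; rewrite -{1}(chart_mapK cp) => /(near_chart_inv (chart_mapP cp)) E.
have w := nbhs_singleton fp c Ac cp.
have wc := is_wirtD w (is_wirt_cst (chart_map c p) (F p - f p - F z0 + h0)%:C).
rewrite !addr0 in wc.
apply: is_wirt_near wc; apply: filterS E => u E.
rewrite -rmorphD; congr (_%:C).
by rewrite -[F (chart_inv c u)](subrK (f (chart_inv c u))) E; ring.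
Qed.

Lemma primitive_smooth F : (forall p, primitive_at F p) ->
  forall c, atlas c -> smooth_on (chart_cod c) (fun w => F (chart_inv c w)) /\
   forall z, chart_cod c z -> is_wirt (fun w => (F (chart_inv c w))%:C) z
    (one_form c z) (one_form c z)^*%C.
Proof.
move=> FP c Ac.
have H z : chart_cod c z -> is_wirt (fun w => (F (chart_inv c w))%:C) z
    (one_form c z) (one_form c z)^*%C.
  by move=> cz; have := FP _ c Ac (chart_invP cz); rewrite chart_invK.
split=> //; exact: real_primitive_smooth (@chart_cod_open R S c) (csmooth_one_form Ac) H.
Qed.

End Primitive.

(** The difference is locally constant, hence constant along every path. *)
Lemma equal_differential (f f' : S -> R) (z0 : S) : path_connected R S ->
  f z0 = f' z0 ->
  (forall c z, atlas c -> chart_cod c z -> exists l : R[i],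
     is_wirt (fun w => (f (chart_inv c w))%:C) z l l^*%C /\
     is_wirt (fun w => (f' (chart_inv c w))%:C) z l l^*%C) ->
  f = f'.
Proof.
move=> pc e0 H; apply/funext => p.
have [gamma [/subspace_continuousP cg g0 g1]] := pc z0 p.
have loc q : \forall q' \near q, f q' - f' q' = f q - f' q.
  have [c Ac cq] := atlas_cover q.
  have /(nbhs_boxP (chart_map c q))[r r0 rP] := near_cod (chart_mapP cq).
  have K := @constant_on_box (fun w => f (chart_inv c w) - f' (chart_inv c w))
    (chart_map c q) r.
  have {}K : forall w, box (chart_map c q) r w ->
    f (chart_inv c w) - f' (chart_inv c w) =
    f (chart_inv c (chart_map c q)) - f' (chart_inv c (chart_map c q)).
    apply: K => w /rP cw; have [l [h h']] := H c w Ac cw.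
    have := is_wirtB h h'; rewrite !subrr.
    by under eq_fun do rewrite -rmorphB.
  have nb : nbhs (chart_map c q : R[i]^o) (box (chart_map c q) r).
    by apply/(nbhs_boxP (chart_map c q)); exists r.
  apply: filterS2 (near_dom cq) (near_chart_map cq nb) => q' cq' /K.
  by rewrite !chart_mapK.
have I0 : `[0, 1]%classic (0 : R) by rewrite /= in_itv /= lexx ler01.
have I1 : `[0, 1]%classic (1 : R) by rewrite /= in_itv /= lexx ler01.
have := @connected_locally_constant R R `[0, 1]%classic
  (fun t => f (gamma t) - f' (gamma t)) (@segment_connected R 0 1) _ 0 1 I0 I1.
rewrite g0 g1 e0 subrr => E; apply/eqP; rewrite -subr_eq0; apply/eqP/esym/E.
move=> t It; have := cg t It _ (loc (gamma t)).
by rewrite /= !near_simpl near_withinE.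
Qed.

End Surface.

(** * Existence and uniqueness *)
Section Main.
Variable R : realType.
Variable S : riemann_surface R.
Variable g : S -> R[i].
Hypothesis hg : harmonic_disk_map g.
Hypothesis hgz : nowhere_antiholomorphic g.
Implicit Types (X : S -> 'rV[R]_3) (c : chart R S) (z : R[i]).

Let gc c w := g (chart_inv c w).
Let Xc X c w := X (chart_inv c w).

Lemma g_csmooth c : atlas c -> csmooth (chart_cod c) (gc c).
Proof. by case: hg => _ sg _ Ac; have [] := sg c Ac. Qed.

Lemma g_disk c z : chart_cod c z -> `|gc c z| < 1.
Proof. by case: hg => g1 _ _ _; exact: g1. Qed.

Lemma g_harmonic c z : atlas c -> chart_cod c z ->
  let p := cpartial 1 (gc c) z in let q := cpartial 'i%C (gc c) z in
  cpartial 1 (cpartial 1 (gc c)) z + cpartial 'i%C (cpartial 'i%C (gc c)) z =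
  - (2 * (gc c z)^*%C * (p * p + q * q)) / (1 - gc c z * (gc c z)^*%C).
Proof.
case: hg => g1 _ t0 Ac cz.
by apply: tension_poincare; [exact: g1 | exact: t0].
Qed.

Definition smooth_map X := forall c, atlas c ->
  forall k, smooth_on (chart_cod c) (fun w => Xc X c w 0 k).

Definition isotropic_map X := forall c z, atlas c -> chart_cod c z ->
  isotropic (gc c z) (rep_Fz (gc c) z) (psi (Xc X c) 0 z) (psi (Xc X c) 1 z)
    (phi3 (Xc X c) z).

Lemma solution_isotropic X : conformal_immersion X -> minimal X ->
  is_gauss_map X g -> smooth_map X /\ isotropic_map X.
Proof.
move=> cX mX gX; have sX : smooth_map X by move=> c Ac; have [] := cX c Ac.
split=> // c z Ac cz.
apply: (representation (@chart_cod_open R S c) (g_csmooth Ac) (@g_disk c) (sX c Ac)) => //.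
- by move=> w cw; have [_ h] := cX c Ac; have [_] := h w cw.
- by move=> w cw; exact: gX.
- by move=> w cw; exact: mX.
Qed.

Lemma isotropic_solution X : smooth_map X -> isotropic_map X ->
  [/\ conformal_immersion X, minimal X & is_gauss_map X g].
Proof.
move=> sX iX.
have conf c z (Ac : atlas c) (cz : chart_cod c z) :=
  conformal_of_isotropic (@g_disk c) (sX c Ac) (fun w => @iX c w Ac) cz (hgz Ac cz).
split.
- move=> c Ac; split; first exact: sX.
  by move=> z cz; have [h1 h2 _] := conf c z Ac cz.
- move=> c z Ac cz.
  exact: (minimal_of_isotropic (@chart_cod_open R S c) (g_csmooth Ac) (@g_disk c)
    (sX c Ac) (fun w => @iX c w Ac) (fun w => @g_harmonic c w Ac) cz (hgz Ac cz)).
- by move=> c z Ac cz; have [_ _] := conf c z Ac cz.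
Qed.

Lemma isotropic_unique X Y (z0 : S) : path_connected R S ->
  smooth_map X -> isotropic_map X -> smooth_map Y -> isotropic_map Y ->
  X z0 = Y z0 -> X = Y.
Proof.
move=> pc sX iX sY iY e0.
have wX k c z (Ac : atlas c) (cz : chart_cod c z) :=
  (smooth_real_wirt (sX c Ac k) cz).1.
have wY k c z (Ac : atlas c) (cz : chart_cod c z) :=
  (smooth_real_wirt (sY c Ac k) cz).1.
have comp k : (forall c z, atlas c -> chart_cod c z ->
    psi (Xc X c) k z = psi (Xc Y c) k z) ->
    (fun p => X p 0 k) = (fun p => Y p 0 k).
  move=> E; apply: (@equal_differential R S _ _ z0 pc); first by rewrite e0.
  move=> c z Ac cz; exists (psi (Xc X c) k z); split; first exact: wX.
  by rewrite E //; exact: wY.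
have E0 : (fun p => X p 0 0) = (fun p => Y p 0 0).
  apply: comp => c z Ac cz.
  have [-> _ _] := isotropic_split (iX c z Ac cz).
  by have [-> _ _] := isotropic_split (iY c z Ac cz).
have E1 : (fun p => X p 0 1) = (fun p => Y p 0 1).
  apply: comp => c z Ac cz.
  have [_ -> _] := isotropic_split (iX c z Ac cz).
  by have [_ -> _] := isotropic_split (iY c z Ac cz).
have E2 : (fun p => X p 0 2) = (fun p => Y p 0 2).
  apply: comp => c z Ac cz.
  have [h0 h1 h2] := isotropic_split (iX c z Ac cz).
  have [k0 k1 k2] := isotropic_split (iY c z Ac cz).
  have : phi3 (Xc X c) z = phi3 (Xc Y c) z by rewrite h2 k2.
  rewrite /phi3 h0 h1 k0 k1 /Xc.
  have -> : X (chart_inv c z) 0 0 = Y (chart_inv c z) 0 0 := congr1 (@^~ _) E0.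
  have -> : X (chart_inv c z) 0 1 = Y (chart_inv c z) 0 1 := congr1 (@^~ _) E1.
  exact: addIr.
apply/funext => p; apply: row3P.
- exact: (congr1 (@^~ p) E0).
- exact: (congr1 (@^~ p) E1).
- exact: (congr1 (@^~ p) E2).
Qed.

(** The quotient F_z / g_z. *)
Definition factor (p : S) : R[i] :=
  - 4 * 'i%C * ((1 - g p * (g p)^*%C)^-1 * (1 - g p * (g p)^*%C)^-1).
(** [coef0], [coef1], [coef2] are the functions A for which A g_z is the
    z-derivative of x1, x2, x3. *)
Definition coef0 (p : S) : R[i] :=
  (factor p + (g p)^*%C * (- (g p)^*%C * factor p)) * 2^-1.
Definition coef1 (p : S) : R[i] :=
  - 'i%C * (factor p - (g p)^*%C * (- (g p)^*%C * factor p)) * 2^-1.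
Definition coef2 (x0 x1 : S -> R) (p : S) : R[i] :=
  - (g p)^*%C * factor p -
  2^-1 * ((x1 p)%:C * coef0 p - (x0 p)%:C * coef1 p).

Lemma one_form_coef0 c : one_form g coef0 c = rep_x1z (gc c).
Proof. by apply/funext => z; rewrite /one_form /rep_x1z /coef0 /factor /rep_Fz /gc; ring. Qed.

Lemma one_form_coef1 c : one_form g coef1 c = rep_x2z (gc c).
Proof. by apply/funext => z; rewrite /one_form /rep_x2z /coef1 /factor /rep_Fz /gc; ring. Qed.

Lemma one_form_coef2 x0 x1 c : one_form g (coef2 x0 x1) c = fun z => rep_phi3 (gc c) z -
  2^-1 * ((x1 (chart_inv c z))%:C * rep_x1z (gc c) z -
          (x0 (chart_inv c z))%:C * rep_x2z (gc c) z).
Proof.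
rewrite -one_form_coef0 -one_form_coef1; apply/funext => z.
by rewrite /one_form /rep_phi3 /coef2 /factor /rep_Fz /gc; ring.
Qed.

Section Coefs.
Variable c : chart R S.
Hypothesis Ac : atlas c.
Let oc := @chart_cod_open R S c.

Lemma csmooth_factor : csmooth (chart_cod c) (fun w => factor (chart_inv c w)).
Proof.
have s := csmooth_inv_defect oc (g_csmooth Ac) (@g_disk c).
apply: csmoothM => //; first exact: csmooth_cst.
exact: (csmoothM oc s s).
Qed.

Let sgb := csmooth_conj oc (g_csmooth Ac).

Lemma csmooth_coef0 : csmooth (chart_cod c) (fun w => coef0 (chart_inv c w)).
Proof.
apply: csmoothM => //; last exact: csmooth_cst.
apply: csmoothD => //; first exact: csmooth_factor.
apply: csmoothM => //.
by apply: csmoothM => //; [apply: csmoothN => //; exact: sgb | exact: csmooth_factor].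
Qed.

Lemma csmooth_coef1 : csmooth (chart_cod c) (fun w => coef1 (chart_inv c w)).
Proof.
apply: csmoothM => //; last exact: csmooth_cst.
apply: csmoothM => //; first exact: csmooth_cst.
apply: csmoothB => //; first exact: csmooth_factor.
apply: csmoothM => //.
by apply: csmoothM => //; [apply: csmoothN => //; exact: sgb | exact: csmooth_factor].
Qed.

Lemma csmooth_coef2 (x0 x1 : S -> R) :
  smooth_on (chart_cod c) (fun w => x0 (chart_inv c w)) ->
  smooth_on (chart_cod c) (fun w => x1 (chart_inv c w)) ->
  csmooth (chart_cod c) (fun w => coef2 x0 x1 (chart_inv c w)).
Proof.
move=> s0 s1; apply: csmoothB => //.
  by apply: csmoothM => //; [apply: csmoothN => //; exact: sgb | exact: csmooth_factor].
apply: csmoothM => //; first exact: csmooth_cst.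
apply: csmoothB => //; apply: csmoothM => //; try exact: csmooth_real.
- exact: csmooth_coef0.
- exact: csmooth_coef1.
Qed.

End Coefs.

Lemma isotropic_exists (z0 : S) (F0 : R[i]) (h0 : R) : simply_connected R S ->
  exists X, [/\ smooth_map X, isotropic_map X, nil_F (X z0) = F0 &
    nil_h (X z0) = h0].
Proof.
move=> sc.
have rd c z (Ac : atlas c) (cz : chart_cod c z) :=
  rep_dzbar (@chart_cod_open R S c) (g_csmooth Ac) (@g_disk c)
    (fun w => @g_harmonic c w Ac) cz.
have cl0 c z : atlas c -> chart_cod c z -> complex.Im (dzbar (one_form g coef0 c) z) = 0.
  by move=> Ac cz; have [[a w] _ _] := rd c z Ac cz; rewrite one_form_coef0 (is_wirt_dzbar w).
have cl1 c z : atlas c -> chart_cod c z -> complex.Im (dzbar (one_form g coef1 c) z) = 0.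
  by move=> Ac cz; have [_ [a w] _] := rd c z Ac cz; rewrite one_form_coef1 (is_wirt_dzbar w).
have [x0 x00 px0] := surface_primitive g_csmooth csmooth_coef0 cl0 z0
  (complex.Re F0) sc.
have [x1 x10 px1] := surface_primitive g_csmooth csmooth_coef1 cl1 z0
  (complex.Im F0) sc.
have s0 := primitive_smooth g_csmooth csmooth_coef0 px0.
have s1 := primitive_smooth g_csmooth csmooth_coef1 px1.
have sc2 c : atlas c -> csmooth (chart_cod c) (fun w => coef2 x0 x1 (chart_inv c w)).
  by move=> Ac; apply: csmooth_coef2 => //; [exact: (s0 c Ac).1 | exact: (s1 c Ac).1].
have cl2 c z : atlas c -> chart_cod c z ->
    complex.Im (dzbar (one_form g (coef2 x0 x1) c) z) = 0.
  move=> Ac cz; have w0 := (s0 c Ac).2 z cz; have w1 := (s1 c Ac).2 z cz.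
  rewrite one_form_coef0 in w0; rewrite one_form_coef1 in w1.
  have [a [b w]] := rep_x3z_dzbar (@chart_cod_open R S c) (g_csmooth Ac) (@g_disk c)
    (fun w => @g_harmonic c w Ac) cz w0 w1.
  by rewrite one_form_coef2 (is_wirt_dzbar w).
have [x2 x20 px2] := surface_primitive g_csmooth sc2 cl2 z0 h0 sc.
have s2 := primitive_smooth g_csmooth sc2 px2.
pose X p := row3 (x0 p) (x1 p) (x2 p).
have X0 c : (fun w => Xc X c w 0 0) = (fun w => x0 (chart_inv c w)).
  by apply/funext => w; rewrite /Xc /X row3E.
have X1 c : (fun w => Xc X c w 0 1) = (fun w => x1 (chart_inv c w)).
  by apply/funext => w; rewrite /Xc /X row3E.
have X2 c : (fun w => Xc X c w 0 2) = (fun w => x2 (chart_inv c w)).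
  by apply/funext => w; rewrite /Xc /X row3E.
exists X; split.
- move=> c Ac; apply: ord3P.
  + by rewrite X0; exact: (s0 c Ac).1.
  + by rewrite X1; exact: (s1 c Ac).1.
  + by rewrite X2; exact: (s2 c Ac).1.
- move=> c z Ac cz.
  have P0 : psi (Xc X c) 0 z = rep_x1z (gc c) z.
    rewrite -one_form_coef0 -(is_wirt_dz ((s0 c Ac).2 z cz)).
    exact: (congr1 (fun f => dz (fun w => (f w)%:C) z) (X0 c)).
  have P1 : psi (Xc X c) 1 z = rep_x2z (gc c) z.
    rewrite -one_form_coef1 -(is_wirt_dz ((s1 c Ac).2 z cz)).
    exact: (congr1 (fun f => dz (fun w => (f w)%:C) z) (X1 c)).
  have P2 : psi (Xc X c) 2 z = one_form g (coef2 x0 x1) c z.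
    rewrite -(is_wirt_dz ((s2 c Ac).2 z cz)).
    exact: (congr1 (fun f => dz (fun w => (f w)%:C) z) (X2 c)).
  have P3 : phi3 (Xc X c) z = rep_phi3 (gc c) z.
    by rewrite /phi3 P0 P1 P2 one_form_coef2 /Xc /X !row3E subrK.
  by rewrite P0 P1 P3; exact: isotropic_rep.
- by rewrite /nil_F /X !row3E x00 x10; case: (F0).
- by rewrite /nil_h /X row3E x20.
Qed.

End Main.

Theorem theorem4p1 (R : realType) (S : riemann_surface R)
  (hS : simply_connected R S)
  (g : S -> R[i]) (hg : harmonic_disk_map g) (hgz : nowhere_antiholomorphic g)
  (z0 : S) (F0 : R[i]) (h0 : R) :
  let solution (X : S -> 'rV[R]_3) :=
    [/\ conformal_immersion X, minimal X, is_gauss_map X g &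
        nil_F (X z0) = F0 /\ nil_h (X z0) = h0] in
  (exists! X : S -> 'rV[R]_3, solution X) /\
  (forall X : S -> 'rV[R]_3, solution X ->
   forall c z, atlas c -> chart_cod c z ->
   let gc := fun w => g (chart_inv c w) in
   let Fc := fun w => nil_F (X (chart_inv c w)) in
   let hc := fun w => nil_h (X (chart_inv c w)) in
   [/\ dz Fc z = - 4 * 'i%C * (dz gc z / (1 - `|gc z| ^+ 2) ^+ 2),
       dzbar Fc z =
         - 4 * 'i%C * (gc z ^+ 2 * dzbar (fun w => (gc w)^*%C) z
                     / (1 - `|gc z| ^+ 2) ^+ 2) &
       dz (fun w => (hc w)%:C) z =
         4 * 'i%C * ((gc z)^*%C * dz gc z / (1 - `|gc z| ^+ 2) ^+ 2)
         - 'i%C / 4 * ((Fc z)^*%C * dz Fc z - Fc z * dz (fun w => (Fc w)^*%C) z)]).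
Proof.
move=> solution; split.
- have [X [sX iX FX hX]] := isotropic_exists hg z0 F0 h0 hS.
  have [cX mX gX] := isotropic_solution hg hgz sX iX.
  exists X; split; first by split.
  move=> Y [cY mY gY [FY hY]].
  have [sY iY] := solution_isotropic hg cY mY gY.
  apply: (isotropic_unique (z0 := z0) hS.1 sX iX sY iY).
  move: FX; rewrite -FY => -[e0 e1]; apply: row3P => //.
  exact: etrans hX (esym hY).
- move=> X [cX mX gX _] c z Ac cz gc Fc hc.
  have [sX iX] := solution_isotropic hg cX mX gX.
  exact: (isotropic_formulas (g_csmooth hg Ac) (sX c Ac) cz (iX c z Ac cz)).
Qed.
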